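(* Let $\lambda/\mu$ be a skew Young diagram inside the $k\times(n-k)$ rectangle, and let $D$ be the Le-diagram of shape $\lambda$ with dots exactly in the boxes of $\lambda/\mu$. For each box $(a,b)$ of $\lambda$ let $k_{a,b}$ be the maximal number such that $(a+k_{a,b},b+k_{a,b})$ is a box of $\lambda$, and put $X_{a,b}=\{a,a+1,\dots,a+k_{a,b}\}$, $Y_{a,b}=\{b,b+1,\dots,b+k_{a,b}\}$. Write $D_{a,b}:=\Delta_{X_{a,b},Y_{a,b}}$ if $(a,b)$ is a box of $\lambda$, and $D_{a,b}:=1$ otherwise. Let $\mathcal S'$ be the set of Plücker variables $\Delta_{X_{a,b},Y_{a,b}}$ for all dots $(a,b)$ of $D$ (together with $\Delta_{\emptyset,\emptyset}$). Then: 1. With the normalization $\Delta_{\emptyset,\emptyset}=1$, the weight $x_e$ of the horizontal edge $e$ of the Le-network of $D$ heading towards the dot $(x,y)$ is $$x_e=\frac{D_{x,y}\,D_{x+1,y+2}}{D_{x,y+1}\,D_{x+1,y+1}}.$$ 2. $\mathcal S'$ is a TP-basis of the cell $S_D^{tnn}$ that is mutation equivalent to the canonical TP-basis of the cell. 3. $\mathcal S'$ is a cluster in the canonical cluster algebra associated to the cell.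
   Context: **Le-diagrams.** Rectangle in English notation: rows $1,\dots,k$ top to bottom, columns $1,\dots,n-k$ left to right; $(x,y)$ is the box in row $x$, column $y$. A Le-diagram $D$ of shape $\lambda$ is a choice, for each box of the Young diagram $\lambda$, to be empty or to contain a dot, such that for boxes $(i,j),(i',j),(i,j')$ of $\lambda$ with $i'<i$, $j'<j$: if $(i',j)$ and $(i,j')$ contain dots, so does $(i,j)$. The southeast boundary of $\lambda$ is a lattice path from the upper-right to the lower-left corner of the rectangle; label its steps $1,\dots,n$ in order. Let $I=\{i_1<\dots<i_k\}$ be the labels of vertical steps ($i_x$ at the right end of row $x$) and $[n]\setminus I=\{j_1>\dots>j_{n-k}\}$ ($j_y$ at the bottom of column $y$). **Le-network and cell.** Put a boundary vertex at the midpoint of each boundary step. From each dot draw a horizontal line to the right and a vertical line down until the boundary is reached (the Le-graph). The vertices are the dots and the boundary vertices (all crossings are dots). Direct horizontal edges left and vertical edges down. Vertical edges have weight $1$; each horizontal edge $e$ has a weight $x_e>0$ and heads towards exactly one dot. Let $M_{i_x,j}=\sum_P\prod_{e\in P}x_e$ over directed paths from $i_x$ to $j$; let $A$ be the $k\times n$ matrix whose columns indexed by $I$ form the identity and with entries $a_{x,j}=(-1)^sM_{i_x,j}$ for $j\notin I$, $s$ being the number of elements of $I$ strictly between $i_x$ and $j$. The cell $S_D^{tnn}\subset Gr_{k,n}^{tnn}$ is the set of points represented by such $A$ for all positive weights; the weights are coordinates on the cell. **Plücker variables.** For $X\subseteq[k]$, $Y\subseteq[n-k]$, $|X|=|Y|$: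 $\Delta_{X,Y}=\Delta_{(I\setminus\{i_x:x\in X\})\cup\{j_y:y\in Y\}}$; $\Delta_{\emptyset,\emptyset}=\Delta_I$. They are regarded as functions on the $k\times n$ matrices representing points of the cell; one is nonzero in the cell if it is positive on it. $\Delta_{\emptyset,\emptyset}$ is always counted as a member of the sets considered. **TP-basis.** A set $\mathcal B$ of algebraically independent Plücker variables (nonzero in the cell) such that every other Plücker variable nonzero in the cell is a subtraction-free rational function of the variables in $\mathcal B$. **Canonical TP-basis.** For a dot at $(a,b)$, if there are dots in boxes $(x,y)$ with $x<a,y<b$, there is a unique maximal one among them (for the order generated by: same row, further right is bigger; same column, further below is bigger); it covers the dot at $(a,b)$. For each dot form the maximal chain starting at it in which each dot is covered by the next; if the chain occupies rows $X$ and columns $Y$, the dot is labelled $\Delta_{X,Y}$. The canonical TP-basis consists of these labels and $\Delta_{\emptyset,\emptyset}$. **Mutation equivalence.** Given a three-term Plücker relation $\Delta_{H_1}\Delta_{H_2}=\Delta_{H_3}\Delta_{H_4}+\Delta_{H_5}\Delta_{H_6}$ (i.e. $\Delta_{Sac}\Delta_{Sbd}=\Delta_{Sab}\Delta_{Scd}+\Delta_{Sad}\Delta_{Sbc}$, $a<b<c<d$ outside $S$, $|S|=k-2$, the two terms on the right in either order), $\mathcal S'$ is obtained from $\mathcal S$ by a Plücker mutation if: (i) $\Delta_{H_2},\dots,\Delta_{H_6}\in\mathcal S$, $\Delta_{H_1}\notin\mathcal S$, $\mathcal S'=(\mathcal S\setminus\{\Delta_{H_2}\})\cup\{\Delta_{H_1}\}$;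 or (ii) $\Delta_{H_3}$ or $\Delta_{H_4}$ is zero in the cell, $\Delta_{H_2},\Delta_{H_5},\Delta_{H_6}\in\mathcal S$, $\Delta_{H_1}\notin\mathcal S$, $\mathcal S'=(\mathcal S\setminus\{\Delta_{H_2}\})\cup\{\Delta_{H_1}\}$; or (iii) $\Delta_{H_3}$ or $\Delta_{H_4}$ is zero in the cell, $\Delta_{H_1},\Delta_{H_2},\Delta_{H_6}\in\mathcal S$, $\Delta_{H_5}\notin\mathcal S$, $\mathcal S'=(\mathcal S\setminus\{\Delta_{H_6}\})\cup\{\Delta_{H_5}\}$. Two sets are mutation equivalent if one is obtained from the other by a sequence of Plücker mutations. **Canonical cluster algebra of the cell.** Draw the Le-graph in a disk with the boundary vertices on the boundary circle. Turn it into the canonical plabic graph: a dot with edges to the right, down and left becomes a white vertex; a dot with edges to the right, down and up becomes a black vertex; a dot with edges in all four directions is replaced by a black vertex carrying the up and right edges, joined by a new edge to a white vertex carrying the left and down edges; a dot with only right and down edges is a bend of an edge. Each face other than the outermost northwest one lies immediately southeast of exactly one dot, and is given the canonical label of that dot; the northwest face is labelled $\Delta_{\emptyset,\emptyset}$. The quiver has one vertex per face and one arrow crossing each edge whose endpoints have different colours, oriented so that the white endpoint is always on the same fixed side (say left) of the arrow; 2-cycles are cancelled. Faces touching the boundary circle are frozen. The labels (as algebraically independent elements) and this quiver form the initial seed. Seeds are mutated at non-frozen vertices in the usual way ($x_v'x_v=\prod_{u\to v}x_u+\prod_{v\to w}x_w$, with quiver mutation); a cluster is the set of all variables (frozen ones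 included) of a seed reachable from the initial seed. *)

(* Defs.v *)
From mathcomp Require Import all_boot all_order all_algebra.
From mathcomp Require Export mpoly.
From Stdlib Require Import Relation_Operators.

Set Implicit Arguments.
Unset Strict Implicit.
Unset Printing Implicit Defensive.

Import Order.TTheory GRing.Theory Num.Theory.
Local Open Scope ring_scope.

(* The rectangle has [k] rows and [m] columns, with [n = k + m].  Rows,
   columns and boundary steps are numbered from 0. *)

Notation box k m := ('I_k * 'I_m)%type.

(* The order on boxes generated by "same row, further right is bigger" and
   "same column, further below is bigger". *)
Definition box_le k m (p q : box k m) : bool :=
  ((p.1 <= q.1) && (p.2 <= q.2))%N.

Definition young_diagram k m (lam : {set box k m}) : Prop :=
  forall p q : box k m, q \in lam -> box_le p q -> p \in lam.

Definition le_diagram k m (lam D : {set box k m}) : Prop :=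
  [/\ young_diagram lam, D \subset lam &
      forall (i i' : 'I_k) (j j' : 'I_m), (i' < i)%N -> (j' < j)%N ->
        (i, j) \in lam -> (i', j) \in D -> (i, j') \in D -> (i, j) \in D].

Lemma skew_le_diagram k m (lam mu : {set box k m}) :
  young_diagram lam -> young_diagram mu -> mu \subset lam ->
  le_diagram lam (lam :\: mu).
Proof.
move=> yl ym _; split=> //; first exact: subsetDl.
move=> i i' j j' ii' jj' ijl; rewrite !inE => /andP[ij'm _] _.
rewrite ijl andbT; apply: contra ij'm => /ym; apply.
by rewrite /box_le /= leqnn ltnW.
Qed.

(* Membership of the box with arbitrary natural coordinates, which may fall
   outside the rectangle. *)
Definition has_box k m (lam : {set box k m}) (a b : nat) : bool :=
  [exists p in lam, (p.1 == a :> nat) && (p.2 == b :> nat)].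

Lemma vlab_subproof k m (x : 'I_k) (l : nat) : (x + (m - l) < k + m)%N.
Proof. by rewrite -addSn; apply: leq_add => //; apply: leq_subr. Qed.

Lemma hlab_subproof k m (y : 'I_m) (A : {set 'I_k}) :
  (#|A| + (m - y.+1) < k + m)%N.
Proof.
rewrite -addnS; apply: leq_add; first by rewrite -[leqRHS]card_ord max_card.
by rewrite ltn_subrL /= (leq_trans _ (ltn_ord y)).
Qed.

(* The vertical step of row [x] is preceded by the vertical steps of the rows
   above and by [m - lam_x] horizontal steps. *)
Definition vlab k m (lam : {set box k m}) (x : 'I_k) : 'I_(k + m) :=
  Ordinal (vlab_subproof m x #|[set y : 'I_m | (x, y) \in lam]|).

(* The horizontal step of column [y] is preceded by the horizontal steps of the
   columns to the right and by the vertical steps of the rows meeting [lam] in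
   column [y]. *)
Definition hlab k m (lam : {set box k m}) (y : 'I_m) : 'I_(k + m) :=
  Ordinal (hlab_subproof y [set x : 'I_k | (x, y) \in lam]).

Definition vlabs k m (lam : {set box k m}) : {set 'I_(k + m)} :=
  [set vlab lam x | x : 'I_k].

(* [q] is the next dot to the right of [p] in its row. *)
Definition row_next k m (D : {set box k m}) (p q : box k m) : bool :=
  [&& p \in D, q \in D, p.1 == q.1, (p.2 < q.2)%N &
      ~~ [exists y : 'I_m, ((p.1, y) \in D) && (p.2 < y < q.2)%N]].

(* [q] is the next dot below [p] in its column. *)
Definition col_next k m (D : {set box k m}) (p q : box k m) : bool :=
  [&& p \in D, q \in D, p.2 == q.2, (p.1 < q.1)%N &
      ~~ [exists x : 'I_k, ((x, p.2) \in D) && (p.1 < x < q.1)%N]].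

Notation net_vertex k m := ((box k m) + 'I_(k + m))%type.

Definition net_hedge k m (lam D : {set box k m}) (u v : net_vertex k m) : bool :=
  match u, v with
  | inl q, inl p => row_next D p q
  | inr i, inl p =>
      [&& p \in D, i == vlab lam p.1 & ~~ [exists q, row_next D p q]]
  | _, _ => false
  end.

Definition net_vedge k m (lam D : {set box k m}) (u v : net_vertex k m) : bool :=
  match u, v with
  | inl p, inl q => col_next D p q
  | inl p, inr j =>
      [&& p \in D, j == hlab lam p.2 & ~~ [exists q, col_next D p q]]
  | _, _ => false
  end.

Definition net_edge k m (lam D : {set box k m}) : rel (net_vertex k m) :=
  [rel u v | net_hedge lam D u v || net_vedge lam D u v].

(* [w p] is the weight of the horizontal edge heading towards the dot [p]. *)
Definition net_weight k m (R : comNzRingType) (lam D : {set box k m})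
    (w : box k m -> R) (u v : net_vertex k m) : R :=
  if net_hedge lam D u v then (if v is inl p then w p else 1) else 1.

(* The network is acyclic, so a path has fewer edges than there are vertices;
   a path is given by its successive vertices after the source. *)
Definition path_sum k m (R : comNzRingType) (lam D : {set box k m})
    (w : box k m -> R) (u v : net_vertex k m) : R :=
  \sum_(l < #|{: net_vertex k m}|)
    \sum_(P : l.-tuple (net_vertex k m)
            | path (net_edge lam D) u P && (last u P == v))
      \prod_(e <- zip (u :: P) P) net_weight lam D w e.1 e.2.

Definition strictly_between (i j l : nat) : bool :=
  ((i < l < j) || (j < l < i))%N.

Definition le_matrix k m (R : comNzRingType) (lam D : {set box k m})
    (w : box k m -> R) : 'M[R]_(k, k + m) :=
  \matrix_(x, j)
    if j \in vlabs lam then (j == vlab lam x)%:R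
    else (-1) ^+ #|[set i in vlabs lam | strictly_between (vlab lam x) j i]|
         * path_sum lam D w (inr (vlab lam x)) (inr j).

Definition positive_weights k m (R : realFieldType) (D : {set box k m})
    (w : box k m -> R) : Prop :=
  forall p, p \in D -> 0 < w p.

(* The representing matrices of the point with weights [w]; [0 < \det g] selects
   those whose maximal minors are nonnegative. *)
Definition represents k m (R : realFieldType) (lam D : {set box k m})
    (w : box k m -> R) (M : 'M[R]_(k, k + m)) : Prop :=
  exists2 g : 'M[R]_k, 0 < \det g & M = g *m le_matrix lam D w.

Definition in_cell k m (R : realFieldType) (lam D : {set box k m})
    (M : 'M[R]_(k, k + m)) : Prop :=
  exists2 w : box k m -> R, positive_weights D w & represents lam D w M.

(* The maximal minor in the columns [H], taken in increasing order (as listed by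
   [enum H]); meaningful when [#|H| = k], the default of [nth] being then unused.
   A Plücker variable is encoded by its set of columns: positive rescalings of
   the columns preserve the cell, so variables which are nonzero in the cell are
   distinct functions on it when their index sets are distinct. *)
Definition plucker k m (R : comNzRingType) (H : {set 'I_(k + m)})
    (M : 'M[R]_(k, k + m)) : R :=
  \det (colsub (fun j : 'I_k => nth (lshift m j) (enum H) j) M).

Definition plucker_index k m (lam : {set box k m})
    (X : {set 'I_k}) (Y : {set 'I_m}) : {set 'I_(k + m)} :=
  (vlabs lam :\: [set vlab lam x | x in X]) :|: [set hlab lam y | y in Y].

Definition zero_in_cell (R : realFieldType) k m (lam D : {set box k m})
    (H : {set 'I_(k + m)}) : Prop :=
  forall M : 'M[R]_(k, k + m), in_cell lam D M -> plucker H M = 0.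

Definition nonzero_in_cell (R : realFieldType) k m (lam D : {set box k m})
    (H : {set 'I_(k + m)}) : Prop :=
  forall M : 'M[R]_(k, k + m), in_cell lam D M -> 0 < plucker H M.

Definition alg_independent (R : realFieldType) k m (lam D : {set box k m})
    (B : {set {set 'I_(k + m)}}) : Prop :=
  forall f : {mpoly R[#|B|]},
    (forall M : 'M[R]_(k, k + m), in_cell lam D M ->
       f.@[fun i => plucker (enum_val i) M] = 0) ->
    f = 0.

Inductive sf_expr (T : Type) : Type :=
  | SFvar of T
  | SFone
  | SFadd of sf_expr T & sf_expr T
  | SFmul of sf_expr T & sf_expr T
  | SFdiv of sf_expr T & sf_expr T.

Arguments SFone {T}.

Fixpoint sf_eval (T : Type) (R : fieldType) (x : T -> R) (e : sf_expr T) : R :=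
  match e with
  | SFvar v => x v
  | SFone => 1
  | SFadd e1 e2 => sf_eval x e1 + sf_eval x e2
  | SFmul e1 e2 => sf_eval x e1 * sf_eval x e2
  | SFdiv e1 e2 => sf_eval x e1 / sf_eval x e2
  end.

(* No denominator vanishes below when the members of [B] are positive on the
   cell. *)
Definition subtraction_free_in (R : realFieldType) k m (lam D : {set box k m})
    (B : {set {set 'I_(k + m)}}) (H : {set 'I_(k + m)}) : Prop :=
  exists e : sf_expr {G : {set 'I_(k + m)} | G \in B},
    forall M : 'M[R]_(k, k + m), in_cell lam D M ->
      plucker H M = sf_eval (fun G => plucker (val G) M) e.

Definition tp_basis (R : realFieldType) k m (lam D : {set box k m})
    (B : {set {set 'I_(k + m)}}) : Prop :=
  [/\ vlabs lam \in B,
      forall H : {set 'I_(k + m)}, H \in B -> #|H| = k /\ nonzero_in_cell R lam D H,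
      alg_independent R lam D B &
      forall H : {set 'I_(k + m)}, #|H| = k -> H \notin B -> nonzero_in_cell R lam D H ->
        subtraction_free_in R lam D B H].

Definition strictly_nw k m (q p : box k m) : bool :=
  ((q.1 < p.1) && (q.2 < p.2))%N.

Definition covering_dot k m (D : {set box k m}) (p : box k m) : option (box k m) :=
  [pick q in D | strictly_nw q p &
     [forall r in D, strictly_nw r p && box_le q r ==> (r == q)]].

Definition maximal_chain k m (D : {set box k m}) (p : box k m) :
    {set box k m} :=
  [set q | connect [rel u v | covering_dot D u == Some v] p q].

Definition canonical_label k m (lam D : {set box k m}) (p : box k m) :
    {set 'I_(k + m)} :=
  plucker_index lam [set q.1 | q in maximal_chain D p]
                    [set q.2 | q in maximal_chain D p].

Definition canonical_tp_basis k m (lam D : {set box k m}) :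
    {set {set 'I_(k + m)}} :=
  vlabs lam |: [set canonical_label lam D p | p in D].

(* [H1 H2 = H3 H4 + H5 H6]; the factors of each product and the two terms on the
   right may come in any order. *)
Definition three_term_plucker k m (H1 H2 H3 H4 H5 H6 : {set 'I_(k + m)}) :
    Prop :=
  exists (S : {set 'I_(k + m)}) (a b c d : 'I_(k + m)),
    [/\ #|S|.+2 = k, (a < b < c)%N && (c < d)%N,
        [disjoint S & [set a; b; c; d]],
        [set H1; H2] = [set a |: (c |: S); b |: (d |: S)] &
        ([set H3; H4] = [set a |: (b |: S); c |: (d |: S)] /\
         [set H5; H6] = [set a |: (d |: S); b |: (c |: S)])
        \/
        ([set H3; H4] = [set a |: (d |: S); b |: (c |: S)] /\
         [set H5; H6] = [set a |: (b |: S); c |: (d |: S)])].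

(* The variable indexed by [vlabs lam] belongs to all the sets considered. *)
Definition plucker_mutation (R : realFieldType) k m (lam D : {set box k m})
    (S S' : {set {set 'I_(k + m)}}) : Prop :=
  [/\ vlabs lam \in S, vlabs lam \in S' &
   exists H1 H2 H3 H4 H5 H6 : {set 'I_(k + m)},
   three_term_plucker H1 H2 H3 H4 H5 H6 /\
   [\/ [/\ [set H2; H3; H4; H5; H6] \subset S, H1 \notin S &
           S' = H1 |: (S :\ H2)],
       [/\ zero_in_cell R lam D H3 \/ zero_in_cell R lam D H4,
           [set H2; H5; H6] \subset S, H1 \notin S &
           S' = H1 |: (S :\ H2)] |
       [/\ zero_in_cell R lam D H3 \/ zero_in_cell R lam D H4,
           [set H1; H2; H6] \subset S, H5 \notin S &
           S' = H5 |: (S :\ H6)]]].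

Definition mutation_equivalent (R : realFieldType) k m (lam D : {set box k m})
    (S S' : {set {set 'I_(k + m)}}) : Prop :=
  clos_refl_trans _ (plucker_mutation R lam D) S S' \/
  clos_refl_trans _ (plucker_mutation R lam D) S' S.

(* [quiver u v] is the number of arrows [u -> v] minus the number of arrows
   [v -> u] (2-cycles being cancelled). *)
Record seed (F : fieldType) (V : finType) := Seed {
  seed_var : V -> F;
  quiver : V -> V -> int
}.

Definition arrows (V : finType) (b : V -> V -> int) (u v : V) : int :=
  Num.max 0 (b u v).

Definition mutate_var (F : fieldType) (V : finType) (s : seed F V) (v : V) : F :=
  (\prod_(u : V) seed_var s u ^+ `|arrows (quiver s) u v|%N
   + \prod_(u : V) seed_var s u ^+ `|arrows (quiver s) v u|%N)
  / seed_var s v.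

Definition mutate_quiver (V : finType) (b : V -> V -> int) (v : V) :
    V -> V -> int :=
  fun u u' =>
    if (u == v) || (u' == v) then - b u u'
    else b u u' + arrows b u v * arrows b v u' - arrows b u' v * arrows b v u.

Definition mutate_seed (F : fieldType) (V : finType) (v : V) (s : seed F V) :
    seed F V :=
  Seed (fun u => if u == v then mutate_var s v else seed_var s u)
       (mutate_quiver (quiver s) v).

Inductive reachable (F : fieldType) (V : finType) (frozen : pred V)
    (s0 : seed F V) : seed F V -> Prop :=
  | reachable0 : reachable frozen s0 s0
  | reachableS s v : reachable frozen s0 s -> ~~ frozen v ->
      reachable frozen s0 (mutate_seed v s).

(* A face is named by the dot it lies immediately southeast of, the northwest
   face being [None]. *)
Notation face D := (option {p | p \in D}).

(* [(i, j)] is the common corner of the boxes [(i-1, j-1)] and [(i, j)].  The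
   lines of the Le-graph run through the middles of the boxes and so avoid the
   corners: each face is a union of neighbourhoods of corners. *)
Notation corner k m := ('I_k.+1 * 'I_m.+1)%type.

Definition nw_corner k m (p : box k m) : corner k m := (inord p.1, inord p.2).
Definition ne_corner k m (p : box k m) : corner k m := (inord p.1, inord p.2.+1).
Definition sw_corner k m (p : box k m) : corner k m := (inord p.1.+1, inord p.2).
Definition se_corner k m (p : box k m) : corner k m :=
  (inord p.1.+1, inord p.2.+1).

(* The corners of the closed region lying northwest of the boundary path,
   including the top and left sides of the rectangle. *)
Definition in_region k m (lam : {set box k m}) (c : corner k m) : bool :=
  [|| c.1 == 0%N :> nat, c.2 == 0%N :> nat | has_box lam c.1.-1 c.2.-1].

(* [c'] is the corner next to [c] on its right, resp. below it, and the side
   joining them does not meet the vertical, resp. horizontal, line of the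
   Le-graph in the column, resp. row, in question. *)
Definition unseparated k m (lam D : {set box k m}) (c c' : corner k m) : bool :=
  [&& in_region lam c, in_region lam c' &
      [&& c'.1 == c.1, c'.2 == c.2.+1 :> nat &
          ~~ [exists p in D, (p.2 == c.2 :> nat) && (p.1 < c.1)%N]]
   || [&& c'.2 == c.2, c'.1 == c.1.+1 :> nat &
          ~~ [exists p in D, (p.1 == c.1 :> nat) && (p.2 < c.2)%N]]].

Definition same_face k m (lam D : {set box k m}) : rel (corner k m) :=
  connect [rel c c' | unseparated lam D c c' || unseparated lam D c' c].

Definition face_of k m (lam D : {set box k m}) (c : corner k m) : face D :=
  [pick p : {p | p \in D} | same_face lam D (se_corner (val p)) c].

(* The arcs between consecutive boundary vertices correspond to the corners on
   the boundary path, i.e. to the corners of the region whose southeast box is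
   not in [lam]; the arc between the last and the first boundary vertex borders
   the northwest face. *)
Definition face_frozen k m (lam D : {set box k m}) : pred (face D) :=
  fun f => (f == None) ||
    [exists c : corner k m,
       [&& in_region lam c, ~~ has_box lam c.1 c.2 & face_of lam D c == f]].

Inductive color := White | Black.

Definition has_left k m (D : {set box k m}) (q : box k m) : bool :=
  [exists p, row_next D p q].

Definition has_up k m (D : {set box k m}) (q : box k m) : bool :=
  [exists p, col_next D p q].

Definition is_bend k m (D : {set box k m}) (p : box k m) : bool :=
  ~~ has_left D p && ~~ has_up D p.

(* Colours of the vertices carrying the four edges at a dot, the vertex
   replacing the dot if there is only one; a left edge is always carried by a
   white vertex and an up edge by a black one. *)
Definition right_color k m (D : {set box k m}) (p : box k m) : option color :=
  if has_up D p then Some Black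
  else if has_left D p then Some White else None.

Definition down_color k m (D : {set box k m}) (p : box k m) : option color :=
  if has_left D p then Some White
  else if has_up D p then Some Black else None.

(* The colour of the endpoint reached by going west along an edge that arrives at
   the dot [p]: at a bend the edge turns down, and ends at the black vertex of the
   next dot below or at an (uncoloured) boundary vertex. *)
Definition west_end_color k m (D : {set box k m}) (p : box k m) : option color :=
  if is_bend D p then
    if [exists r, col_next D p r] then Some Black else None
  else right_color D p.

(* An edge with the colours of its endpoints and the faces on its left and on
   its right when going from the first endpoint to the second. *)
Record plabic_edge (Face : Type) := PlabicEdge {
  end1 : option color;
  end2 : option color;
  left_face : Face;
  right_face : Face
}.

(* From west to east, with [q] next to the right of [p]. *)
Definition horizontal_edge k m (lam D : {set box k m}) (p q : box k m) :
    plabic_edge (face D) :=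
  PlabicEdge (west_end_color D p) (Some White)
    (face_of lam D (nw_corner q)) (face_of lam D (sw_corner q)).

(* From north to south, with [q] next below [p], which is not a bend. *)
Definition vertical_edge k m (lam D : {set box k m}) (p q : box k m) :
    plabic_edge (face D) :=
  PlabicEdge (down_color D p) (Some Black)
    (face_of lam D (ne_corner q)) (face_of lam D (nw_corner q)).

(* The new edge at a dot with four edges, from the (northeastern) black vertex to
   the (southwestern) white one. *)
Definition inner_edge k m (lam D : {set box k m}) (p : box k m) :
    plabic_edge (face D) :=
  PlabicEdge (Some Black) (Some White)
    (face_of lam D (se_corner p)) (face_of lam D (nw_corner p)).

(* The edges not listed have a boundary vertex as an endpoint, which has no
   colour, so no arrow crosses them. *)
Definition plabic_edges k m (lam D : {set box k m}) :
    seq (plabic_edge (face D)) :=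
  [seq horizontal_edge lam D e.1 e.2
     | e <- enum [set e : box k m * box k m | row_next D e.1 e.2]]
  ++ [seq vertical_edge lam D e.1 e.2
     | e <- enum [set e : box k m * box k m
                    | col_next D e.1 e.2 & ~~ is_bend D e.1]]
  ++ [seq inner_edge lam D p
     | p <- enum [set p in D | has_left D p & has_up D p]].

(* The arrow crossing an edge, with the white endpoint on its left. *)
Definition dual_arrow (Face : Type) (e : plabic_edge Face) :
    option (Face * Face) :=
  match end1 e, end2 e with
  | Some Black, Some White => Some (left_face e, right_face e)
  | Some White, Some Black => Some (right_face e, left_face e)
  | _, _ => None
  end.

Definition canonical_quiver k m (lam D : {set box k m}) (u v : face D) : int :=
  let arr := pmap (@dual_arrow _) (plabic_edges lam D) in
  (count_mem (u, v) arr)%:Z - (count_mem (v, u) arr)%:Z.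

(* The ambient field: the initial variables are indeterminates indexed by the
   faces. *)
Notation cluster_field R D :=
  {fraction {mpoly R[#|{: face D}|]}}.

Definition initial_seed (R : realFieldType) k m (lam D : {set box k m}) :
    seed (cluster_field R D) (face D) :=
  Seed (fun v : face D =>
          tofrac ('X_(enum_rank v) : {mpoly R[#|{: face D}|]}))
       (@canonical_quiver k m lam D).

Definition face_label k m (lam D : {set box k m}) (v : face D) :
    {set 'I_(k + m)} :=
  if v is Some p then canonical_label lam D (val p) else vlabs lam.

(* Substituting the canonical labels for the initial variables in the rational
   function [f] gives the Plücker variable indexed by [H]. *)
Definition specializes_to (R : realFieldType) k m (lam D : {set box k m})
    (f : cluster_field R D) (H : {set 'I_(k + m)}) : Prop :=
  exists p q : {mpoly R[#|{: face D}|]},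
    f = tofrac p / tofrac q /\
    forall M : 'M[R]_(k, k + m), in_cell lam D M ->
      let x i := plucker (face_label lam (enum_val i)) M in
      q.@[x] != 0 /\ plucker H M = p.@[x] / q.@[x].

Definition is_cluster (R : realFieldType) k m (lam D : {set box k m})
    (S : {set {set 'I_(k + m)}}) : Prop :=
  exists2 s : seed (cluster_field R D) (face D),
    reachable (face_frozen lam (D := D)) (initial_seed R lam D) s &
    (forall v, exists2 H : {set 'I_(k + m)}, H \in S & specializes_to lam (seed_var s v) H) /\
    (forall H : {set 'I_(k + m)}, H \in S -> exists v, specializes_to lam (seed_var s v) H).

(* The maximal [d] such that the box [(a + d, b + d)] is in [lam]. *)
Definition diag_len k m (lam : {set box k m}) (a b : nat) : nat :=
  \max_(d < k | has_box lam (a + d) (b + d)) d.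

Definition diag_index k m (lam : {set box k m}) (a b : nat) :
    {set 'I_(k + m)} :=
  plucker_index lam
    [set x : 'I_k | (a <= x <= a + diag_len lam a b)%N]
    [set y : 'I_m | (b <= y <= b + diag_len lam a b)%N].

Definition diag_minor k m (R : comNzRingType) (lam : {set box k m})
    (M : 'M[R]_(k, k + m)) (a b : nat) : R :=
  if has_box lam a b then plucker (diag_index lam a b) M else 1.

Definition diag_set k m (lam D : {set box k m}) : {set {set 'I_(k + m)}} :=
  vlabs lam |: [set diag_index lam p.1 p.2 | p : box k m in D].

(* Main.v *)
Require Import Defs.
From mathcomp Require Import all_boot all_order all_fingroup all_algebra.
From mathcomp Require Import zify ring.
From Stdlib Require Import Relation_Operators.

(** Let [z] be a southeast corner box of [lam] carrying a dot of weight [w], and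
   let [i], [i+1] be the labels of its two boundary steps.  Up to a row operation
   of determinant [w], the matrix of the network is obtained from the one of
   [lam] without [z] by replacing the columns [u_i], [u_(i+1)] by
   [(u_i + u_(i+1)) / w] and [u_(i+1)].  Hence the maximal minors satisfy a
   recursion over the shape with positive coefficients: each of them is a
   subtraction-free expression in the weights or is identically zero, and the
   minor attached to the diagonal starting at a dot [(a, b)] is the product of the
   weights of the boxes [(a', b')] with [a <= a'] and [b - a <= b' - a'].  The
   weights are therefore Laurent monomials in these minors, which gives the
   formula for the weights and the TP-basis.

   For the mutations, attach to the [l]-th dot of the diagonal [c] a minor on [l]
   consecutive boxes of this diagonal, starting in some row [r c l].  The canonical
   TP-basis has all intervals at the northwest end of their diagonal, the other
   set has all of them at the southeast end.  Moving an interval by one box is a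
   three-term Plücker relation (Desnanot-Jacobi) involving the four neighbours of
   [(c, l)], so that the sets are stepped surfaces of the octahedron recurrence.
   A vertex which has not reached its final position and minimizes
   [2 * r c l + c + l] can always be moved.  The rows of the exchange matrix at the
   mutable vertices are affine functions of [r], which makes the compatibility of
   these moves with quiver mutation a local computation. *)

Set Implicit Arguments.
Unset Strict Implicit.
Unset Printing Implicit Defensive.

Import Order.TTheory GRing.Theory Num.Theory.
Local Open Scope ring_scope.

(** * Plücker relations and column operations *)

(** A southeast corner dot [z] glues the sink of its column to the source of its row. Without [z]
    these are the boundary steps [i] and [i + 1], so a path through [z] and on to the left is a path
    to that sink followed by a path from that source. This explains the shape of the row and column
    operations, and adjacency of the two steps keeps signs out of the recursion for minors.
    Convexity of skew shapes makes the combinatorics local: the next dot in a row or column is the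
    adjacent box, the covering dot is the diagonal neighbour, and each face other than the northwest
    one consists of a single corner. Minors on intervals starting at a dot are all positive on the
    cell. Hence every move is a mutation of the first kind, and cluster variables can be divided by
    when they are evaluated on the cell. On the quiver side the difficulty is the northwest vertex,
    which stands for the empty intervals of all diagonals at once; it needs its own column in the
    exchange matrix. Arrows between two frozen vertices are not followed at all. *)

Section TwoRows.
Variables (F : fieldType) (p : nat) (U : 'M[F]_p.+2).
Implicit Types u v a b c d : 'rV[F]_p.+2.

(** The rows of [U] that remain play the part of the columns common to all minors of a three-term
    relation; the determinant is then an alternating bilinear form in [u] and [v]. *)
Definition two_rows u v : 'M[F]_p.+2 :=
  \matrix_(i, j) (if i == 0 then u 0 j else if i == 1 then v 0 j else U i j).

Lemma row_two_rows u v i : row i (two_rows u v) =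
  if i == 0 then u else if i == 1 then v else row i U.
Proof. by apply/rowP=> j; rewrite !mxE; do 2?case: ifP => _ //; rewrite mxE. Qed.

Lemma row'_two_rows u u' v : row' 0 (two_rows u v) = row' 0 (two_rows u' v).
Proof. by apply/matrixP=> i j; rewrite !mxE eq_sym (negPf (neq_lift _ _)). Qed.

Lemma det_two_rows_linear x y u u' v :
  \det (two_rows (x *: u + y *: u') v)
  = x * \det (two_rows u v) + y * \det (two_rows u' v).
Proof.
apply: (@determinant_multilinear _ _ _ _ _ 0); first by rewrite !row_two_rows.
  exact: row'_two_rows.
exact: row'_two_rows.
Qed.

Lemma det_two_rows_diag u : \det (two_rows u u) = 0.
Proof.
apply: (@determinant_alternate _ _ _ 0 1) => // j.
by rewrite !mxE.
Qed.

Lemma det_two_rowsC u v : \det (two_rows v u) = - \det (two_rows u v).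
Proof.
have -> : two_rows v u = row_perm (tperm 0 1) (two_rows u v).
  apply/matrixP=> i j; rewrite !mxE.
  case: tpermP => [->|->|/eqP/negPf-> /eqP/negPf->] //=.
by rewrite row_permE det_mulmx det_perm odd_tperm /= mulN1r.
Qed.

Lemma det_two_rows_old i v :
  i != 0 -> i != 1 -> \det (two_rows (row i U) v) = 0.
Proof.
move=> i0 i1; apply: (@determinant_alternate _ _ _ 0 i); first by rewrite eq_sym.
by move=> j; rewrite !mxE eqxx (negPf i0) (negPf i1).
Qed.

(** When the first row is expanded by linearity, each old row of [U] occurs twice and contributes
    zero; only the coefficients of [a] and [b] survive. *)
Lemma det_two_rows_mul a b z v :
  \det (two_rows (z *m two_rows a b) v)
  = z 0 0 * \det (two_rows a v) + z 0 1 * \det (two_rows b v).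
Proof.
have sumP (I : Type) (s : seq I) (x : I -> F) (r : I -> 'rV_p.+2) :
    \det (two_rows (\sum_(i <- s) x i *: r i) v)
    = \sum_(i <- s) x i * \det (two_rows (r i) v).
  elim: s => [|i s IH].
    rewrite !big_nil; have := det_two_rows_linear 0 0 0 0 v.
    by rewrite !scale0r addr0 !mul0r addr0.
  rewrite !big_cons -IH; set S := \sum_(_ <- _) _.
  by have := det_two_rows_linear (x i) 1 (r i) S v; rewrite scale1r mul1r.
rewrite mulmx_sum_row sumP (bigD1 0) //= (bigD1 1) //= big1 ?addr0.
  by rewrite !row_two_rows.
move=> i /andP[i0 i1]; rewrite row_two_rows (negPf i0) (negPf i1).
by rewrite det_two_rows_old ?mulr0.
Qed.

(** If one value of the form is nonzero, its two arguments and the old rows form a basis. By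
    [det_two_rows_mul] the other vectors count only through two coordinates, and the relation
    becomes an identity of 2 by 2 determinants. *)
Lemma two_rows_plucker a b c d :
  \det (two_rows a c) * \det (two_rows b d)
  = \det (two_rows a b) * \det (two_rows c d)
    + \det (two_rows a d) * \det (two_rows b c).
Proof.
pose f x y := \det (two_rows x y).
have fC x y : f y x = - f x y by exact: det_two_rowsC.
have fxx u : f u u = 0 by exact: det_two_rows_diag.
have key x y u : f x y != 0 ->
    exists s t, forall v, f u v = s * f x v + t * f y v.
  move=> nz; have Bu : two_rows x y \in unitmx by rewrite unitmxE unitfE.
  exists ((u *m invmx (two_rows x y)) 0 0), ((u *m invmx (two_rows x y)) 0 1).
  by move=> v; rewrite -det_two_rows_mul mulmxKV.
rewrite -!/(f _ _); clearbody f.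
have base x y z t : f x y != 0 -> f x z * f y t = f x y * f z t + f x t * f y z.
  move=> nz; have [s1 [s2 zE]] := key x y z nz; have [t1 [t2 tE]] := key x y t nz.
  have xz : f x z = s2 * f x y by rewrite (fC z x) zE fxx (fC x y); ring.
  have yz : f y z = - s1 * f x y by rewrite (fC z y) zE fxx; ring.
  have xt : f x t = t2 * f x y by rewrite (fC t x) tE fxx (fC x y); ring.
  have yt : f y t = - t1 * f x y by rewrite (fC t y) tE fxx; ring.
  by rewrite (zE t) xz yz xt yt; ring.
(* Up to signs the relation is symmetric in [b], [c], [d], so any nonzero value among [f a b],
   [f a c], [f a d] can be the pivot; if all three vanish, so does every term. *)
have [ab|] := eqVneq (f a b) 0; last exact: base.
have [ac|] := eqVneq (f a c) 0; last first.
  move/(base a c b d) => h; apply/eqP; rewrite -subr_eq0.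
  rewrite (_ : _ - _ = - (f a b * f c d - (f a c * f b d + f a d * f c b))).
    by rewrite h subrr oppr0.
  by rewrite (fC b c); ring.
have [ad|] := eqVneq (f a d) 0; last first.
  move/(base a d b c) => h; apply/eqP; rewrite -subr_eq0.
  rewrite (_ : _ - _ = f a b * f d c - (f a d * f b c + f a c * f d b)).
    by rewrite h subrr.
  by rewrite (fC b d) (fC c d); ring.
by rewrite ab ac ad !mul0r addr0.
Qed.

End TwoRows.

(** * Increasing enumerations and the place of an inserted element *)

Section EnumOrd.
Variable n : nat.
Implicit Types (x y : 'I_n) (T : {set 'I_n}).

Let lt_ord : rel 'I_n := fun i j => (i < j)%N.

Lemma enum_ord_sorted T : sorted lt_ord (enum T).
Proof.
rewrite {1}/enum_mem; apply: sorted_filter; first by move=> ? ? ?; apply: ltn_trans.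
have := iota_ltn_sorted 0 n; rewrite -val_enum_ord sorted_map enumT.
exact.
Qed.

Lemma ord_sorted_eq (s t : seq 'I_n) :
  sorted lt_ord s -> sorted lt_ord t -> s =i t -> s = t.
Proof.
apply: irr_sorted_eq; first by move=> ? ? ?; apply: ltn_trans.
by move=> i; rewrite /lt_ord ltnn.
Qed.

Lemma enum_split T x : x \notin T ->
  enum T = [seq y : 'I_n <- enum T | (y < x)%N] ++ [seq y : 'I_n <- enum T | (x < y)%N].
Proof.
move=> xT; apply: ord_sorted_eq; first exact: enum_ord_sorted.
  have tr : transitive lt_ord by move=> ? ? ?; apply: ltn_trans.
  rewrite (sorted_pairwise tr) pairwise_cat -!(sorted_pairwise tr).
  rewrite !(sorted_filter tr _ (enum_ord_sorted T)) ?andbT /=.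
  apply/allrelP=> y z; rewrite !mem_filter => /andP[yx _] /andP[xz _].
  exact: ltn_trans yx xz.
move=> y; have fE a : (y \in filter a (enum T)) = a y && (y \in T).
  by rewrite mem_filter mem_enum.
rewrite mem_cat !fE mem_enum.
case: (ltngtP y x) => [||/val_inj->] /=; rewrite ?orbF //; exact: negPf.

Qed.

Lemma enum_setU1 T x : x \notin T ->
  enum (x |: T) = [seq y : 'I_n <- enum T | (y < x)%N] ++ x :: [seq y : 'I_n <- enum T | (x < y)%N].
Proof.
move=> xT; apply: ord_sorted_eq; first exact: enum_ord_sorted.
  have tr : transitive lt_ord by move=> ? ? ?; apply: ltn_trans.
  rewrite (sorted_pairwise tr) pairwise_cat /= -!(sorted_pairwise tr).
  rewrite !(sorted_filter tr _ (enum_ord_sorted T)) ?andbT /=.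
  apply/andP; split.
    apply/allrelP=> y z; rewrite mem_filter => /andP[yx _].
    rewrite inE mem_filter => /predU1P[->//|/andP[xz _]].
    exact: ltn_trans yx xz.
  by apply/allP=> z; rewrite mem_filter => /andP[].
move=> y; have fE a : (y \in filter a (enum T)) = a y && (y \in T).
  by rewrite mem_filter mem_enum.
rewrite mem_cat inE !fE mem_enum in_setU1.
rewrite -val_eqE; case: (ltngtP y x) => [||/val_inj->] /=; rewrite ?orbF //.
Qed.
End EnumOrd.

Section Minors.
Variables (F : fieldType) (k m : nat) (M : 'M[F]_(k, k + m)).
Implicit Types (s : seq 'I_(k + m)) (H S : {set 'I_(k + m)}).

(** Columns may come in any order and with repetitions, so that a column can be moved to the front
    of the list at the price of a sign. *)
Definition seq_minor s : F :=
  \det (\matrix_(i < k, j < k) M i (nth (lshift m j) s j)).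

Lemma pluckerE H : plucker H M = seq_minor (enum H).
Proof. by congr (\det _); apply/matrixP=> i j; rewrite !mxE. Qed.

Lemma seq_minor_swap s1 a b s2 : ((size s1).+1 < k)%N ->
  seq_minor (s1 ++ a :: b :: s2) = - seq_minor (s1 ++ b :: a :: s2).
Proof.
move=> lt1; have lt0 := ltnW lt1.
pose j0 := Ordinal lt0; pose j1 := Ordinal lt1.
have j01 : j0 != j1 by rewrite -val_eqE /= ltn_eqF.
rewrite /seq_minor; set A := \matrix_(_, _) _; set B := \matrix_(_, _) _.
have -> : A = col_perm (tperm j0 j1) B.
  apply/matrixP=> i j; rewrite !mxE; congr (M i _).
  case: tpermP => [->|->|] /=.
  - by rewrite !nth_cat ltnn ltnNge leqnSn /= subnn subSnn.
  - by rewrite !nth_cat ltnn ltnNge leqnSn /= subnn subSnn.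
  move=> /eqP; rewrite -val_eqE /= => h0 /eqP; rewrite -val_eqE /= => h1.
  rewrite !nth_cat; case: ltnP => // h.
  by case E: (j - size s1)%N => [|[|d]] //=; lia.
by rewrite -[LHS]det_tr tr_col_perm row_permE det_mulmx det_perm odd_tperm j01 /=
  expr1 mulN1r det_tr.
Qed.

Lemma seq_minor_move s1 x s2 s3 : size (s1 ++ x :: s2 ++ s3) = k ->
  seq_minor (s1 ++ x :: s2 ++ s3)
  = (-1) ^+ size s2 * seq_minor (s1 ++ s2 ++ x :: s3).
Proof.
elim: s2 s1 => [|y s2 IH] s1 sz; first by rewrite mul1r.
rewrite /= seq_minor_swap; last by move: sz; rewrite size_cat /=; lia.
rewrite -cat_rcons IH; last by move: sz; rewrite !size_cat /= size_rcons; lia.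
by rewrite cat_rcons exprS mulN1r mulNr.
Qed.

Lemma plucker_setU1 S x : #|S|.+1 = k -> x \notin S ->
  plucker (x |: S) M
  = (-1) ^+ count (fun y : 'I__ => y < x)%N (enum S) * seq_minor (x :: enum S).
Proof.
move=> cS xS; rewrite pluckerE enum_setU1 // [in x :: enum S](enum_split xS).
rewrite -[x :: _]/([::] ++ x :: _ ++ _) seq_minor_move /=; last first.
  by rewrite -enum_split // -cardE.
by rewrite size_filter mulrA -expr2 sqrr_sign mul1r.
Qed.

Lemma plucker_setU2 S (x y : 'I_(k + m)) : (x < y)%N -> #|S|.+2 = k -> x \notin S -> y \notin S ->
  plucker (x |: (y |: S)) M
  = (-1) ^+ (count (fun z : 'I__ => z < x)%N (enum S)
             + count (fun z : 'I__ => z < y)%N (enum S))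
    * seq_minor (x :: y :: enum S).
Proof.
move=> xy cS xS yS; rewrite plucker_setU1; last first.
- by rewrite in_setU1 negb_or -val_eqE (ltn_eqF xy).
- by rewrite cardsU1 yS.
rewrite enum_setU1 // [in x :: y :: enum S](enum_split yS).
rewrite -[x :: y :: _]/([:: x] ++ y :: _ ++ _) seq_minor_move /=; last first.
  by rewrite -enum_split // -cardE.
rewrite size_filter mulrA -exprD -addnA addnn exprD -mul2n [X in _ * X * _]exprM.
rewrite sqrrN !expr1n mulr1 [in X in _ = _ ^+ X * _](enum_split yS)
  !count_cat /=.
have -> : (y < x)%N = false by rewrite ltnNge ltnW.
by rewrite add0n.
Qed.
End Minors.

Lemma plucker_relation (F : fieldType) k m (M : 'M[F]_(k, k + m))
    (S : {set 'I_(k + m)}) (a b c d : 'I_(k + m)) :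
  #|S|.+2 = k -> (a < b < c)%N -> (c < d)%N -> [disjoint S & [set a; b; c; d]] ->
  plucker (a |: (c |: S)) M * plucker (b |: (d |: S)) M
  = plucker (a |: (b |: S)) M * plucker (c |: (d |: S)) M
    + plucker (a |: (d |: S)) M * plucker (b |: (c |: S)) M.
Proof.
move=> cS /andP[ab bc] cd; rewrite disjoint_sym => /disjointFr dis.
have aS : a \notin S by rewrite dis // !inE eqxx.
have bS : b \notin S by rewrite dis // !inE eqxx orbT.
have cS' : c \notin S by rewrite dis // !inE eqxx orbT.
have dS : d \notin S by rewrite dis // !inE eqxx orbT.
have ac := ltn_trans ab bc; have bd := ltn_trans bc cd.
have ad := ltn_trans ac cd.
rewrite !plucker_setU2 //; clear dis aS bS cS' dS ab bc cd ac bd ad.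
case: k M S a b c d cS => [//|[//|p]] M S a b c d _.
(* After transposition the columns of [S] become the rows from 2 on; the shift [i.-2] leaves rows 0
   and 1 to be overwritten. *)
pose U : 'M_p.+2 := \matrix_(i, j) M j (nth (lshift m i) (enum S) i.-2).
have E (x y : 'I_(p.+2 + m)) :
    seq_minor M (x :: y :: enum S) = \det (two_rows U (col x M)^T (col y M)^T).
  rewrite /seq_minor -det_tr; congr (\det _); apply/matrixP=> i j.
  rewrite !mxE; case: i => [[|[|i]] lt_i] //=; rewrite !mxE //.
rewrite !E; have := two_rows_plucker U (col a M)^T (col b M)^T (col c M)^T (col d M)^T.
set n1 := count _ _; set n2 := count _ _; set n3 := count _ _; set n4 := count _ _.
(* Each label occurs once in each of the three products, so all of them carry the same sign, of
   exponent [n1 + n2 + n3 + n4]. *)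
rewrite !exprD; move: (\det _) (\det _) (\det _) (\det _) (\det _) (\det _).
move=> f1 f2 f3 f4 f5 f6 h.
transitivity ((-1) ^+ n1 * (-1) ^+ n2 * (-1) ^+ n3 * (-1) ^+ n4 * (f6 * f5)); first by ring.
by rewrite h; ring.
Qed.

(** * Minors under row and column operations *)

Section ColumnOps.
Variables (F : fieldType) (k m : nat).
Implicit Types (M N : 'M[F]_(k, k + m)) (H S : {set 'I_(k + m)}).

Lemma plucker_mulmx (g : 'M[F]_k) M H : plucker H (g *m M) = \det g * plucker H M.
Proof.
rewrite /plucker -det_mulmx; congr (\det _).
by apply/matrixP=> i j; rewrite !mxE; apply: eq_bigr => l _; rewrite !mxE.
Qed.

Lemma nth_enum_in H (j : 'I_k) : #|H| = k -> nth (lshift m j) (enum H) j \in H.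
Proof. by move=> cH; rewrite -mem_enum mem_nth // -cardE cH. Qed.

Lemma eq_plucker M N H : #|H| = k ->
  (forall x j, j \in H -> N x j = M x j) -> plucker H N = plucker H M.
Proof.
move=> cH eqMN; congr (\det _); apply/matrixP=> i j; rewrite !mxE.
by rewrite eqMN // nth_enum_in.
Qed.

Lemma seq_minor_dup M i s : (size s < k)%N -> i \in s -> seq_minor M (i :: s) = 0.
Proof.
move=> sz ins; have lt1 : ((index i s).+1 < k)%N by rewrite (leq_ltn_trans _ sz) // index_mem.
pose j0 := Ordinal (leq_ltn_trans (leq0n _) lt1); pose j1 := Ordinal lt1.
rewrite /seq_minor -det_tr; apply: (@determinant_alternate _ _ _ j0 j1) => // j.
by rewrite !mxE /= nth_index.
Qed.

(** No element of [S] lies strictly between the adjacent labels [i] and [i'], so replacing one by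
    the other does not move the column and produces no sign. If [i'] is already in [S], the second
    determinant has a repeated column. *)
Lemma plucker_col_add M N (i i' : 'I_(k + m)) (c : F) S :
    i' = i.+1 :> nat -> (forall x j, j != i -> N x j = M x j) ->
    (forall x, N x i = c * (M x i + M x i')) -> #|S|.+1 = k -> i \notin S ->
  plucker (i |: S) N = c * (plucker (i |: S) M
    + if i' \in S then 0 else plucker (i' |: S) M).
Proof.
move=> ii' Nj Ni cS iS; have k0 : (0 < k)%N by rewrite -cS.
have Slt x : x \in S -> (x < i)%N = (x < i')%N.
  move=> xS; rewrite ii' ltnS [RHS]leq_eqVlt val_eqE.
  by case: eqP => // xi; rewrite -xi xS in iS.
have cnt : count (fun y : 'I__ => y < i')%N (enum S)
         = count (fun y : 'I__ => y < i)%N (enum S).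
  by apply: eq_in_count => y; rewrite mem_enum => /Slt ->.
have -> : (if i' \in S then 0 else plucker (i' |: S) M)
    = (-1) ^+ count (fun y : 'I__ => y < i)%N (enum S) * seq_minor M (i' :: enum S).
  case: ifP => i'S; last by rewrite plucker_setU1 ?i'S // cnt.
  by rewrite seq_minor_dup ?mulr0 ?mem_enum // -cardE cS.
rewrite !plucker_setU1 // -mulrDr mulrCA; congr (_ * _); rewrite mulrDr.
rewrite /seq_minor -!(det_tr (\matrix_(_, _) _)).
pose j0 := Ordinal k0.
have cS1 : #|S| = k.-1 by apply: succn_inj; rewrite cS prednK.
have nth_neq (x : 'I_k.-1) j : nth j (enum S) (0 + x) != i.
  apply: contraNneq iS => <-; rewrite -mem_enum mem_nth // -cardE.
  by rewrite cS1 add0n; apply: ltn_ord.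
apply: (@determinant_multilinear _ _ _ _ _ j0).
- by apply/rowP=> j; rewrite !mxE /= Ni mulrDr.
- by apply/matrixP=> x y; rewrite !mxE /= Nj // nth_neq.
- by apply/matrixP=> x y; rewrite !mxE /= Nj // nth_neq.
Qed.
End ColumnOps.

Local Open Scope nat_scope.

Section DownClosed.
Variables (n : nat) (T : {set 'I_n}).

Lemma card_ord_lt (a : nat) : a <= n -> #|[set x : 'I_n | x < a]| = a.
Proof.
move=> an; have inj : injective (widen_ord an) by move=> x y [] /val_inj.
rewrite -[RHS](card_ord a) -(card_imset _ inj).
apply: eq_card => x; rewrite inE; apply/idP/imsetP => [xa|[y _ ->]] /=.
  by exists (Ordinal xa) => //; apply: val_inj.
exact: ltn_ord.
Qed.

Lemma mem_down_closed : (forall x y : 'I_n, y \in T -> x <= y -> x \in T) ->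
  forall x : 'I_n, (x \in T) = (x < #|T|).
Proof.
move=> down x; apply/idP/idP => [xT|].
  rewrite -(card_ord_lt (ltn_ord x)); apply/subset_leq_card/subsetP=> y.
  by rewrite inE ltnS; apply: down.
apply: contraTT => xT; rewrite -leqNgt -[leqRHS](card_ord_lt (ltnW (ltn_ord x))).
apply/subset_leq_card/subsetP=> y yT; rewrite inE ltnNge.
by apply: contra xT; apply: down.
Qed.
End DownClosed.

(** * Boundary labels *)

Section Labels.
Variables (k m : nat) (lam : {set box k m}) (ylam : young_diagram lam).
Implicit Types (x : 'I_k) (y : 'I_m) (X : {set 'I_k}) (Y : {set 'I_m}).

Definition row_len x := #|[set y : 'I_m | (x, y) \in lam]|.
Definition col_len y := #|[set x : 'I_k | (x, y) \in lam]|.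

Lemma mem_row_len x y : ((x, y) \in lam) = (y < row_len x).
Proof.
rewrite -mem_down_closed ?inE // => z z'; rewrite !inE => xz' zz'.
by apply: ylam xz' _; rewrite /box_le /= leqnn.
Qed.

Lemma mem_col_len x y : ((x, y) \in lam) = (x < col_len y).
Proof.
rewrite -mem_down_closed ?inE // => z z'; rewrite !inE => xz' zz'.
by apply: ylam xz' _; rewrite /box_le /= leqnn andbT.
Qed.

Lemma row_len_max x : row_len x <= m.
Proof. by rewrite -[leqRHS]card_ord max_card. Qed.

Lemma col_len_max y : col_len y <= k.
Proof. by rewrite -[leqRHS]card_ord max_card. Qed.

(** A box of the shape lies northwest of the boundary path, so the path passes the right end of its
    row before the bottom of its column. The order of the labels thus encodes the shape. *)
Lemma vlab_lt_hlab x y : (vlab lam x < hlab lam y) = ((x, y) \in lam).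
Proof.
rewrite /= -/(row_len x) -/(col_len y).
have := mem_row_len x y; have := mem_col_len x y.
case: (_ \in _) => /esym hc /esym hr; have := ltn_ord x; have := ltn_ord y.
  by have := row_len_max x; lia.
have := row_len_max x; lia.
Qed.

Lemma hlab_lt_vlab x y : (hlab lam y < vlab lam x) = ((x, y) \notin lam).
Proof.
rewrite /= -/(row_len x) -/(col_len y).
have := mem_row_len x y; have := mem_col_len x y.
case: (_ \in _) => /esym hc /esym hr; have := ltn_ord x; have := ltn_ord y.
  by have := row_len_max x; lia.
have := row_len_max x; lia.
Qed.

Lemma vlab_neq_hlab x y : (vlab lam x == hlab lam y) = false.
Proof.
rewrite -val_eqE; have := hlab_lt_vlab x y; rewrite -vlab_lt_hlab.
by case: ltngtP.
Qed.

Lemma vlab_homo x x' : x < x' -> vlab lam x < vlab lam x'.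
Proof.
move=> xx' /=; rewrite -/(row_len x) -/(row_len x').
suff : row_len x' <= row_len x by lia.
apply/subset_leq_card/subsetP=> y; rewrite !inE => /ylam; apply.
by rewrite /box_le /= ltnW //=.
Qed.

Lemma hlab_homo y y' : y < y' -> hlab lam y' < hlab lam y.
Proof.
move=> yy' /=; rewrite -/(col_len y) -/(col_len y').
have : col_len y' <= col_len y.
  apply/subset_leq_card/subsetP=> x; rewrite !inE => /ylam; apply.
  by rewrite /box_le /= leqnn ltnW.
by have := ltn_ord y'; lia.
Qed.

Lemma vlab_lt x x' : (vlab lam x < vlab lam x') = (x < x').
Proof.
case: (ltngtP x x') => [/vlab_homo//|/vlab_homo/ltnW|/val_inj->]; rewrite ?ltnn //.
by rewrite leqNgt => /negPf.
Qed.

Lemma vlab_inj : injective (vlab lam).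
Proof.
move=> x x' e; apply: val_inj; have := vlab_lt x x'; have := vlab_lt x' x.
by rewrite e ltnn; case: ltngtP.
Qed.

Lemma hlab_inj : injective (hlab lam).
Proof.
move=> y y' e; apply/val_inj; case: (ltngtP y y') => // /hlab_homo.
  by rewrite e ltnn.
by rewrite e ltnn.
Qed.

Lemma vlab_in x : vlab lam x \in vlabs lam.
Proof. exact: imset_f. Qed.

Lemma hlab_notin y : hlab lam y \notin vlabs lam.
Proof. by apply/imsetP=> -[x _ /eqP]; rewrite eq_sym vlab_neq_hlab. Qed.

Lemma card_vlabs : #|vlabs lam| = k.
Proof. by rewrite card_imset ?card_ord //; apply: vlab_inj. Qed.

(** By counting: [k] vertical and [m] horizontal labels, all distinct, exhaust the [k + m] steps. *)
Lemma labP (j : 'I_(k + m)) : (exists x, j = vlab lam x) \/ (exists y, j = hlab lam y).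
Proof.
have [/imsetP[x _ ->]|jv] := boolP (j \in vlabs lam); first by left; exists x.
right; suff /imsetP[y _ ->] : j \in [set hlab lam y | y : 'I_m] by exists y.
have -> : [set hlab lam y | y : 'I_m] = ~: vlabs lam; last by rewrite inE.
apply/eqP; rewrite eqEcard; apply/andP; split.
  by apply/subsetP=> _ /imsetP[y _ ->]; rewrite inE hlab_notin.
rewrite card_imset; last exact: hlab_inj.
by rewrite cardsCs setCK card_vlabs !card_ord addKn.
Qed.

Lemma vlab_in_index X Y x : (vlab lam x \in plucker_index lam X Y) = (x \notin X).
Proof.
rewrite !inE vlab_in andbT (mem_imset _ _ vlab_inj); case: (x \in X) => //=.
by apply/imsetP=> -[y _ /eqP]; rewrite vlab_neq_hlab.
Qed.

Lemma hlab_in_index X Y y : (hlab lam y \in plucker_index lam X Y) = (y \in Y).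
Proof.
by rewrite !inE (negPf (hlab_notin y)) andbF (mem_imset _ _ hlab_inj).
Qed.

Lemma index_eqP X Y (H : {set 'I_(k + m)}) :
    (forall x, (vlab lam x \in H) = (x \notin X)) ->
    (forall y, (hlab lam y \in H) = (y \in Y)) ->
  H = plucker_index lam X Y.
Proof.
move=> hX hY; apply/setP=> j.
by case: (labP j) => -[z ->]; rewrite ?vlab_in_index ?hX // hlab_in_index hY.
Qed.

Lemma index_inj X Y X' Y' :
  plucker_index lam X Y = plucker_index lam X' Y' -> X = X' /\ Y = Y'.
Proof.
move=> e; split; apply/setP=> z.
  by have := vlab_in_index X Y z; rewrite e vlab_in_index; do 2!case: (_ \in _).
by rewrite -(hlab_in_index X) e hlab_in_index.
Qed.

Lemma index0 : plucker_index lam set0 set0 = vlabs lam.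
Proof. by rewrite /plucker_index !imset0 setD0 setU0. Qed.

Lemma indexP (H : {set 'I_(k + m)}) :
  H = plucker_index lam [set x | vlab lam x \notin H] [set y | hlab lam y \in H].
Proof. by apply: index_eqP => z; rewrite inE ?negbK. Qed.

Lemma card_index X Y : #|plucker_index lam X Y| + #|X| = k + #|Y|.
Proof.
rewrite /plucker_index cardsU disjoint_setI0 ?cards0 ?subn0; last first.
  rewrite disjoint_subset; apply/subsetP=> j; rewrite !inE => /andP[_ jv].
  by apply: contraL jv => /imsetP[y _ ->]; apply: hlab_notin.
rewrite (card_imset _ hlab_inj) cardsD (setIidPr _); last first.
  by apply/subsetP=> _ /imsetP[x _ ->]; apply: vlab_in.
rewrite card_vlabs (card_imset _ vlab_inj) addnAC subnK //.
by rewrite -[leqRHS]card_ord max_card.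
Qed.
End Labels.

(** * Path sums in the Le-network *)

Local Open Scope ring_scope.

Section BigTuple.
Lemma big_tupleS (R : nmodType) (T : finType) l (P : pred (seq T)) (G : seq T -> R) :
  \sum_(s : l.+1.-tuple T | P s) G s
  = \sum_(x : T) \sum_(s : l.-tuple T | P (x :: s)) G (x :: s).
Proof.
rewrite pair_big_dep /=.
rewrite (reindex (fun u : T * l.-tuple T => cons_tuple u.1 u.2)) //=.
exists (fun s => (thead s, behead_tuple s)) => [[x s] _|s _] /=.
  by congr pair; apply: val_inj.
by rewrite [RHS]tuple_eta; apply: val_inj.
Qed.

Lemma big_tuple0 (R : nmodType) (T : finType) (P : pred (seq T)) (G : seq T -> R) :
  \sum_(s : 0.-tuple T | P s) G s = if P [::] then G [::] else 0.
Proof.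
case: ifP => P0; last by rewrite big_pred0 // => s; rewrite (tuple0 s).
rewrite (big_pred1 [tuple]) // => s; rewrite (tuple0 s) /= P0.
by apply/esym/eqP; apply: val_inj.
Qed.
End BigTuple.

Section Rank.
Variables (k m : nat) (D : {set box k m}).
Implicit Types (p q : box k m).

(** Edges of the network go left or down, and both directions decrease this number; it is the
    induction measure along paths. *)
Definition box_rank p : nat := (k - p.1 + p.2)%N.

Lemma row_next_rank p q : row_next D p q -> (box_rank p < box_rank q)%N.
Proof. by case/and5P=> _ _ /eqP e lt _; rewrite /box_rank e; lia. Qed.

Lemma col_next_rank p q : col_next D p q -> (box_rank q < box_rank p)%N.
Proof.
case/and5P=> _ _ /eqP e lt _; rewrite /box_rank e; have := ltn_ord q.1; lia.
Qed.

End Rank.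

Section PathSums.
Variables (R : comNzRingType) (k m : nat) (lam D : {set box k m}).
Hypotheses (ylam : young_diagram lam) (Dlam : D \subset lam).
Variable w : box k m -> R.
Implicit Types (p q : box k m) (c : 'I_m) (u v : net_vertex k m).

(** Sources have to lie above all dots, whose rank is at most [k + m], and sinks below them; strict
    decrease along edges makes the network acyclic. *)
Definition vertex_rank u : nat :=
  match u with
  | inl p => (box_rank p).+1
  | inr i => if i \in vlabs lam then (k + m).+2 else 0%N
  end.

Lemma edge_rank u v : net_edge lam D u v -> (vertex_rank v < vertex_rank u)%N.
Proof.
rewrite /net_edge; case: u v => [p|i] [q|j] //=; rewrite ?orbF.
- by case/orP=> [/row_next_rank|/col_next_rank].
- by case/and3P=> _ /eqP-> _; rewrite (negPf (hlab_notin ylam _)).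
case/and3P=> _ /eqP-> _; rewrite vlab_in // /box_rank.
by have := ltn_ord q.2; lia.
Qed.

Lemma path_size u s : path (net_edge lam D) u s -> (size s < #|{: net_vertex k m}|)%N.
Proof.
move=> pth; have : uniq (u :: s).
  apply: (@sorted_uniq _ (fun u v => vertex_rank v < vertex_rank u)%N).
  - by move=> a b c h1 h2; apply: ltn_trans h2 h1.
  - by move=> a; apply: ltnn.
  by apply: sub_path pth; apply: edge_rank.
by move/card_uniqP => /= <-; apply: max_card.
Qed.

Definition walk_sum l u v : R :=
  \sum_(P : l.-tuple (net_vertex k m)
          | path (net_edge lam D) u P && (last u P == v))
    \prod_(e <- zip (u :: P) P) net_weight lam D w e.1 e.2.

Lemma walk_sum0 u v : walk_sum 0 u v = (u == v)%:R.
Proof.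
rewrite /walk_sum (@big_tuple0 R _ (fun P => path (net_edge lam D) u P && (last u P == v))
  (fun P => \prod_(e <- zip (u :: P) P) net_weight lam D w e.1 e.2)) /=.
by rewrite big_nil; case: eqP.
Qed.

Lemma walk_sumS l u v : walk_sum l.+1 u v =
  \sum_(u' | net_edge lam D u u') net_weight lam D w u u' * walk_sum l u' v.
Proof.
rewrite /walk_sum (@big_tupleS R _ l (fun P => path (net_edge lam D) u P && (last u P == v))
  (fun P => \prod_(e <- zip (u :: P) P) net_weight lam D w e.1 e.2)) /=.
rewrite [RHS]big_mkcond; apply: eq_bigr => u' _; case: ifP => e /=; last first.
  by rewrite big_pred0.
by rewrite mulr_sumr; apply: eq_bigr => P _; rewrite big_cons.
Qed.

(** Decomposition by the first edge. There is no walk of length [N], so the bounded sum over lengths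
    can be extended by one term, and its shift by one is again a full path sum. *)
Lemma path_sumE u v : path_sum lam D w u v = (u == v)%:R +
  \sum_(u' | net_edge lam D u u') net_weight lam D w u u' * path_sum lam D w u' v.
Proof.
set N := #|{: net_vertex k m}|.
have psE u1 : path_sum lam D w u1 v = \sum_(l < N) walk_sum l u1 v by [].
have wN u1 : walk_sum N u1 v = 0.
  rewrite /walk_sum big_pred0 // => P; apply/negP=> /andP[/path_size].
  by rewrite size_tuple ltnn.
transitivity (\sum_(l < N.+1) walk_sum l u v).
  by rewrite big_ord_recr /= wN addr0.
rewrite big_ord_recl walk_sum0; congr (_ + _).
under [RHS]eq_bigr => u' _ do rewrite psE mulr_sumr.
by rewrite exchange_big; apply: eq_bigr => l _; rewrite walk_sumS.
Qed.

Definition dot_sum p c : R := path_sum lam D w (inl p) (inr (hlab lam c)).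

Definition row_sum (x : 'I_k) c : R :=
  path_sum lam D w (inr (vlab lam x)) (inr (hlab lam c)).

Lemma path_sum_sink c c' :
  path_sum lam D w (inr (hlab lam c)) (inr (hlab lam c')) = (c == c')%:R.
Proof.
rewrite path_sumE big1 ?addr0.
  by rewrite (inj_eq (@inr_inj _ _)) (inj_eq (hlab_inj ylam)).
case=> [p|j] //= /orP[|//] /and3P[_ /eqP e _].
by have := vlab_neq_hlab ylam p.1 c; rewrite e eqxx.
Qed.

Lemma dot_sumE p c : p \in D -> dot_sum p c =
  \sum_(q | row_next D q p) w q * dot_sum q c + \sum_(q | col_next D p q) dot_sum q c
  + ((c == p.2) && ~~ [exists q, col_next D p q])%:R.
Proof.
move=> pD; rewrite /dot_sum path_sumE /= add0r big_sumType /=; congr (_ + _).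
  rewrite (bigID (fun q => row_next D q p)) /=; congr (_ + _).
    apply: eq_big => [q|q /andP[_]]; first by rewrite /net_edge /=; case: row_next; rewrite ?andbF ?andbT.
    by rewrite /net_weight /= => ->.
  apply: eq_big => [q|q /andP[]].
    rewrite /net_edge /=; case: (boolP (row_next D q p)) => [rn|_]; last by rewrite andbT.
    rewrite andbF; apply/esym/negP=> /and5P[_ _ _ lt _].
    by case/and5P: rn => _ _ /eqP e _ _; rewrite e ltnn in lt.
  by rewrite /net_weight /= => _ /negPf ->; rewrite mul1r.
rewrite /net_edge /net_weight /= pD /=; case: (boolP [exists q, col_next D p q]) => ex /=; rewrite ?andbF ?andbT.
  by rewrite big_pred0 // => j; rewrite andbF.
rewrite (eq_bigl (fun j => j == hlab lam p.2)); last by move=> j; rewrite andbT.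
by rewrite big_pred1_eq path_sum_sink mul1r eq_sym.
Qed.

Lemma row_sumE x c : row_sum x c =
  \sum_(q in D | (q.1 == x) && ~~ [exists q', row_next D q q']) w q * dot_sum q c.
Proof.
rewrite /row_sum path_sumE (inj_eq (@inr_inj _ _)) vlab_neq_hlab // add0r.
rewrite big_sumType /= [X in _ + X]big_pred0 ?addr0 //.
have nE q : [&& q \in D, vlab lam x == vlab lam q.1 & ~~ [exists q', row_next D q q']]
    = [&& q \in D, q.1 == x & ~~ [exists q', row_next D q q']].
  by rewrite (inj_eq (vlab_inj ylam)) eq_sym.
apply: eq_big => [q|q]; rewrite /net_edge /= orbF nE //.
by rewrite /net_weight /= nE => ->.
Qed.

Lemma dot_sum_eq0 p c : p \in D -> (p.2 < c)%N -> dot_sum p c = 0.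
Proof.
have [n] := ubnP (box_rank p); elim: n p => // n IH p; rewrite ltnS => le pD lt.
rewrite dot_sumE // !big1 ?add0r; first by case: eqP => // e; rewrite e ltnn in lt.
  move=> q cn; rewrite IH //.
  - exact: leq_trans (col_next_rank cn) le.
  - by case/and5P: cn.
  - by case/and5P: cn => _ _ /eqP <-.
move=> q rn; rewrite IH ?mulr0 //.
- exact: leq_trans (row_next_rank rn) le.
- by case/and5P: rn.
- by case/and5P: rn => _ _ _ /ltn_trans->.
Qed.

Lemma row_sum_eq0 x c : (x, c) \notin lam -> row_sum x c = 0.
Proof.
move=> xc; rewrite row_sumE big1 // => q /and3P[qD /eqP qx _].
rewrite dot_sum_eq0 ?mulr0 // ltnNge; apply: contra xc => le.
by apply: (ylam (subsetP Dlam _ qD)); rewrite /box_le /= qx leqnn.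
Qed.
End PathSums.

(** * Path sums in the presence of a corner dot *)

Section Corner.
Variables (k m : nat) (lam D : {set box k m}) (z : box k m).
Hypotheses (ylam : young_diagram lam) (Dlam : D \subset lam) (zD : z \in D).
Hypothesis corner : forall p, p \in lam -> box_le z p -> p = z.
Notation lam' := (lam :\ z).
Notation D' := (D :\ z).
Implicit Types (p q : box k m).

Lemma box_eq p q : p.1 = q.1 :> nat -> p.2 = q.2 :> nat -> p = q.
Proof. by case: p q => [a b] [c d] /= /val_inj -> /val_inj ->. Qed.

Lemma young_corner : young_diagram lam'.
Proof.
move=> p q; rewrite !inE => /andP[qz ql] pq; rewrite (ylam ql pq) andbT.
by apply: contra qz => /eqP pz; rewrite pz in pq; rewrite (corner ql pq).
Qed.

Lemma corner_subset : D' \subset lam'.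
Proof. exact: setSD. Qed.

Lemma corner_row p : p \in D -> p.1 = z.1 -> (p.2 <= z.2)%N.
Proof.
move=> /(subsetP Dlam) pl e; rewrite leqNgt; apply/negP=> lt.
have ez : p = z by apply: corner pl _; rewrite /box_le e leqnn ltnW.
by rewrite ez ltnn in lt.
Qed.

Lemma corner_col p : p \in D -> p.2 = z.2 -> (p.1 <= z.1)%N.
Proof.
move=> /(subsetP Dlam) pl e; rewrite leqNgt; apply/negP=> lt.
have ez : p = z by apply: corner pl _; rewrite /box_le e leqnn ltnW.
by rewrite ez ltnn in lt.
Qed.

Lemma row_next_corner p q : q \in D' -> row_next D p q = row_next D' p q.
Proof.
move=> qD'; have := qD'; rewrite in_setD1 => /andP[qz qD].
rewrite /row_next qD qD' /= in_setD1; case: (p.1 =P q.1) => e; rewrite ?andbF //=.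
case: (ltnP p.2 q.2) => lt; rewrite ?andbF //=.
have -> : p != z.
  by apply: contraTneq lt => pz; rewrite -leqNgt pz corner_row // -e pz.
congr (_ && ~~ _); apply: eq_existsb => y; rewrite in_setD1.
case: eqVneq => //= ez; rewrite ez zD /=.
apply/negP=> /andP[_ lt2].
by have := corner_row qD; rewrite -ez -e /= => /(_ erefl); rewrite leqNgt lt2.
Qed.

Lemma col_next_corner p q : q != z -> col_next D p q = col_next D' p q.
Proof.
move=> qz; rewrite /col_next !in_setD1 qz /=.
case: (boolP (q \in D)) => qD; rewrite ?andbF //=.
case: (p.2 =P q.2) => e; rewrite ?andbF //=.
case: (ltnP p.1 q.1) => lt; rewrite ?andbF //=.
have -> : p != z.
  by apply: contraTneq lt => pz; rewrite -leqNgt pz corner_col // -e pz.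
congr (_ && ~~ _); apply: eq_existsb => x; rewrite in_setD1.
case: eqVneq => //= ez; rewrite ez zD /=.
apply/negP=> /andP[_ lt2].
by have := corner_col qD; rewrite -ez -e /= => /(_ erefl); rewrite leqNgt lt2.
Qed.

(** The dot preceding [z] is the last dot of its row once [z] is removed, hence the dot entered from
    the source of that row in the smaller network. *)
Lemma row_next_corner_last p : row_next D p z =
  [&& p \in D', p.1 == z.1 & ~~ [exists q, row_next D' p q]].
Proof.
rewrite {1}/row_next zD /= [p \in D']in_setD1.
case: (boolP (p \in D)) => pD; rewrite ?andbF //=.
case: (p.1 =P z.1) => e; rewrite ?andbF //=.
have -> : (p.2 < z.2)%N = (p != z).
  rewrite ltn_neqAle corner_row // andbT; congr (~~ _).
  by rewrite -pair_eqE /= /pair_eq e eqxx.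
case: eqVneq => //= pz; congr (~~ _).
apply/existsP/existsP => [[y /and3P[yD py yz]]|[q]].
  have [q pq]: exists q, row_next D' p q.
    pose P y := ((p.1, y) \in D) && (p.2 < y)%N.
    have Py : P y by rewrite /P yD.
    case: (arg_minnP (fun y : 'I_m => y : nat) Py) => y1 /andP[y1D py1] min1.
    have y1z : (y1 < z.2)%N by rewrite (leq_ltn_trans _ yz) // min1.
    exists (p.1, y1); rewrite /row_next !in_setD1 pz pD y1D eqxx py1 /= andbT.
    apply/andP; split; first by apply: contraTneq y1z => <- /=; rewrite ltnn.
    apply/existsP=> -[y2]; rewrite in_setD1 => /and3P[/andP[_ y2D] py2].
    by rewrite ltnNge min1 // /P y2D.
  by exists q.
case/and5P; rewrite !in_setD1 => _ /andP[qz qD] /eqP pq lt _.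
exists q.2; rewrite pq -surjective_pairing qD lt ltn_neqAle corner_row -?pq // andbT.
apply: contra qz => /eqP q2; apply/eqP.
by apply: box_eq; rewrite // -?pq ?e.
Qed.

Lemma col_next_exists_corner p : p \in D' ->
  [exists q, col_next D p q] = [exists q, col_next D' p q] || col_next D p z.
Proof.
move=> pD'; apply/existsP/orP => [[q]|[/existsP[q]|]].
- have [->|qz] := eqVneq q z; first by right.
  by rewrite col_next_corner // => h; left; apply/existsP; exists q.
- move=> h; exists q; rewrite col_next_corner //.
  by case/and5P: h => _; rewrite in_setD1 => /andP[].
by exists z.
Qed.

Lemma col_next_corner_last p : p \in D' -> p.2 = z.2 ->
  [exists q, col_next D' p q] = ~~ col_next D p z.
Proof.
move=> pD' e; have := pD'; rewrite in_setD1 => /andP[pz pD].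
have lt : (p.1 < z.1)%N.
  rewrite ltn_neqAle corner_col // andbT; apply: contra pz => /eqP p1; apply/eqP.
  by apply: box_eq; rewrite // -?pq ?e.
rewrite {2}/col_next pD zD e eqxx lt /= negbK.
apply/existsP/existsP => [[q]|[x /and3P[xD px xz]]].
  case/and5P; rewrite !in_setD1 => _ /andP[qz qD] /eqP pq lt2 _.
  exists q.1; rewrite -e pq -surjective_pairing qD lt2 ltn_neqAle corner_col -?pq // andbT.
  apply: contra qz => /eqP q1; apply/eqP.
  by apply: box_eq; rewrite // -?pq ?e.
pose P x := ((x, p.2) \in D) && (p.1 < x)%N.
have Px : P x by rewrite /P e xD.
case: (arg_minnP (fun x : 'I_k => x : nat) Px) => x1 /andP[x1D px1] min1.
have x1z : (x1 < z.1)%N by rewrite (leq_ltn_trans _ xz) // min1.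
exists (x1, p.2); rewrite /col_next !in_setD1 pz pD x1D eqxx px1 /= andbT.
apply/andP; split; first by apply: contraTneq x1z => <- /=; rewrite ltnn.
apply/existsP=> -[x2]; rewrite in_setD1 => /and3P[/andP[_ x2D] px2].
by rewrite ltnNge min1 // /P x2D.
Qed.

Section Sums.
Variables (R : comNzRingType) (w : box k m -> R).
Notation f := (dot_sum lam D w).
Notation f' := (dot_sum lam' D' w).
Notation M := (row_sum lam D w).
Notation M' := (row_sum lam' D' w).
Let y' := young_corner.
Let s' := corner_subset.

Lemma row_sum_corner' c : M' z.1 c = \sum_(q | row_next D q z) w q * f' q c.
Proof.
rewrite row_sumE //; apply: eq_bigl => q.
by rewrite row_next_corner_last.
Qed.

(** Without [z], a path that reaches [z] ends at the sink of column [z.2]. With [z] it either goes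
    down to that sink, which is the only choice for [c = z.2], or turns left and continues like a
    path from the source of row [z.1]. *)
Lemma dot_sum_corner p c : p \in D' ->
  f p c = f' p c + (if c == z.2 then 0 else f' p z.2 * M' z.1 c).
Proof.
have [n] := ubnP (box_rank p); elim: n p => // n IH p; rewrite ltnS => le pD'.
have := pD'; rewrite in_setD1 => /andP[pz pD].
have fz : col_next D p z -> f z c = if c == z.2 then 1 else M' z.1 c.
  move=> pzn; have rz := col_next_rank pzn.
  rewrite dot_sumE // [X in _ + X + _]big_pred0 ?addr0; last first.
    move=> q; apply/negP=> /and5P[_ qD /eqP e lt _].
    by have := corner_col qD (esym e); rewrite leqNgt lt.
  have -> : [exists q, col_next D z q] = false.
    apply/existsP=> -[q /and5P[_ qD /eqP e lt _]].
    by have := corner_col qD (esym e); rewrite leqNgt lt.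
  rewrite andbT row_sum_corner'.
  have rnP q : row_next D q z -> (f q c = f' q c) /\ (c = z.2 -> f' q c = 0).
    move=> qz; have lt : (q.2 < z.2)%N by case/and5P: qz.
    have qD' : q \in D' by move: qz; rewrite row_next_corner_last => /and3P[].
    have q0 : f' q z.2 = 0 by rewrite dot_sum_eq0.
    split; last by move=> ->.
    rewrite IH ?q0 ?mul0r ?if_same ?addr0 //.
    exact: leq_trans (ltn_trans (row_next_rank qz) rz) le.
  case: eqP => [cz|_] /=.
    by rewrite big1 ?add0r // => q /rnP[-> ->]; rewrite ?mulr0.
  by rewrite addr0; apply: eq_bigr => q /rnP[->].
(* The correction term satisfies the recursion of path sums in the smaller network, so it separates
   from the main term. *)
pose K q := if c == z.2 then 0 else f' q z.2 * M' z.1 c.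
have rowE : \sum_(q | row_next D q p) w q * f q c
    = \sum_(q | row_next D' q p) w q * f' q c + \sum_(q | row_next D' q p) w q * K q.
  rewrite -big_split; apply: eq_big => q; first exact: row_next_corner.
  move=> rn; have := rn; rewrite row_next_corner // => rn'.
  rewrite IH ?mulrDr //; last by case/and5P: rn'.
  exact: leq_trans (row_next_rank rn) le.
have colE : \sum_(q | col_next D p q) f q c = (if col_next D p z then f z c else 0)
    + (\sum_(q | col_next D' p q) f' q c + \sum_(q | col_next D' p q) K q).
  rewrite (bigID (pred1 z)) /= -big_split; congr (_ + _).
    case: ifP => h; last by rewrite big_pred0 // => q; case: eqP => [->|]; rewrite ?h ?andbF.
    by rewrite (big_pred1 z) // => q; rewrite /=; case: eqP => [->|]; rewrite ?h ?andbF.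
  apply: eq_big => q.
    case: (eqVneq q z) => [->|qz]; last by rewrite andbT col_next_corner.
    by rewrite andbF /col_next !in_setD1 eqxx /= andbF.
  case/andP=> cn qz; rewrite IH //.
    exact: leq_trans (col_next_rank cn) le.
  by move: cn; rewrite col_next_corner // => /and5P[].
rewrite dot_sumE // rowE colE [f' p c]dot_sumE //.
rewrite col_next_exists_corner //.
rewrite -!/(K p) -!addrA; congr (_ + _).
set ex := [exists q, _]; set zn := col_next D p z.
have -> : K p = \sum_(q | row_next D' q p) w q * K q + \sum_(q | col_next D' p q) K q
    + (if c == z.2 then 0 else ((z.2 == p.2) && ~~ ex)%:R * M' z.1 c).
  rewrite /K; case: eqP => _.
    by rewrite !big1 ?addr0 // => q _; rewrite mulr0.
  rewrite dot_sumE // !mulrDl !mulr_suml; congr (_ + _ + _).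
  by apply: eq_bigr => q _; rewrite mulrA.
set A := \sum_(q | _) _ * K q; set B := \sum_(q | _) f' q c; set C := \sum_(q | _) K q.
set Z := if zn then _ else _; set Y := if c == z.2 then _ else _.
set e1 := (_ : bool)%:R; set e2 := (_ : bool)%:R.
(* The sums over interior edges agree; what remains are the edges from [p] to [z] and to the sink of
   its column in the two networks. *)
suff E : Z + e1 = e2 + Y.
  by transitivity (A + B + C + (Z + e1)); [|rewrite E]; ring.
rewrite {}/Z {}/Y {}/e1 {}/e2.
case: (eqVneq z.2 p.2) => [zp|zp] /=; last first.
  have -> : zn = false.
    by apply/negP=> /and5P[_ _ /eqP e]; rewrite e eqxx in zp.
  by rewrite mul0r if_same addr0 add0r orbF.
have -> : ex = ~~ zn by exact: col_next_corner_last.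
rewrite negbK orNb andbF addr0 -zp; case: (boolP zn) => [/fz->|_]; case: eqP => _;
  by rewrite ?mul1r ?mul0r ?addr0 ?add0r.
Qed.

Lemma row_sum_corner x c : x != z.1 ->
  M x c = M' x c + (if c == z.2 then 0 else M' x z.2 * M' z.1 c).
Proof.
move=> xz; rewrite [M x c]row_sumE // [M' x c]row_sumE // [M' x z.2]row_sumE //.
have dE q : [&& q \in D, q.1 == x & ~~ [exists q', row_next D q q']]
    = [&& q \in D', q.1 == x & ~~ [exists q', row_next D' q q']].
  rewrite in_setD1; case: eqP => [qx|]; last by rewrite !andbF.
  have qz : q != z by apply: contraNneq xz => <-; rewrite qx.
  rewrite qz; congr [&& _, _ & ~~ _]; apply: eq_existsb => q'.
  have [->|q'z] := eqVneq q' z.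
    rewrite /row_next !in_setD1 eqxx qx (negPf xz) /= !andbF //.
  case: (boolP (q' \in D)) => q'D; first by rewrite row_next_corner // in_setD1 q'z.
  by rewrite /row_next !in_setD1 (negPf q'D) /= !andbF.
rewrite !(eq_bigl _ _ dE).
have rE : \sum_(q in D' | (q.1 == x) && ~~ [exists q', row_next D' q q']) w q * f q c
  = \sum_(q in D' | (q.1 == x) && ~~ [exists q', row_next D' q q'])
      (w q * f' q c + w q * (if c == z.2 then 0 else f' q z.2 * M' z.1 c)).
  by apply: eq_bigr => q /andP[qD' _]; rewrite dot_sum_corner // mulrDr.
rewrite rE big_split; congr (_ + _).
case: eqP => _; first by rewrite big1 // => q _; rewrite mulr0.
by rewrite mulr_suml; apply: eq_bigr => q _; rewrite mulrA.
Qed.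

(** Every path from the source of row [z.1] enters [z] first, which gives [w z]; it then goes down
    to the sink, or left as in the smaller network. *)
Lemma row_sum_corner_row c : M z.1 c = w z * (if c == z.2 then 1 else M' z.1 c).
Proof.
rewrite row_sumE // (big_pred1 z) => [|q]; last first.
  apply/and3P/eqP => [[qD /eqP qz /existsP nex]|->].
    apply/eqP; apply: contraT => qz'; case: nex.
    have qD' : q \in D' by rewrite in_setD1 qz'.
    have [/existsP[q' h]|h] := boolP [exists q', row_next D' q q'].
      exists q'; rewrite row_next_corner //; by case/and5P: h.
    by exists z; rewrite row_next_corner_last qD' qz eqxx.
  split=> //; apply/existsP=> -[q1 /and5P[_ q1D /eqP e lt _]].
  by have := corner_row q1D (esym e); rewrite leqNgt lt.
congr (_ * _); rewrite dot_sumE //.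
rewrite [X in _ + X + _]big_pred0 ?addr0; last first.
  move=> q; apply/negP=> /and5P[_ qD /eqP e lt _].
  by have := corner_col qD (esym e); rewrite leqNgt lt.
have -> : [exists q, col_next D z q] = false.
  apply/existsP=> -[q /and5P[_ qD /eqP e lt _]].
  by have := corner_col qD (esym e); rewrite leqNgt lt.
rewrite andbT row_sum_corner'.
have rnP q : row_next D q z -> (f q c = f' q c) /\ (c = z.2 -> f' q c = 0).
  move=> qz; have lt : (q.2 < z.2)%N by case/and5P: qz.
  have qD' : q \in D' by move: qz; rewrite row_next_corner_last => /and3P[].
  have q0 : f' q z.2 = 0 by rewrite dot_sum_eq0.
  split; last by move=> ->.
  by rewrite dot_sum_corner ?q0 ?mul0r ?if_same ?addr0.
case: eqP => [cz|_] /=.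
  by rewrite big1 ?add0r // => q /rnP[-> ->]; rewrite ?mulr0.
by rewrite addr0; apply: eq_bigr => q /rnP[->].
Qed.
End Sums.
End Corner.

(** * Removing a corner box *)

Lemma setD1_id (T : finType) (a : T) (B : {set T}) : a \notin B -> B :\ a = B.
Proof.
by move=> aB; apply/setP=> b; rewrite !inE; case: eqP => // ->; rewrite (negPf aB).
Qed.

Lemma setU1_id (T : finType) (a : T) (B : {set T}) : a \in B -> a |: B = B.
Proof. by move=> aB; apply/setUidPr; rewrite sub1set. Qed.

Section LeMatrix.
Variables (R : comNzRingType) (k m : nat) (lam D : {set box k m}) (w : box k m -> R).
Hypotheses (ylam : young_diagram lam) (Dlam : D \subset lam).
Implicit Types (x : 'I_k) (c : 'I_m).

Lemma le_matrix_vlab x x' : le_matrix lam D w x (vlab lam x') = (x == x')%:R.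
Proof. by rewrite mxE vlab_in (inj_eq (vlab_inj ylam)) eq_sym. Qed.

(** The vertical labels strictly between are those of the rows below [x] that meet column [c].
    Outside [lam] the path sum is zero, so truncation in the exponent is harmless. *)
Lemma le_matrix_hlab x c : le_matrix lam D w x (hlab lam c)
  = (-1) ^+ (col_len lam c - x.+1) * row_sum lam D w x c.
Proof.
rewrite mxE (negPf (hlab_notin ylam c)) -/(row_sum lam D w x c).
case: (boolP ((x, c) \in lam)) => [xc|/(row_sum_eq0 ylam Dlam w) ->]; last by rewrite !mulr0.
congr (_ ^+ _ * _).
rewrite (_ : [set i in _ | _] = vlab lam @: ([set x' : 'I_k | (x' < col_len lam c)%N]
    :\: [set x' : 'I_k | (x' < x.+1)%N])).
  rewrite card_imset; last exact: vlab_inj.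
  rewrite cardsD (setIidPr _); last first.
    apply/subsetP=> x'; rewrite !inE ltnS => /leq_ltn_trans; apply.
    by rewrite -mem_col_len.
  by rewrite !card_ord_lt ?ltn_ord ?col_len_max.
have xc' : (x < col_len lam c)%N by rewrite -mem_col_len.
have sbE x' : strictly_between (vlab lam x) (hlab lam c) (vlab lam x')
    = (x < x' < col_len lam c)%N.
  rewrite /strictly_between vlab_lt // vlab_lt_hlab // hlab_lt_vlab // vlab_lt //.
  by rewrite mem_col_len //; apply/idP/idP; lia.
apply/setP=> j; apply/idP/imsetP => [|[x' + ->]]; rewrite inE.
  case/andP=> /imsetP[x' _ ->]; rewrite sbE => /andP[h1 h2].
  by exists x' => //; rewrite !inE h2 andbT -leqNgt.
by rewrite vlab_in sbE !inE -leqNgt.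
Qed.
End LeMatrix.

Section CornerMatrix.
Variables (k m : nat) (lam D : {set box k m}) (z : box k m).
Hypotheses (ylam : young_diagram lam) (Dlam : D \subset lam) (zD : z \in D).
Hypothesis corner : forall p, p \in lam -> box_le z p -> p = z.
Notation lam' := (lam :\ z).
Notation D' := (D :\ z).
Let ylam' : young_diagram lam' := young_corner ylam corner.
Let zl : z \in lam := subsetP Dlam _ zD.

Lemma corner_row_len : row_len lam z.1 = z.2.+1.
Proof.
rewrite -[RHS](card_ord_lt (ltn_ord z.2)); apply: eq_card => y; rewrite !inE ltnS.
apply/idP/idP => [h|h].
  rewrite leqNgt; apply/negP=> lt.
  have e : (z.1, y) = z by apply: corner h _; rewrite /box_le /= leqnn ltnW.
  by move: lt; rewrite -[in X in (X < _)%N]e ltnn.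
by apply: ylam zl _; rewrite /box_le leqnn.
Qed.

Lemma corner_col_len : col_len lam z.2 = z.1.+1.
Proof.
rewrite -[RHS](card_ord_lt (ltn_ord z.1)); apply: eq_card => x; rewrite !inE ltnS.
apply/idP/idP => [h|h].
  rewrite leqNgt; apply/negP=> lt.
  have e : (x, z.2) = z by apply: corner h _; rewrite /box_le /= leqnn ltnW.
  by move: lt; rewrite -[in X in (X < _)%N]e ltnn.
by apply: ylam zl _; rewrite /box_le leqnn andbT.
Qed.

Lemma row_len_corner x : row_len lam' x = if x == z.1 then z.2 : nat else row_len lam x.
Proof.
case: eqP => [->|/eqP xz].
  rewrite -[RHS](card_ord_lt (ltnW (ltn_ord z.2))); apply: eq_card => y.
  rewrite !inE mem_row_len // corner_row_len ltnS ltn_neqAle; congr (~~ _ && _).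
  by rewrite -pair_eqE /= /pair_eq /= eqxx.
apply: eq_card => y; rewrite !inE; case: eqVneq => // e.
by rewrite -e eqxx in xz.
Qed.

Lemma col_len_corner y : col_len lam' y = if y == z.2 then z.1 : nat else col_len lam y.
Proof.
case: eqP => [->|/eqP yz].
  rewrite -[RHS](card_ord_lt (ltnW (ltn_ord z.1))); apply: eq_card => x.
  rewrite !inE mem_col_len // corner_col_len ltnS ltn_neqAle; congr (~~ _ && _).
  by rewrite -pair_eqE /= /pair_eq /= eqxx andbT.
apply: eq_card => x; rewrite !inE; case: eqVneq => // e.
by rewrite -e eqxx in yz.
Qed.

Lemma hlab_corner : hlab lam z.2 = (vlab lam z.1).+1 :> nat.
Proof.
rewrite /= -/(row_len lam z.1) -/(col_len lam z.2) corner_row_len corner_col_len.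
by rewrite addSn.
Qed.

(** At [z] the path goes down and then left; without [z] it goes left and then down, so the two
    labels are exchanged. *)
Lemma vlab_corner' x : vlab lam' x = if x == z.1 then hlab lam z.2 else vlab lam x.
Proof.
apply: ord_inj; case: (x =P z.1) => [->|/eqP xz]; rewrite ?hlab_corner /=.
  rewrite -!/(row_len _ _) row_len_corner eqxx corner_row_len.
  by have := ltn_ord z.2; lia.
by rewrite -!/(row_len _ _) row_len_corner (negPf xz).
Qed.

Lemma hlab_corner' y : hlab lam' y = if y == z.2 then vlab lam z.1 else hlab lam y.
Proof.
apply: ord_inj; case: (y =P z.2) => [->|/eqP yz] /=.
  by rewrite -!/(col_len _ _) -/(row_len _ _) col_len_corner eqxx corner_row_len.
by rewrite -!/(col_len _ _) col_len_corner (negPf yz).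
Qed.

Variables (F : fieldType) (w : box k m -> F).
Hypothesis wz : w z != 0.
Notation A := (le_matrix lam D w).
Notation A' := (le_matrix lam' D' w).
Notation i := (vlab lam z.1).
Notation i' := (hlab lam z.2).

Definition corner_col_op : 'M[F]_(k, k + m) := \matrix_(r, j)
  if j == i then (w z)^-1 * (A' r i + A' r i') else A' r j.

(** Column [z.1] is forced: in [lam] the label [i] is that of row [z.1], so column [i] of the
    product has to be the unit vector of that row. *)
Definition corner_row_op : 'M[F]_k := \matrix_(r, s)
  ((r == s)%:R - (s == z.1)%:R * (if r == z.1 then 1 - w z else A' r i)).

Lemma le_matrix_col_corner r : A' r i =
  (-1) ^+ (z.1 - r.+1) * row_sum lam' D' w r z.2.
Proof.
have -> : i = hlab lam' z.2 by rewrite hlab_corner' eqxx.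
by rewrite le_matrix_hlab ?setSD // col_len_corner eqxx.
Qed.

Lemma row_sum_below (r : 'I_k) : (z.1 <= r)%N -> row_sum lam' D' w r z.2 = 0.
Proof.
move=> le; apply: row_sum_eq0; rewrite ?setSD // !inE negb_and negbK mem_col_len //.
rewrite corner_col_len ltnS; case: eqVneq => //= ne.
rewrite -ltnNge ltn_neqAle le andbT; apply: contra ne => /eqP e.
by apply/eqP/box_eq.
Qed.

Lemma det_corner_row_op : \det corner_row_op = w z.
Proof.
(* The matrix is upper triangular because [A' r i] vanishes for [r >= z.1], the box [(r, z.2)] being
   outside the smaller shape; hence the transposition. *)
rewrite -det_tr det_trig; last first.
  apply/is_trig_mxP=> r s lt; have sr : (s == r) = false by rewrite -val_eqE /= gtn_eqF.
  rewrite mxE [corner_row_op _ _]mxE sr; case: (eqVneq r z.1) => [rz|]; last first.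
    by rewrite mul0r subr0.
  rewrite -{1}rz sr le_matrix_col_corner row_sum_below ?mulr0 ?subr0 //.
  by rewrite -rz ltnW.
rewrite (bigD1 z.1) //= big1 ?mulr1; last first.
  by move=> r rz; rewrite mxE [corner_row_op _ _]mxE eqxx (negPf rz) mul0r subr0.
by rewrite mxE [corner_row_op _ _]mxE eqxx mul1r opprB addrC subrK.
Qed.

Lemma le_matrix_corner : A = corner_row_op *m corner_col_op.
Proof.
apply/matrixP=> r j; rewrite [RHS]mxE.
have -> : \sum_s corner_row_op r s * corner_col_op s j = corner_col_op r j
    - (if r == z.1 then 1 - w z else A' r i) * corner_col_op z.1 j.
  transitivity (\sum_s ((r == s)%:R * corner_col_op s j - (s == z.1)%:R *
     ((if r == z.1 then 1 - w z else A' r i) * corner_col_op s j))).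
    by apply: eq_bigr => s _; rewrite [corner_row_op r s]mxE mulrBl mulrA.
  rewrite sumrB; congr (_ - _).
    rewrite (bigD1 r) //= eqxx mul1r big1 ?addr0 // => s.
    by rewrite eq_sym => /negPf->; rewrite mul0r.
  rewrite (bigD1 z.1) //= eqxx mul1r big1 ?addr0 // => s.
  by move=> /negPf->; rewrite mul0r.
have Ai' s : A' s i' = (s == z.1)%:R.
  have -> : i' = vlab lam' z.1 by rewrite vlab_corner' eqxx.
  by rewrite le_matrix_vlab.
have Azi : A' z.1 i = 0 by rewrite le_matrix_col_corner row_sum_below ?mulr0.
have colE t j' : corner_col_op t j' =
    if j' == i then (w z)^-1 * (A' t i + A' t i') else A' t j' by rewrite mxE.
case: (labP ylam j) => -[s ->]; rewrite !colE.
  have -> : A r (vlab lam s) = (r == s)%:R by rewrite le_matrix_vlab.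
  rewrite (inj_eq (vlab_inj ylam)); case: (s =P z.1) => [->|/eqP sz].
    rewrite !Ai' Azi eqxx add0r mulr1; case: (r =P z.1) => [->|_] /=.
      by rewrite Azi; field.
    by field.
  have AsE t : A' t (vlab lam s) = (t == s)%:R.
    have -> : vlab lam s = vlab lam' s by rewrite vlab_corner' (negPf sz).
    by rewrite le_matrix_vlab.
  by rewrite !AsE [z.1 == s]eq_sym (negPf sz) mulr0 subr0.
rewrite eq_sym vlab_neq_hlab // le_matrix_hlab //.
have [->|sz] := eqVneq s z.2.
  rewrite !Ai' eqxx mulr1 corner_col_len subSS.
  have [->|rz] := eqVneq r z.1.
    by rewrite subnn mul1r (row_sum_corner_row ylam Dlam zD corner) eqxx mulr1 opprB addrC subrK.
  rewrite sub0r (row_sum_corner ylam Dlam zD corner _ _ rz) eqxx addr0 le_matrix_col_corner.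
  have [lt|ge] := ltnP r z.1; last by rewrite row_sum_below ?mulr0 ?oppr0.
  by rewrite -[in LHS](subnSK lt) exprS mulN1r mulNr.
have -> : hlab lam s = hlab lam' s by rewrite hlab_corner' (negPf sz).
rewrite !le_matrix_hlab ?setSD // col_len_corner (negPf sz).
have [->|rz] := eqVneq r z.1.
  by rewrite (row_sum_corner_row ylam Dlam zD corner) (negPf sz); ring.
rewrite (row_sum_corner ylam Dlam zD corner _ _ rz) (negPf sz) le_matrix_col_corner.
have [lt|ge] := ltnP r z.1; last first.
  by rewrite (row_sum_below ge) !mul0r mulr0 mul0r addr0 subr0.
have [zs|zs] := boolP ((z.1, s) \in lam'); last first.
  by rewrite (row_sum_eq0 _ _ _ zs) ?setSD // !mulr0 addr0 subr0.
move: zs; rewrite mem_col_len // col_len_corner (negPf sz) => zs.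
rewrite mulrDr; congr (_ + _).
(* The two factors are the signs of the two pieces of a path through [z]; the extra unit counts the
   row of [z] itself and matches the minus sign of the row operation. *)
have -> : (col_len lam s - r.+1 = (z.1 - r.+1 + (col_len lam s - z.1.+1)).+1)%N by lia.
by rewrite exprS exprD; ring.
Qed.

Notation minor X Y := (plucker (plucker_index lam X Y) A).
Notation minor' X Y := (plucker (plucker_index lam' X Y) A').

(** The labels trade roles: the presence of [i] is governed by [z.1] for [lam] and by [z.2] for the
    smaller shape, with complementary conventions, and conversely for [i']. *)
Lemma index_corner (X : {set 'I_k}) (Y : {set 'I_m}) :
  plucker_index lam X Y = plucker_index lam'
    (if z.2 \in Y then X :\ z.1 else z.1 |: X) (if z.1 \in X then Y :\ z.2 else z.2 |: Y).
Proof.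
apply: index_eqP => // [x|y].
  rewrite vlab_corner'; case: eqP => [->|/eqP xz].
    by rewrite hlab_in_index //; case: (z.2 \in Y); rewrite !inE eqxx.
  by rewrite vlab_in_index //; case: (z.2 \in Y); rewrite !inE ?xz ?(negPf xz).
rewrite hlab_corner'; case: eqP => [->|/eqP yz].
  by rewrite vlab_in_index //; case: (z.1 \in X); rewrite !inE eqxx.
by rewrite hlab_in_index //; case: (z.1 \in X); rewrite !inE ?yz ?(negPf yz).
Qed.

(** The four cases tell whether [i] and [i'] belong to the index set. Without [i], only the
    determinant [w z] is felt. With [i], it cancels the factor [(w z)^-1] of the column, and the sum
    of two columns gives one minor or two according to whether [i'] is present. No sign appears,
    which is the source of positivity. *)
Lemma minor_corner (X : {set 'I_k}) (Y : {set 'I_m}) : #|X| = #|Y| ->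
  minor X Y =
    if z.1 \in X then w z * (if z.2 \in Y then minor' (X :\ z.1) (Y :\ z.2) else minor' X Y)
    else if z.2 \in Y then minor' X Y else minor' X Y + minor' (z.1 |: X) (z.2 |: Y).
Proof.
move=> cXY; set H := plucker_index lam X Y.
have cH : #|H| = k by have := card_index ylam X Y; rewrite cXY => /addIn.
have HE := index_corner X Y; rewrite -/H in HE.
have iH : (i \in H) = (z.1 \notin X) by rewrite vlab_in_index.
have i'H : (i' \in H) = (z.2 \in Y) by rewrite hlab_in_index.
rewrite le_matrix_corner plucker_mulmx det_corner_row_op.
have ii' : i != i' by rewrite vlab_neq_hlab.
case: (boolP (z.1 \in X)) iH => zX /= iH.
  rewrite (eq_plucker (M := A')) //; last first.
    by move=> x j jH; rewrite mxE; case: eqP => // ji; rewrite -ji jH in iH.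
  congr (_ * _); rewrite HE zX; case: (boolP (z.2 \in Y)) => zY //.
  by rewrite (setU1_id zX) (setD1_id zY).
have cS : #|H :\ i|.+1 = k by move: cH; rewrite (cardsD1 i H) iH.
rewrite -[in LHS](setD1K iH) (plucker_col_add (M := A') (i := i) (i' := i') (c := (w z)^-1)) //.
- rewrite setD1K // mulrA mulfV // mul1r in_setD1 eq_sym ii' /= i'H.
  case: (boolP (z.2 \in Y)) => zY.
    by rewrite addr0 HE zY (negPf zX) (setU1_id zY) (setD1_id zX).
  rewrite addrC; congr (plucker _ _ + _); last first.
    by rewrite HE (negPf zX) (negPf zY).
  apply: index_eqP => // [x|y]; rewrite in_setU1 in_setD1.
    rewrite vlab_corner'; case: (x =P z.1) => [->|/eqP xz]; first by rewrite eqxx zX.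
    rewrite vlab_neq_hlab // (inj_eq (vlab_inj ylam)) xz /=.
    by rewrite /H vlab_in_index.
  rewrite hlab_corner'; case: (y =P z.2) => [->|/eqP yz].
    by rewrite (negPf ii') eqxx /= (negPf zY).
  rewrite (inj_eq (hlab_inj ylam)) (negPf yz) /= eq_sym vlab_neq_hlab //=.
  by rewrite /H hlab_in_index.
- exact: hlab_corner.
- by move=> x j ji; rewrite mxE (negPf ji).
- by move=> x; rewrite mxE eqxx.
- by rewrite !inE eqxx.
Qed.
End CornerMatrix.

(** * Minors of skew shapes *)

Section HasBox.
Variables (k m : nat).
Implicit Types (A lam mu : {set box k m}) (p z : box k m) (a b : nat).

Lemma has_boxP A a b :
  reflect (exists2 p, p \in A & p.1 = a :> nat /\ p.2 = b :> nat) (has_box A a b).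
Proof.
apply: (iffP existsP) => [[p /and3P[pA /eqP h1 /eqP h2]]|[p pA [h1 h2]]]; exists p => //.
by rewrite pA h1 h2 !eqxx.
Qed.

Lemma has_box_in A p : has_box A p.1 p.2 = (p \in A).
Proof.
apply/has_boxP/idP => [[q qA [h1 h2]]|pA]; last by exists p.
by rewrite -(box_eq h1 h2).
Qed.

Lemma has_box_ltk A a b : has_box A a b -> (a < k)%N.
Proof. by case/has_boxP=> p _ [<- _]. Qed.

Lemma has_box_ltm A a b : has_box A a b -> (b < m)%N.
Proof. by case/has_boxP=> p _ [_ <-]. Qed.

Lemma has_box_le lam a b a' b' : young_diagram lam -> has_box lam a b ->
  (a' <= a)%N -> (b' <= b)%N -> has_box lam a' b'.
Proof.
move=> yl h la lb; have lk := has_box_ltk h; have lm := has_box_ltm h.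
have [p pl [pa pb]] := has_boxP _ _ _ h.
apply/has_boxP; exists (Ordinal (leq_ltn_trans la lk), Ordinal (leq_ltn_trans lb lm)) => //.
by apply: yl pl _; rewrite /box_le /= pa pb la.
Qed.

Lemma has_boxD A mu a b : has_box (A :\: mu) a b = has_box A a b && ~~ has_box mu a b.
Proof.
apply/has_boxP/andP => [[p pA [<- <-]]|[/has_boxP[p pA [<- <-]]]].
  by move: pA; rewrite !has_box_in inE => /andP[].
by rewrite has_box_in => pm; exists p; rewrite // inE pm.
Qed.

Lemma has_boxD1 A z a b : has_box (A :\ z) a b =
  has_box A a b && ~~ ((a == z.1 :> nat) && (b == z.2 :> nat)).
Proof.
rewrite has_boxD; congr (_ && ~~ _); apply/has_boxP/andP => [[p]|[/eqP-> /eqP->]].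
  by rewrite inE => /eqP -> [<- <-].
by exists z; rewrite ?inE.
Qed.

Lemma corner_box A z a b : (forall p, p \in A -> box_le z p -> p = z) ->
  has_box A a b -> (z.1 <= a)%N -> (z.2 <= b)%N -> a = z.1 /\ b = z.2.
Proof.
by move=> cz /has_boxP[p pA [<- <-]] h1 h2; rewrite (cz p pA) // /box_le h1.
Qed.

Lemma skew_ind mu (P : {set box k m} -> Prop) : young_diagram mu -> P mu ->
    (forall lam z, young_diagram lam -> mu \subset lam -> z \in lam :\: mu ->
       (forall p, p \in lam -> box_le z p -> p = z) ->
       young_diagram (lam :\ z) -> mu \subset lam :\ z -> P (lam :\ z) -> P lam) ->
  forall lam, young_diagram lam -> mu \subset lam -> P lam.
Proof.
move=> ymu P0 PS lam; have [n] := ubnP #|lam|; elim: n lam => // n IH lam.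
rewrite ltnS => le ylam mulam.
have [/eqP|[z0 z0D]] := set_0Vmem (lam :\: mu).
  rewrite setD_eq0 => lammu; suff -> : lam = mu by [].
  by apply/eqP; rewrite eqEsubset lammu.
(* A box outside [mu] with maximal coordinate sum is a southeast corner of [lam], since every box of
   [lam] southeast of it is also outside [mu]. *)
case: (arg_maxnP (fun p : box k m => p.1 + p.2)%N z0D) => z zD zmax.
have /setDP[zl zmu] := zD.
have cz p : p \in lam -> box_le z p -> p = z.
  move=> pl zp; have pD : p \in lam :\: mu.
    by rewrite inE pl andbT; apply: contra zmu => /ymu; apply.
  have := zmax p pD; move: zp; rewrite /box_le /= => /andP[h1 h2] h3.
  by apply: box_eq; lia.
have ylam' := young_corner ylam cz.
have mulam' : mu \subset lam :\ z by rewrite subsetD1 mulam.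
apply: (PS lam z) => //; apply: IH => //.
by move: le; rewrite (cardsD1 z lam) zl.
Qed.

End HasBox.

(** * Two criteria for a minor to vanish *)

Section Vanishing.
Variables (F : fieldType) (k m : nat).
Implicit Types (M : 'M[F]_(k, k + m)) (H : {set 'I_(k + m)}).

Lemma plucker_row0 M H x : #|H| = k ->
  (forall j, j \in H -> M x j = 0) -> plucker H M = 0.
Proof.
move=> cH M0; apply/eqP/det0P; exists (delta_mx 0 x).
  by apply/eqP=> /rowP/(_ x)/eqP; rewrite !mxE !eqxx oner_eq0.
by rewrite -rowE; apply/rowP=> j; rewrite !mxE M0 // nth_enum_in.
Qed.

(** The columns [l x] are unit vectors, so column [j] is the combination of them whose coefficients
    are its own entries; the last hypothesis confines this combination to columns of [H]. *)
Lemma plucker_col_span M H j (l : 'I_k -> 'I_(k + m)) : #|H| = k -> j \in H ->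
    (forall x, l x != j) -> (forall x x', M x (l x') = (x == x')%:R) ->
    (forall x, l x \notin H -> M x j = 0) ->
  plucker H M = 0.
Proof.
move=> cH jH lj Ml M0; apply/eqP; rewrite /plucker -det_tr; apply/det0P.
pose f (t : 'I_k) := nth (lshift m t) (enum H) t.
have fK i : i \in H -> exists2 t, f t = i & forall s, f s = i -> s = t.
  rewrite -mem_enum => iH; have lt : (index i (enum H) < k)%N by rewrite -[X in (_ < X)%N]cH cardE index_mem.
  exists (Ordinal lt) => [|s fs]; first by rewrite /f /= nth_index.
  by apply: val_inj; rewrite /= -fs index_uniq ?enum_uniq // -cardE cH.
have sumf i (h : 'I_(k + m) -> F) : \sum_t (f t == i)%:R * h (f t)
    = (i \in H)%:R * h i.
  have [iH|iH] := boolP (i \in H); last first.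
    rewrite mul0r big1 // => t _; case: eqP => [e|]; last by rewrite mul0r.
    by move: iH; rewrite -e nth_enum_in.
  have [t ft tu] := fK i iH; rewrite (bigD1 t) //= ft eqxx big1 ?addr0 // => s st.
  case: eqP => [/tu e|_]; last by rewrite mul0r.
  by rewrite e eqxx in st.
exists (\row_t ((f t == j)%:R - \sum_x (f t == l x)%:R * M x j)).
  have [t ft _] := fK j jH; apply/eqP=> /rowP/(_ t)/eqP; rewrite !mxE ft eqxx big1.
    by rewrite subr0 oner_eq0.
  by move=> x _; rewrite eq_sym (negPf (lj x)) mul0r.
apply/rowP=> r; rewrite !mxE.
transitivity (\sum_t (f t == j)%:R * M r (f t)
    - \sum_x M x j * \sum_t (f t == l x)%:R * M r (f t)).
  under [X in _ - X]eq_bigr => x _ do rewrite mulr_sumr.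
  rewrite exchange_big -sumrB; apply: eq_bigr => t _; rewrite !mxE mulrBl; congr (_ - _).
  by rewrite mulr_suml; apply: eq_bigr => x _; rewrite mulrAC mulrC mulrA.
rewrite sumf jH mul1r; under eq_bigr => x _ do rewrite (sumf _ (M r)) Ml.
rewrite (bigD1 r) //= eqxx mulr1 big1 => [|x /negPf]; last by rewrite eq_sym => ->; rewrite !mulr0.
rewrite addr0; case: (boolP (l r \in H)) => [_|/M0 ->]; first by rewrite mulr1 subrr.
by rewrite mul0r subr0.
Qed.
End Vanishing.

Section Minors.
Variables (k m : nat) (mu : {set box k m}).
Hypothesis ymu : young_diagram mu.
Implicit Types (lam : {set box k m}).

Lemma skew_corner lam z : (lam :\ z) :\: mu = (lam :\: mu) :\ z.
Proof. by apply/setP=> p; rewrite !inE andbCA. Qed.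

Variable F : fieldType.
Implicit Types (w : box k m -> F).

Lemma plucker_vlabs lam w : young_diagram lam ->
  plucker (vlabs lam) (le_matrix lam (lam :\: mu) w) = 1.
Proof.
move=> yl; rewrite -[RHS](det1 F k); congr (\det _).
have -> : enum (vlabs lam) = map (vlab lam) (enum 'I_k).
  apply: ord_sorted_eq; first exact: enum_ord_sorted.
    rewrite sorted_map; have := @enum_ord_sorted k setT.
    have -> : enum [set: 'I_k] = enum 'I_k by apply: eq_enum => x; rewrite inE.
    by apply: sub_sorted => x y /= lt; rewrite vlab_homo.
  move=> j; rewrite mem_enum; apply/imsetP/mapP => -[x _ ->]; exists x => //.
  by rewrite mem_enum.
apply/matrixP=> x y; rewrite mxE (nth_map y) ?size_enum_ord //.
by rewrite nth_ord_enum le_matrix_vlab // mxE.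
Qed.

Lemma minor_empty lam w (X : {set 'I_k}) (Y : {set 'I_m}) : young_diagram lam ->
  #|X| = #|Y| -> (0 < #|X|)%N -> lam :\: mu = set0 ->
  plucker (plucker_index lam X Y) (le_matrix lam (lam :\: mu) w) = 0.
Proof.
move=> yl cXY; rewrite cXY card_gt0 => /set0Pn[y yY] D0.
have cH : #|plucker_index lam X Y| = k by have := card_index yl X Y; rewrite cXY => /addIn.
apply: (plucker_col_span (j := hlab lam y) (l := vlab lam)) => //.
- by rewrite hlab_in_index.
- by move=> x; rewrite vlab_neq_hlab.
- by move=> x x'; rewrite le_matrix_vlab.
move=> x _; rewrite le_matrix_hlab ?subsetDl // D0 row_sumE ?sub0set // big1 ?mulr0 // => q.
by rewrite inE.
Qed.

(** The recursion over corners only adds and multiplies, so it preserves the alternative. The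
    expression is chosen before [w]: one formula has to serve the whole cell. *)
Lemma minor_sf_or_zero lam (X : {set 'I_k}) (Y : {set 'I_m}) :
    young_diagram lam -> mu \subset lam -> #|X| = #|Y| ->
    let P w := plucker (plucker_index lam X Y) (le_matrix lam (lam :\: mu) w) in
  (forall w, (forall p, w p != 0) -> P w = 0)
  \/ (exists e : sf_expr (box k m), forall w, (forall p, w p != 0) -> P w = sf_eval w e).
Proof.
move=> yl ml; move: X Y; pattern lam; move: lam yl ml; apply: skew_ind ymu _ _.
  move=> X Y cXY P; have [X0|Xn0] := eqVneq #|X| 0%N.
    right; exists SFone => w _; rewrite /P.
    have -> : X = set0 by apply/eqP; rewrite -cards_eq0 X0.
    have -> : Y = set0 by apply/eqP; rewrite -cards_eq0 -cXY X0.
    by rewrite index0 plucker_vlabs.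
  by left=> w _; rewrite /P minor_empty ?setDv // lt0n.
move=> lam z yl ml zD cz yl' ml' IH X Y cXY P.
have Pz w : (forall p, w p != 0) -> P w =
    if z.1 \in X then w z * (if z.2 \in Y
      then plucker (plucker_index (lam :\ z) (X :\ z.1) (Y :\ z.2))
             (le_matrix (lam :\ z) ((lam :\ z) :\: mu) w)
      else plucker (plucker_index (lam :\ z) X Y) (le_matrix (lam :\ z) ((lam :\ z) :\: mu) w))
    else if z.2 \in Y
      then plucker (plucker_index (lam :\ z) X Y) (le_matrix (lam :\ z) ((lam :\ z) :\: mu) w)
      else plucker (plucker_index (lam :\ z) X Y) (le_matrix (lam :\ z) ((lam :\ z) :\: mu) w)
       + plucker (plucker_index (lam :\ z) (z.1 |: X) (z.2 |: Y))
           (le_matrix (lam :\ z) ((lam :\ z) :\: mu) w).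
  by move=> w0; rewrite /P skew_corner; apply: (minor_corner yl (subsetDl _ _) zD cz (w0 z) cXY).
have := IH X Y cXY; case: (boolP (z.1 \in X)) Pz => zX; case: (boolP (z.2 \in Y)) => zY Pz.
- have cXY' : #|X :\ z.1| = #|Y :\ z.2|.
    by move: cXY; rewrite (cardsD1 z.1 X) (cardsD1 z.2 Y) zX zY => /addnI.
  case: (IH _ _ cXY') => [h|[e h]] _; first by left=> w w0; rewrite Pz // h ?mulr0.
  by right; exists (SFmul (SFvar z) e) => w w0; rewrite Pz //= h.
- case=> [h|[e h]]; first by left=> w w0; rewrite Pz // h ?mulr0.
  by right; exists (SFmul (SFvar z) e) => w w0; rewrite Pz //= h.
- case=> [h|[e h]]; first by left=> w w0; rewrite Pz // h.
  by right; exists e => w w0; rewrite Pz //= h.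
have cXY' : #|z.1 |: X| = #|z.2 |: Y| by rewrite !cardsU1 zX zY cXY.
case: (IH _ _ cXY') => [h|[e h]] [h'|[e' h']].
- by left=> w w0; rewrite Pz // h ?h' ?addr0.
- by right; exists e' => w w0; rewrite Pz //= h ?h' ?addr0.
- by right; exists e => w w0; rewrite Pz //= h ?h' ?add0r.
by right; exists (SFadd e' e) => w w0; rewrite Pz //= h ?h'.
Qed.

Definition interval n (a l : nat) : {set 'I_n} := [set x : 'I_n | (a <= x < a + l)%N].

Definition interval_index lam (a b l : nat) : {set 'I_(k + m)} :=
  plucker_index lam (interval k a l) (interval m b l).

Definition diag_monomial lam w (a b : nat) : F :=
  \prod_(p in lam | (a <= p.1)%N && (b + p.1 <= p.2 + a)%N) w p.

Lemma interval0 n a : interval n a 0 = set0.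
Proof. by apply/setP=> x; rewrite !inE addn0; lia. Qed.

Lemma card_interval n a l : (a + l <= n)%N -> #|interval n a l| = l.
Proof.
move=> le; have -> : interval n a l = [set x : 'I_n | (x < a + l)%N] :\: [set x : 'I_n | (x < a)%N].
  by apply/setP=> x; rewrite !inE -leqNgt.
rewrite cardsD (setIidPr _); last by apply/subsetP=> x; rewrite !inE; lia.
by rewrite !card_ord_lt ?addKn //; lia.
Qed.

(* [diag_monomial] takes the value [1] used by [diag_minor] outside the shape. *)
Lemma diag_monomial_out lam w a b : young_diagram lam -> ~~ has_box lam a b ->
  diag_monomial lam w a b = 1.
Proof.
move=> yl nl; rewrite /diag_monomial big_pred0 // => p.
apply/negP=> /and3P[pl h1 h2]; case/negP: nl.
by apply: has_box_le yl (_ : has_box lam p.1 p.2) _ _; rewrite ?has_box_in //; lia.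
Qed.

Lemma diag_monomial_corner lam w z a b : z \in lam -> diag_monomial lam w a b =
  (if (a <= z.1)%N && (b + z.1 <= z.2 + a)%N then w z else 1)
  * diag_monomial (lam :\ z) w a b.
Proof.
move=> zl; rewrite /diag_monomial.
rewrite [X in _ = _ * X](eq_bigl (fun p => [&& p \in lam, (a <= p.1)%N &
  (b + p.1 <= p.2 + a)%N] && (p != z))); last first.
  by move=> p; rewrite in_setD1; case: eqP; rewrite ?andbF ?andbT.
case: ifP => h; first by rewrite (bigD1 z) // zl.
rewrite mul1r; apply: eq_bigl => p; case: eqP => [->|]; last by rewrite andbT.
by rewrite h andbF.
Qed.

(** Removing a corner [z] produces the factor [w z] exactly when row [z.1] is among the chosen rows.
    As the interval reaches the end of its diagonal, this happens exactly when [z] lies in the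
    region of the monomial. *)
Lemma minor_diag lam w a b l : young_diagram lam -> mu \subset lam ->
    (forall p, w p != 0) -> ~~ has_box lam (a + l) (b + l) ->
    ((0 < l)%N -> has_box (lam :\: mu) a b && has_box lam (a + l.-1) (b + l.-1)) ->
  plucker (interval_index lam a b l) (le_matrix lam (lam :\: mu) w) = diag_monomial lam w a b.
Proof.
move=> yl ml w0; move: l; pattern lam; move: lam yl ml; apply: skew_ind ymu _ _.
  move=> [|l] nl hl; last by have := hl isT; rewrite setDv => /andP[/has_boxP[p]]; rewrite inE.
  rewrite /interval_index !interval0 index0 plucker_vlabs // diag_monomial_out //.
  by rewrite !addn0 in nl.
move=> lam z yl ml zD cz yl' ml' IH [|l] nl hl.
  rewrite /interval_index !interval0 index0 plucker_vlabs // diag_monomial_out //.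
  by rewrite !addn0 in nl.
have /andP[abD el] := hl isT; have zl : z \in lam by case/setDP: zD.
have zlb : has_box lam z.1 z.2 by rewrite has_box_in.
have := abD; rewrite has_boxD => /andP[abl _].
have lk := has_box_ltk el; have lm := has_box_ltm el; rewrite /= in lk lm el.
set X := interval k a l.+1; set Y := interval m b l.+1.
have cXY : #|X| = #|Y| by rewrite !card_interval //; clear - lk lm; lia.
have zX : (z.1 \in X) = (a <= z.1 < a + l.+1)%N by rewrite inE.
have zY : (z.2 \in Y) = (b <= z.2 < b + l.+1)%N by rewrite inE.
have IHl : ~~ ((z.1 \in X) && (z.2 \in Y)) ->
    plucker (plucker_index (lam :\ z) X Y) (le_matrix (lam :\ z) ((lam :\ z) :\: mu) w)
    = diag_monomial (lam :\ z) w a b.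
  rewrite zX zY => nXY; apply: IH => [|_]; first by rewrite has_boxD1 negb_and nl.
  by rewrite skew_corner !has_boxD1 abD el /=; clear - nXY; lia.
rewrite /interval_index -/X -/Y (minor_corner yl (subsetDl _ _) zD cz (w0 z) cXY) -skew_corner.
rewrite (diag_monomial_corner _ _ _ zl).
case: (boolP (z.1 \in X)) IHl => zX' IHl; rewrite zX in zX'.
  case: (boolP (z.2 \in Y)) IHl => zY' IHl; rewrite zY in zY'.
    (* A corner met by both intervals can only be the last box of the diagonal, so the interval
       loses its last element. *)
    have [e1 e2] : (a + l)%N = z.1 /\ (b + l)%N = z.2.
      by apply: corner_box cz el _ _; clear - zX' zY'; lia.
    rewrite -e1 -e2 leq_addr (_ : (_ <= _)%N); last by clear; lia.
    rewrite /=; congr (_ * _).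
    have -> : X :\ z.1 = interval k a l.
      by apply/setP=> x; rewrite !inE -val_eqE /= -e1; clear; lia.
    have -> : Y :\ z.2 = interval m b l.
      by apply/setP=> x; rewrite !inE -val_eqE /= -e2; clear; lia.
    apply: IH => [|l0]; first by rewrite has_boxD1 e1 e2 !eqxx andbF.
    rewrite skew_corner !has_boxD1 abD /=.
    rewrite (has_box_le (a' := a + l.-1) (b' := b + l.-1) yl el); clear - l0 e1 e2; lia.
  have zb : (b + l.+1 <= z.2)%N.
    rewrite leqNgt; apply/negP=> lt; have := @corner_box _ _ _ _ _ _ cz el.
    clear - zX' zY' lt; lia.
  have -> : (a <= z.1)%N && (b + z.1 <= z.2 + a)%N by clear - zX' zb; lia.
  by rewrite IHl.
have -> : (a <= z.1)%N && (b + z.1 <= z.2 + a)%N = false.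
  apply/negP=> /andP[h1 h2]; case/negP: nl; apply: has_box_le yl zlb _ _; clear - zX' h1 h2; lia.
rewrite mul1r; case: (boolP (z.2 \in Y)) IHl => zY' IHl; rewrite zY in zY'; first by rewrite IHl.
(* The second minor vanishes: if [z] lies above the chosen rows, its column is spanned by unit
   columns already present; if it lies below them, its row is zero. *)
rewrite IHl // [X in _ + X](_ : _ = 0) ?addr0 //.
have cX'Y' : #|z.1 |: X| = #|z.2 |: Y| by rewrite !cardsU1 zX zY (negPf zX') (negPf zY') cXY.
have cH : #|plucker_index (lam :\ z) (z.1 |: X) (z.2 |: Y)| = k.
  by have := card_index yl' (z.1 |: X) (z.2 |: Y); rewrite cX'Y' => /addIn.
have [za|za] := ltnP z.1 a.
  have zb : (b + l.+1 <= z.2)%N.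
    rewrite leqNgt; apply/negP=> lt; have := @corner_box _ _ _ _ _ _ cz abl.
    clear - zY' lt za; lia.
  apply: (plucker_col_span (j := hlab (lam :\ z) z.2) (l := vlab (lam :\ z))) => //.
  - by rewrite hlab_in_index // !inE eqxx.
  - by move=> x; rewrite vlab_neq_hlab.
  - by move=> x x'; rewrite le_matrix_vlab.
  move=> x; rewrite vlab_in_index // negbK => xX.
  rewrite le_matrix_hlab ?subsetDl // row_sum_eq0 ?subsetDl ?mulr0 //.
  rewrite -has_box_in /= has_boxD1 eqxx andbT; apply/negP=> /andP[xl /eqP xz].
  move: xX; rewrite in_setU1 -val_eqE inE => /orP[/eqP//|xX].
  by have := @corner_box _ _ _ _ _ _ cz xl; clear - xX za; lia.
have zb : (z.2 < b)%N.
  rewrite ltnNge; apply/negP=> lt; case/negP: nl.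
  by apply: has_box_le yl zlb _ _; clear - zX' zY' za lt; lia.
apply: (plucker_row0 (x := z.1)) => // j; case: (labP yl' j) => -[s ->].
  rewrite vlab_in_index // le_matrix_vlab // in_setU1 negb_or => /andP[+ _].
  by rewrite eq_sym => /negPf->.
rewrite hlab_in_index // => sY.
rewrite le_matrix_hlab ?subsetDl // row_sum_eq0 ?subsetDl ?mulr0 //.
rewrite -has_box_in /= has_boxD1 eqxx /=; apply/negP=> /andP[xl /eqP xz].
move: sY; rewrite in_setU1 -val_eqE inE => /orP[/eqP//|sY].
by have := @corner_box _ _ _ _ _ _ cz xl; clear - sY zb; lia.
Qed.
End Minors.

(** * Positive points and diagonal monomials *)

Section PositivePoints.
Variable R : realFieldType.

Lemma digits_inj N n (d d' : nat -> nat) :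
    (forall i, (i < n)%N -> (d i < N)%N) -> (forall i, (i < n)%N -> (d' i < N)%N) ->
    (\sum_(i < n) d i * N ^ i = \sum_(i < n) d' i * N ^ i)%N ->
  forall i, (i < n)%N -> d i = d' i.
Proof.
elim: n d d' => // n IH d d' dN d'N.
have N0 : (0 < N)%N by apply: leq_ltn_trans (dN 0%N isT).
rewrite !big_ord_recl !muln1.
have E (c : nat -> nat) : (\sum_(i < n) c (bump 0 i) * N ^ bump 0 i
    = (\sum_(i < n) c i.+1 * N ^ i) * N)%N.
  by rewrite big_distrl; apply: eq_bigr => i _; rewrite /bump add1n expnSr mulnA.
rewrite !E => e.
have e0 : d 0%N = d' 0%N.
  have := congr1 (modn^~ N) e; rewrite ![(_ + _ * N)%N]addnC !modnMDl.
  by rewrite !modn_small ?dN ?d'N.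
have /eqP := e; rewrite e0 eqn_add2l eqn_pmul2r // => /eqP e'.
case=> [|i] lt //; apply: (IH (fun i => d i.+1) (fun i => d' i.+1)) => // j lj.
  exact: dN.
exact: d'N.
Qed.

Lemma poly_pos_eq0 (p : {poly R}) : (forall t, 0 < t -> p.[t] = 0) -> p = 0.
Proof.
move=> p0; apply/eqP; apply: contraT => pn0.
(* These are [size p] distinct positive roots, one more than a nonzero polynomial of that size can
   have. *)
have /(_ [seq i.+1%:R | i <- iota 0 (size p)]) := max_poly_roots pn0.
rewrite size_map size_iota ltnn; apply.
  by apply/allP=> _ /mapP[i _ ->]; rewrite /root p0 ?ltr0Sn.
rewrite map_inj_uniq ?iota_uniq // => i j /eqP.
by rewrite eqr_nat eqSS => /eqP.
Qed.

(* Kronecker's substitution x_i = t ^ (N ^ i). *)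
Lemma mpoly_pos_eq0 n (f : {mpoly R[n]}) :
  (forall x : 'I_n -> R, (forall i, 0 < x i) -> f.@[x] = 0) -> f = 0.
Proof.
(* [msize f] exceeds every exponent occurring in [f], so by uniqueness of digits in base [N]
   distinct monomials yield distinct powers of [t]. *)
move=> f0; pose N := msize f; pose kap (m : 'X_{1..n}) := (\sum_(i < n) m i * N ^ i)%N.
pose p := \sum_(m <- msupp f) f@_m *: 'X^(kap m).
have p0 : p = 0.
  apply: poly_pos_eq0 => t t0; rewrite -(f0 (fun i => t ^+ (N ^ i))); last first.
    by move=> i; rewrite exprn_gt0.
  rewrite mevalE horner_sum; apply: eq_bigr => m _; rewrite hornerZ hornerXn.
  congr (_ * _); rewrite /kap expr_sum; apply: eq_bigr => i _.
  by rewrite -exprM mulnC.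
apply/mpolyP=> m; rewrite mcoeff0; apply/eqP; rewrite mcoeff_eq0; apply/negP=> mf.
have := congr1 (fun q : {poly R} => q`_(kap m)) p0; rewrite coef0 coef_sum.
rewrite (bigD1_seq m) ?msupp_uniq //= coefZ coefXn eqxx mulr1 big1_seq ?addr0.
  by move/eqP; rewrite mcoeff_eq0 mf.
move=> m' /andP[m'm m'f]; rewrite coefZ coefXn; case: eqP => [e|]; last by rewrite mulr0.
have lt (m1 : 'X_{1..n}) (i : 'I_n) : m1 \in msupp f -> (m1 i < N)%N.
  move=> /msize_mdeg_lt; apply: leq_ltn_trans.
  by rewrite mdegE (bigD1 i) //= leq_addr.
case/eqP: m'm; apply/mnmP=> i.
pose d (m1 : 'X_{1..n}) j := if insub j is Some i then m1 i else 0%N.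
have dE m1 (j : 'I_n) : d m1 j = m1 j by rewrite /d valK.
rewrite -!dE; apply: (@digits_inj N n) => //.
- by move=> j lj; rewrite (dE _ (Ordinal lj)) lt.
- by move=> j lj; rewrite (dE _ (Ordinal lj)) lt.
by under eq_bigr => j _ do rewrite dE; under [RHS]eq_bigr => j _ do rewrite dE.
Qed.
End PositivePoints.

Section Weights.
Variables (R : comNzRingType) (k m : nat) (lam D : {set box k m}).

Lemma eq_le_matrix (w w' : box k m -> R) : {in D, w =1 w'} ->
  le_matrix lam D w = le_matrix lam D w'.
Proof.
move=> ww; apply/matrixP=> x j; rewrite !mxE; case: ifP => // _; congr (_ * _).
apply: eq_bigr => l _; apply: eq_bigr => P _; apply: eq_bigr => e _.
rewrite /net_weight; case: ifP => //; case: e => [u [p|//]] /=.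
by case: u => [q|i] /=; [case/and5P=> pD _ _ _ _ | case/andP=> pD _]; apply: ww.
Qed.
End Weights.

Section DiagMonomials.
Variables (F : fieldType) (k m : nat) (lam : {set box k m}) (w : box k m -> F).
Local Notation mon := (diag_monomial lam w).

Lemma diag_monomialS a b : mon a b =
  \prod_(p in lam | (p.1 == a :> nat) && (b <= p.2)%N) w p * mon a.+1 b.+1.
Proof.
rewrite /diag_monomial (bigID (fun p : box k m => p.1 == a :> nat)) /=.
by congr (_ * _); apply: eq_bigl => p; case: (p \in lam) => //=; lia.
Qed.

(** The quotient of [mon x y] by [mon x.+1 y.+1] is the product of the weights of row [x] from
    column [y] on; dividing two consecutive such products isolates one weight. *)
Lemma diag_monomial_weight (x : 'I_k) (y : 'I_m) : (x, y) \in lam ->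
  mon x y * mon x.+1 y.+2 = w (x, y) * (mon x y.+1 * mon x.+1 y.+1).
Proof.
move=> xyl; rewrite (diag_monomialS x y) (diag_monomialS x y.+1) (bigD1 (x, y)) /=; last first.
  by rewrite xyl eqxx leqnn.
rewrite (eq_bigl (fun p : box k m => (p \in lam) && (p.1 == x :> nat) && (y < p.2)%N)).
  by under [in RHS]eq_bigl => p do rewrite andbA; ring.
move=> p; case: (p \in lam) => //=; case: eqVneq => //= e.
rewrite ltn_neqAle andbC; congr (~~ _ && _).
rewrite -pair_eqE /= /pair_eq /= -val_eqE /= e eqxx /= -val_eqE /=.
by rewrite eq_sym.
Qed.
End DiagMonomials.

Section DiagLabels.
Variables (k m : nat) (lam : {set box k m}).
Hypothesis yl : young_diagram lam.

Lemma diag_len_box a b : has_box lam a b ->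
  has_box lam (a + diag_len lam a b) (b + diag_len lam a b).
Proof.
move=> ab; rewrite /diag_len; have k0 : (0 < k)%N by apply: leq_ltn_trans (has_box_ltk ab).
have P0 : has_box lam (a + Ordinal k0) (b + Ordinal k0) by rewrite /= !addn0.
have nonempty : (0 < #|[pred d : 'I_k | has_box lam (a + d) (b + d)]|)%N.
  by apply/card_gt0P; exists (Ordinal k0).
by have [d Pd ->] := eq_bigmax_cond (fun d : 'I_k => d : nat) nonempty.
Qed.

Lemma diag_len_max a b :
  ~~ has_box lam (a + (diag_len lam a b).+1) (b + (diag_len lam a b).+1).
Proof.
apply/negP=> h; have lk := has_box_ltk h.
have lt : ((diag_len lam a b).+1 < k)%N by apply: leq_ltn_trans lk; rewrite leq_addl.
have := @leq_bigmax_cond _ (fun d : 'I_k => has_box lam (a + d) (b + d)) (fun d => d : nat)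
  (Ordinal lt) h.
by rewrite -/(diag_len lam a b) /= ltnn.
Qed.

Lemma diag_indexE a b : diag_index lam a b = interval_index lam a b (diag_len lam a b).+1.
Proof. by congr plucker_index; apply/setP=> x; rewrite !inE addnS ltnS. Qed.
End DiagLabels.

(** * The cell and its TP-basis *)

Section Substitution.
Variables (T U : Type).

Fixpoint sf_bind (s : T -> sf_expr U) (e : sf_expr T) : sf_expr U :=
  match e with
  | SFvar v => s v
  | SFone => SFone
  | SFadd e1 e2 => SFadd (sf_bind s e1) (sf_bind s e2)
  | SFmul e1 e2 => SFmul (sf_bind s e1) (sf_bind s e2)
  | SFdiv e1 e2 => SFdiv (sf_bind s e1) (sf_bind s e2)
  end.

Lemma sf_eval_bind (R : fieldType) (x : U -> R) s e :
  sf_eval x (sf_bind s e) = sf_eval (fun v => sf_eval x (s v)) e.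
Proof. by elim: e => //= e1 -> e2 ->. Qed.

Lemma eq_sf_eval (R : fieldType) (x y : U -> R) e : x =1 y -> sf_eval x e = sf_eval y e.
Proof. by move=> xy; elim: e => //= e1 -> e2 ->. Qed.
End Substitution.

Section Cell.
Variables (R : realFieldType) (k m : nat) (lam mu : {set box k m}).
Hypotheses (yl : young_diagram lam) (ym : young_diagram mu) (ml : mu \subset lam).
Notation D := (lam :\: mu).
Implicit Types (w : box k m -> R) (M : 'M[R]_(k, k + m)) (H : {set 'I_(k + m)}).

Lemma has_box_skew_le a b a' b' : has_box D a b -> (a <= a')%N -> (b <= b')%N ->
  has_box lam a' b' -> has_box D a' b'.
Proof.
rewrite !has_boxD => /andP[_ nab] la lb ->; apply: contra nab => h.
exact: has_box_le ym h la lb.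
Qed.

(** Weights outside [D] do not affect the matrix; setting them to 1 makes all weights positive and
    agrees with [weight_expr] there. *)
Lemma in_cellP M : in_cell lam D M ->
  exists w, [/\ forall p, 0 < w p, forall p, p \notin D -> w p = 1 & represents lam D w M].
Proof.
case=> w w0 [g g0 MA]; exists (fun p => if p \in D then w p else 1); split.
- by move=> p; case: ifP => // /w0.
- by move=> p /negPf->.
by exists g => //; rewrite MA; congr (_ *m _); apply: eq_le_matrix => p ->.
Qed.

Lemma plucker_vlabs_represents w M : represents lam D w M ->
  exists2 g : 'M_k, \det g = plucker (vlabs lam) M & 0 < plucker (vlabs lam) M /\ M = g *m le_matrix lam D w.
Proof.
case=> g g0 MA; have e : plucker (vlabs lam) M = \det g.
  by rewrite MA plucker_mulmx plucker_vlabs ?mulr1.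
by exists g => //; rewrite e.
Qed.

Lemma plucker_vlabs_gt0 M : in_cell lam D M -> 0 < plucker (vlabs lam) M.
Proof. by case=> w _ /plucker_vlabs_represents[g _ []]. Qed.

Lemma plucker_diag w M a b : (forall p, 0 < w p) -> represents lam D w M -> has_box D a b ->
  plucker (diag_index lam a b) M = plucker (vlabs lam) M * diag_monomial lam w a b.
Proof.
move=> w0 /plucker_vlabs_represents[g eg [_ ->]] abD.
rewrite !plucker_mulmx plucker_vlabs // mulr1; congr (_ * _).
have wn0 p : w p != 0 by rewrite gt_eqF.
have abl : has_box lam a b by move: abD; rewrite has_boxD => /andP[].
rewrite diag_indexE minor_diag // ?diag_len_max // => _.
by rewrite abD diag_len_box.
Qed.

Lemma diag_monomial_gt0 w a b : (forall p, 0 < w p) -> 0 < diag_monomial lam w a b.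
Proof. by move=> w0; apply: prodr_gt0. Qed.

Lemma diag_index_in p : p \in D -> diag_index lam p.1 p.2 \in diag_set lam D.
Proof. by move=> pD; apply/setU1P; right; apply/imsetP; exists p. Qed.

Lemma diag_setP H : H \in diag_set lam D ->
  H = vlabs lam \/ exists2 p, p \in D & H = diag_index lam p.1 p.2.
Proof. by case/setU1P=> [|/imsetP[p pD ->]]; [left | right; exists p]. Qed.

Lemma card_diag_set H : H \in diag_set lam D -> #|H| = k.
Proof.
case/diag_setP=> [->|[p /setDP[pl _] ->]]; first exact: card_vlabs.
have h : has_box lam p.1 p.2 by rewrite has_box_in.
have := diag_len_box h; set d := diag_len _ _ _ => hd.
have := has_box_ltk hd; have := has_box_ltm hd => ld ld'.
have := card_index yl (interval k p.1 d.+1) (interval m p.2 d.+1).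
rewrite !card_interval; try by rewrite addnS.
by rewrite diag_indexE => /addIn.
Qed.

Lemma diag_set_gt0 H M : H \in diag_set lam D -> in_cell lam D M -> 0 < plucker H M.
Proof.
move=> HB cM; case/diag_setP: HB => [->|[p pD ->]]; first exact: plucker_vlabs_gt0.
have [w [w0 _ rep]] := in_cellP cM.
rewrite (plucker_diag w0 rep) ?has_box_in //.
by rewrite mulr_gt0 ?plucker_vlabs_gt0 ?diag_monomial_gt0.
Qed.

Definition diag_ratio (f : nat -> nat -> R) (a b : nat) : R :=
  f a b * f a.+1 b.+2 / (f a b.+1 * f a.+1 b.+1).

(** The function [f] is left general because it stands for the minors of a normalized matrix as well
    as for evaluated expressions. All boxes involved lie southeast of the dot [p], so they are dots
    or outside [lam]. *)
Lemma diag_monomial_ratio w (f : nat -> nat -> R) p : (forall p, 0 < w p) -> p \in D ->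
    (forall a b, has_box D a b -> f a b = diag_monomial lam w a b) ->
    (forall a b, ~~ has_box lam a b -> f a b = 1) ->
  diag_ratio f p.1 p.2 = w p.
Proof.
move=> w0 pD fD f1; have pl : p \in lam by case/setDP: pD.
have fE a b : (p.1 <= a)%N -> (p.2 <= b)%N -> f a b = diag_monomial lam w a b.
  move=> la lb; have [h|h] := boolP (has_box lam a b); last by rewrite f1 ?diag_monomial_out.
  by rewrite fD // (has_box_skew_le _ la lb) // has_box_in.
rewrite /diag_ratio !fE ?leqW //; move: pl; rewrite [p]surjective_pairing /= => pl.
rewrite diag_monomial_weight // mulfK // mulf_neq0 // gt_eqF ?diag_monomial_gt0 //.
Qed.

Lemma weight_diag_minors w M (x : 'I_k) (y : 'I_m) :
    positive_weights D w -> represents lam D w M -> plucker (vlabs lam) M = 1 ->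
  (x, y) \in D -> w (x, y) = diag_ratio (diag_minor lam M) x y.
Proof.
move=> w0 [g g0 MA] M1 xyD; pose w' p := if p \in D then w p else 1.
have w'0 p : 0 < w' p by rewrite /w'; case: ifP => // /w0.
have rep : represents lam D w' M.
  by exists g => //; rewrite MA; congr (_ *m _); apply: eq_le_matrix => p; rewrite /w' => ->.
have -> : w (x, y) = w' (x, y) by rewrite /w' xyD.
rewrite -(diag_monomial_ratio (f := diag_minor lam M) w'0 xyD) // => a b.
  rewrite /diag_minor => h; have := h; rewrite has_boxD => /andP[-> _].
  by rewrite (plucker_diag w'0 rep) // M1 mul1r.
by rewrite /diag_minor => /negPf->.
Qed.

Lemma in_cell_le_matrix w : (forall p, 0 < w p) -> in_cell lam D (le_matrix lam D w).
Proof.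
by move=> w0; exists w => //; exists 1%:M; rewrite ?mul1mx // det1.
Qed.

Local Notation B := (diag_set lam D).

Definition set_expr (H : {set 'I_(k + m)}) : sf_expr {G | G \in B} :=
  if insub H is Some G then SFvar G else SFone.

(** Dividing by the variable of [vlabs lam] removes the determinant of the change of representing
    matrix. *)
Definition minor_expr a b : sf_expr {G | G \in B} :=
  if has_box lam a b
  then SFdiv (set_expr (diag_index lam a b)) (set_expr (vlabs lam)) else SFone.

Definition weight_expr (p : box k m) : sf_expr {G | G \in B} :=
  if p \in D then
    SFdiv (SFmul (minor_expr p.1 p.2) (minor_expr p.1.+1 p.2.+2))
          (SFmul (minor_expr p.1 p.2.+1) (minor_expr p.1.+1 p.2.+1))
  else SFone.

Lemma diag_set_subtraction_free H : #|H| = k -> nonzero_in_cell R lam D H ->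
  subtraction_free_in R lam D B H.
Proof.
move=> cH nz; set X := [set x | vlab lam x \notin H]; set Y := [set y | hlab lam y \in H].
have HE : H = plucker_index lam X Y by apply: indexP.
have cXY : #|X| = #|Y|.
  by have := card_index yl X Y; rewrite -HE cH => /addnI.
case: (@minor_sf_or_zero k m mu ym R lam X Y yl ml cXY) => [h0|[e he]].
  (* An identically vanishing minor contradicts positivity at the point with all weights equal to
     1. *)
  have w0 p : (fun _ : box k m => 1 : R) p != 0 by apply: oner_neq0.
  have := nz _ (in_cell_le_matrix (w := fun=> 1) (fun=> ltr01)).
  by rewrite HE h0 ?ltxx // => p; apply: oner_neq0.
exists (SFmul (set_expr (vlabs lam)) (sf_bind weight_expr e)) => M cM.
have setE G : G \in B -> sf_eval (fun G => plucker (val G) M) (set_expr G) = plucker G M.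
  by move=> GB; rewrite /set_expr insubT.
have [w [w0 w1 rep]] := in_cellP cM; have v0 := plucker_vlabs_gt0 cM.
rewrite /= sf_eval_bind setE ?setU11 //.
have [g eg [_ ME]] := plucker_vlabs_represents rep.
rewrite {1}ME plucker_mulmx eg HE he; last by move=> p; rewrite gt_eqF.
congr (_ * _); apply: eq_sf_eval => p; rewrite /weight_expr.
case: (boolP (p \in D)) => [pD|/w1 ->//] /=.
rewrite -/(diag_ratio (fun a b => sf_eval (fun G => plucker (val G) M) (minor_expr a b)) p.1 p.2).
rewrite (diag_monomial_ratio w0 pD) // => a b; rewrite /minor_expr; last by move=> /negPf->.
move=> h; have := h; rewrite has_boxD => /andP[-> _] /=.
have [q qD [<- <-]] := has_boxP _ _ _ h.
rewrite !setE ?setU11 ?diag_index_in // (plucker_diag w0 rep) ?has_box_in //.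
by rewrite mulrC mulKf // gt_eqF.
Qed.

Hypothesis k_gt0 : (0 < k)%N.

(** The formula for the weights turns prescribed values into a point; that the monomials take these
    values is proved from the southeast inwards. It follows that a polynomial relation on the cell
    holds at all positive arguments. *)
Lemma diag_set_realize (Z : {set 'I_(k + m)} -> R) : (forall H, 0 < Z H) ->
  exists2 M, in_cell lam D M & forall H, H \in B -> plucker H M = Z H.
Proof.
move=> Z0.
pose zeta a b := if has_box lam a b then Z (diag_index lam a b) / Z (vlabs lam) else 1.
have zeta0 a b : 0 < zeta a b by rewrite /zeta; case: ifP => // _; rewrite divr_gt0.
pose w (p : box k m) := diag_ratio zeta p.1 p.2.
have w0 p : 0 < w p by rewrite divr_gt0 ?mulr_gt0.
have monE a b : (has_box lam a b -> has_box D a b) -> diag_monomial lam w a b = zeta a b.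
  have [n] := ubnP (k + m - (a + b)); elim: n a b => // n IH a b; rewrite ltnS => le ab.
  have [h|h] := boolP (has_box lam a b); last by rewrite diag_monomial_out // /zeta (negPf h).
  have lk := has_box_ltk h; have lm := has_box_ltm h.
  have step a' b' : (a <= a')%N -> (b <= b')%N -> (a + b < a' + b')%N ->
      diag_monomial lam w a' b' = zeta a' b'.
    move=> la lb lab; apply: IH; first by lia.
    by apply: has_box_skew_le (ab h) la lb.
  have [p pl [pa pb]] := has_boxP _ _ _ h.
  have := @diag_monomial_weight _ _ _ lam w p.1 p.2.
  rewrite -surjective_pairing pa pb => /(_ pl).
  rewrite (step a.+1 b.+2) ?(step a b.+1) ?(step a.+1 b.+1); try by clear; lia.
  rewrite /w /diag_ratio pa pb mulfVK; last by rewrite mulf_neq0 // gt_eqF.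
  by move/mulIf; apply; rewrite gt_eqF.
(* The value of the variable of [vlabs lam] is imposed by scaling one row, which exists because [k]
   is positive. *)
pose g : 'M[R]_k := diag_mx (\row_i if i == Ordinal k_gt0 then Z (vlabs lam) else 1).
have dg : \det g = Z (vlabs lam).
  rewrite det_diag (bigD1 (Ordinal k_gt0)) //= big1 ?mulr1 => [|i /negPf iN]; rewrite mxE ?eqxx //.
  by rewrite iN.
have rep : represents lam D w (g *m le_matrix lam D w) by exists g; rewrite ?dg.
have cM : in_cell lam D (g *m le_matrix lam D w) by exists w.
exists (g *m le_matrix lam D w) => //.
have vM : plucker (vlabs lam) (g *m le_matrix lam D w) = Z (vlabs lam).
  by rewrite plucker_mulmx plucker_vlabs ?mulr1.
move=> H /diag_setP[->//|[p pD ->]].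
have hp : has_box D p.1 p.2 by rewrite has_box_in.
rewrite (plucker_diag w0 rep hp) vM monE // /zeta has_box_in.
have -> : p \in lam by case/setDP: pD.
by rewrite mulrC divfK // gt_eqF.
Qed.

Lemma diag_set_independent : alg_independent R lam D B.
Proof.
move=> f f0; apply: mpoly_pos_eq0 => x x0.
have vB : vlabs lam \in B by apply: setU11.
have [M cM MZ] := @diag_set_realize (fun H => x (enum_rank_in vB H)) (fun=> x0 _).
rewrite -(f0 M cM); apply: meval_eq => i.
by rewrite MZ ?enum_valP // enum_valK_in.
Qed.

Lemma tp_basis_diag_set : tp_basis R lam D B.
Proof.
split; first exact: setU11.
- by move=> H HB; split=> [|M]; [apply: card_diag_set | apply: diag_set_gt0].
- exact: diag_set_independent.
by move=> H cH _ nz; apply: diag_set_subtraction_free.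
Qed.
End Cell.

(** * Minors of consecutive rows and columns *)

Section IntervalRelation.
Variables (k m : nat) (lam : {set box k m}).
Hypothesis yl : young_diagram lam.
Local Notation ii := (interval_index lam).

(** The four labels are the first and last row and the last and first column of a square block of
    size [l + 1]; [S] omits all rows of the block and contains its inner columns. Both rows precede
    both columns because the last box of the block is in [lam]. *)
Lemma interval_three_term r q l : (0 < l)%N -> has_box lam (r + l) (q + l) ->
  exists (S : {set 'I_(k + m)}) (a b c d : 'I_(k + m)),
    [/\ #|S|.+2 = k, (a < b < c)%N && (c < d)%N & [disjoint S & [set a; b; c; d]]] /\
    [/\ a |: (c |: S) = ii r.+1 q.+1 l, b |: (d |: S) = ii r q l,
        a |: (b |: S) = ii r.+1 q.+1 l.-1 /\ c |: (d |: S) = ii r q l.+1,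
        a |: (d |: S) = ii r.+1 q l & b |: (c |: S) = ii r q.+1 l].
Proof.
move=> l0 h; have lk := has_box_ltk h; have lm := has_box_ltm h.
have rk : (r < k)%N by clear - lk; lia.
have qm : (q < m)%N by clear - lm; lia.
pose x1 := Ordinal rk; pose x2 := Ordinal lk; pose y1 := Ordinal qm; pose y2 := Ordinal lm.
pose X := interval k r l.+1; pose Y := interval m q.+1 l.-1.
pose S := plucker_index lam X Y.
have vS x : (vlab lam x \in S) = (x \notin X) by rewrite vlab_in_index.
have hS y : (hlab lam y \in S) = (y \in Y) by rewrite hlab_in_index.
have vv := inj_eq (vlab_inj yl); have hh := inj_eq (hlab_inj yl).
have vh := vlab_neq_hlab yl.
have hv x y : (hlab lam y == vlab lam x) = false by rewrite eq_sym vh.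
exists S, (vlab lam x1), (vlab lam x2), (hlab lam y2), (hlab lam y1); split; split.
- have := card_index yl X Y; rewrite -/S !card_interval; first by clear - l0; lia.
    by clear - lm l0; lia.
  by clear - lk; lia.
- rewrite vlab_lt // vlab_lt_hlab // hlab_homo //=; last by clear - l0; lia.
  rewrite andbT -has_box_in h andbT; clear - l0; lia.
- apply/pred0P=> j /=; apply/negP=> /andP[jS]; rewrite !inE -!orbA.
  by case/or4P=> /eqP e; move: jS; rewrite e ?vS ?hS inE /=; clear - l0; lia.
- apply: index_eqP => // [x|y]; rewrite !in_setU1 ?vv ?hh ?vh ?hv ?vS ?hS -?val_eqE !inE /=;
    clear - l0; lia.
- apply: index_eqP => // [x|y]; rewrite !in_setU1 ?vv ?hh ?vh ?hv ?vS ?hS -?val_eqE !inE /=;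
    clear - l0; lia.
- split; apply: index_eqP => // [x|y];
    rewrite !in_setU1 ?vv ?hh ?vh ?hv ?vS ?hS -?val_eqE !inE /=; clear - l0; lia.
- apply: index_eqP => // [x|y]; rewrite !in_setU1 ?vv ?hh ?vh ?hv ?vS ?hS -?val_eqE !inE /=;
    clear - l0; lia.
apply: index_eqP => // [x|y]; rewrite !in_setU1 ?vv ?hh ?vh ?hv ?vS ?hS -?val_eqE !inE /=;
  clear - l0; lia.
Qed.

Lemma interval_relation (F : fieldType) (M : 'M[F]_(k, k + m)) r q l :
    (0 < l)%N -> has_box lam (r + l) (q + l) ->
  plucker (ii r.+1 q.+1 l) M * plucker (ii r q l) M =
  plucker (ii r.+1 q.+1 l.-1) M * plucker (ii r q l.+1) M
  + plucker (ii r.+1 q l) M * plucker (ii r q.+1 l) M.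
Proof.
move=> l0 h; have [S [a [b [c [d [[cS abcd dis] [<- <- [<- <-] <- <-]]]]]]] :=
  interval_three_term l0 h.
by case/andP: abcd => abc cd; apply: plucker_relation.
Qed.

Lemma interval_index_inj r q l r' q' l' : (0 < l)%N -> (0 < l')%N ->
    has_box lam (r + l.-1) (q + l.-1) -> has_box lam (r' + l'.-1) (q' + l'.-1) ->
  ii r q l = ii r' q' l' -> [/\ r = r', q = q' & l = l'].
Proof.
have intE n a b l1 l2 : (0 < l1)%N -> (0 < l2)%N -> (a + l1.-1 < n)%N -> (b + l2.-1 < n)%N ->
    interval n a l1 = interval n b l2 -> a = b /\ l1 = l2.
  move=> l10 l20 an bn /setP e.
  have an' : (a < n)%N by clear - an; lia.
  have bn' : (b < n)%N by clear - bn; lia.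
  have := e (Ordinal an); have := e (Ordinal bn); have := e (Ordinal an').
  have := e (Ordinal bn'); rewrite !inE /=; clear - l10 l20; lia.
move=> l0 l0' h h' /index_inj-/(_ yl)[e1 e2].
have [-> ->] := intE _ _ _ _ _ l0 l0' (has_box_ltk h) (has_box_ltk h') e1.
by have [-> _] := intE _ _ _ _ _ l0 l0' (has_box_ltm h) (has_box_ltm h') e2.
Qed.

Lemma interval_index_neq_vlabs r q l : (0 < l)%N -> has_box lam (r + l.-1) (q + l.-1) ->
  ii r q l != vlabs lam.
Proof.
move=> l0 h; apply/eqP; rewrite -(index0 lam) => /index_inj-/(_ yl)[/setP/(_ (Ordinal (has_box_ltk h)))].
by rewrite !inE /= => e _; move: e; clear - l0; lia.
Qed.

Lemma diag_index_interval a b l : (0 < l)%N -> has_box lam (a + l.-1) (b + l.-1) ->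
  ~~ has_box lam (a + l) (b + l) -> diag_index lam a b = ii a b l.
Proof.
move=> l0 h nh; rewrite diag_indexE; congr (ii _ _ _).
have ab : has_box lam a b by apply: has_box_le h _ _; rewrite ?leq_addr.
have h1 := diag_len_box ab; have h2 := diag_len_max lam a b.
set d := diag_len lam a b in h1 h2 *.
case: (ltngtP d.+1 l) => // lt.
  case/negP: h2; apply: has_box_le h _ _; rewrite ?leq_add2l //; clear - lt; lia.
case/negP: nh; apply: has_box_le h1 _ _; rewrite ?leq_add2l //; clear - lt; lia.
Qed.
End IntervalRelation.

Section IntervalPositivity.
Variables (R : realFieldType) (k m : nat) (lam mu : {set box k m}).
Hypotheses (yl : young_diagram lam) (ym : young_diagram mu) (ml : mu \subset lam).
Notation D := (lam :\: mu).
Local Notation ii := (interval_index lam).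

(** Induction from large to small [r + q + l]. An interval reaching the end of its diagonal gives a
    monomial; for any other one, the three-term relation multiplies its minor by a positive one and
    expresses the result through minors with a larger sum. *)
Lemma interval_index_gt0 (M : 'M[R]_(k, k + m)) r q l : in_cell lam D M ->
    ((0 < l)%N -> has_box D r q && has_box lam (r + l.-1) (q + l.-1)) ->
  0 < plucker (ii r q l) M.
Proof.
move=> cM; have [n] := ubnP (k + k + m - (r + q + l)); elim: n r q l => // n IH r q [|l].
  by rewrite /interval_index !interval0 index0 => _ _; apply: plucker_vlabs_gt0 cM.
rewrite ltnS => le /(_ isT)/andP[rq h]; rewrite /= in h.
have lk := has_box_ltk h; have lm := has_box_ltm h.
have up a b : (r <= a)%N -> (q <= b)%N -> has_box lam a b -> has_box D a b.
  exact: has_box_skew_le rq.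
have [h'|h'] := boolP (has_box lam (r + l.+1) (q + l.+1)); last first.
  have [w [w0 _ /plucker_vlabs_represents[]]] := in_cellP cM => // g eg [v0 ->].
  rewrite plucker_mulmx eg; apply: mulr_gt0 => //.
  rewrite (minor_diag ym) //; first exact: diag_monomial_gt0.
    by move=> p; rewrite gt_eqF.
  by rewrite rq h.
have lk' := has_box_ltk h'; have lm' := has_box_ltm h'.
have sub a b : (a <= r + l.+1)%N -> (b <= q + l.+1)%N -> has_box lam a b.
  exact: has_box_le yl h'.
have pos a b c : (r <= a)%N -> (q <= b)%N -> (a + c <= (r + l.+1).+1)%N ->
    (b + c <= (q + l.+1).+1)%N -> (r + q + l.+1 < a + b + c)%N -> 0 < plucker (ii a b c) M.
  move=> ra qb la lb lt; apply: IH; first by move: le lt lk' lm' la lb; clear; lia.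
  move=> c0; rewrite up //; last by apply: sub; move: c0 la lb; clear; lia.
  by apply: sub; move: c0 la lb; clear; lia.
have rel := interval_relation yl M (isT : (0 < l.+1)%N) h'.
have p1 : 0 < plucker (ii r.+1 q.+1 l.+1) M by apply: pos; clear; lia.
rewrite -(pmulr_rgt0 _ p1) rel addr_gt0 // mulr_gt0 //; apply: pos; clear; lia.
Qed.
End IntervalPositivity.

(** * Diagonals of a skew shape *)

Local Open Scope nat_scope.

Section Diagonals.
Variables (k m : nat) (lam mu : {set box k m}).
Hypotheses (yl : young_diagram lam) (ym : young_diagram mu).
Notation D := (lam :\: mu).
Implicit Types (p q : box k m) (a b c l : nat).

Lemma has_box_convex a b a' b' x y : has_box D a b -> has_box D a' b' ->
  a <= x <= a' -> b <= y <= b' -> has_box D x y.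
Proof.
move=> h h' /andP[h1 h2] /andP[h3 h4]; apply: (has_box_skew_le ym h h1 h3).
by move: h'; rewrite has_boxD => /andP[h' _]; apply: has_box_le yl h' h2 h4.
Qed.

(* The diagonal of index [c] consists of the boxes [(a, b)] with [c = b + k - a]. *)
Definition on_diag c a := (k <= a + c) && has_box D a (a + c - k).
Definition diag_start c := find (on_diag c) (iota 0 k).
Definition diag_end c := find (fun a => (diag_start c <= a) && ~~ on_diag c a) (iota 0 k).

(** This is convexity of the skew shape. On a diagonal without dots both searches fail and return
    [k], so the interval is empty. *)
Lemma on_diagE c a : on_diag c a = (diag_start c <= a < diag_end c).
Proof.
have conv x y z : on_diag c x -> on_diag c z -> x <= y <= z -> on_diag c y.
  move=> /andP[kx hx] /andP[kz hz] h; rewrite /on_diag (has_box_convex hx hz) //.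
    by move: kx h; clear; lia.
  by move: kx kz h; clear; lia.
have lk x : on_diag c x -> x < k by case/andP=> _ /has_box_ltk.
apply/idP/idP => [Pa|/andP[h1 h2]].
  have hasP : has (on_diag c) (iota 0 k).
    by apply/hasP; exists a => //; rewrite mem_iota lk.
  have s1 : diag_start c <= a.
    rewrite leqNgt; apply/negP=> lt; have := before_find 0 lt.
    by rewrite nth_iota ?lk // add0n Pa.
  rewrite s1 ltnNge; apply/negP=> le.
  have h : has (fun a => (diag_start c <= a) && ~~ on_diag c a) (iota 0 k).
    by rewrite has_find size_iota; apply: leq_ltn_trans le (lk _ Pa).
  have := nth_find 0 h; rewrite -/(diag_end c) nth_iota ?(leq_ltn_trans le) ?lk // add0n.
  have Ps : on_diag c (diag_start c).
    have := nth_find 0 hasP; rewrite nth_iota // -/(diag_start c).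
    exact: leq_ltn_trans s1 (lk _ Pa).
  by case/andP=> h1; case/negP; apply: conv Ps Pa _; rewrite h1.
have ak : a < k.
  by apply: leq_trans h2 _; rewrite -[leqRHS](size_iota 0) find_size.
by have := before_find 0 h2; rewrite nth_iota // add0n h1 /= => /negbFE.
Qed.

(** If an inequality failed, a box beyond the end of one diagonal would lie in the rectangle spanned
    by dots of the two diagonals, hence be a dot by convexity. *)
Lemma diag_steps c : diag_start c < diag_end c -> diag_start c.+1 < diag_end c.+1 ->
  diag_start c.+1 <= diag_start c <= (diag_start c.+1).+1
  /\ diag_end c.+1 <= diag_end c <= (diag_end c.+1).+1.
Proof.
move=> n0 n1.
have dg c' a : diag_start c' <= a < diag_end c' -> k <= a + c' /\ has_box D a (a + c' - k).
  by rewrite -on_diagE => /andP.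
have gd c' a : k <= a + c' -> has_box D a (a + c' - k) -> diag_start c' <= a < diag_end c'.
  by move=> h1 h2; rewrite -on_diagE /on_diag h1.
have [s1 s2] := dg c (diag_start c) ltac:(by rewrite leqnn).
have [s1' s2'] := dg c.+1 (diag_start c.+1) ltac:(by rewrite leqnn).
have [e1 e2] := dg c (diag_end c).-1 ltac:(clear - n0; lia).
have [e1' e2'] := dg c.+1 (diag_end c.+1).-1 ltac:(clear - n1; lia).
split; apply/andP; split.
- rewrite leqNgt; apply/negP=> lt; have := gd c.+1 (diag_start c).
  rewrite (has_box_convex s2 s2'); [|clear - lt; lia|clear - lt s1; lia].
  by move=> /(_ _ isT); clear - lt s1; lia.
- rewrite leqNgt; apply/negP=> lt; have := gd c (diag_start c.+1).+1.
  rewrite (has_box_convex s2' s2); [|clear - lt; lia|clear - lt s1 s1'; lia].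
  by move=> /(_ _ isT); clear - lt s1'; lia.
- rewrite leqNgt; apply/negP=> lt; have := gd c (diag_end c).
  rewrite (has_box_convex e2 e2'); [|clear - lt; lia|clear - lt n0 e1 e1'; lia].
  by move=> /(_ _ isT); clear - lt e1; lia.
rewrite leqNgt; apply/negP=> lt; have := gd c.+1 (diag_end c.+1).
rewrite (has_box_convex e2' e2); [|clear - lt; lia|clear - lt n1 e1 e1'; lia].
by move=> /(_ _ isT); clear - lt e1'; lia.
Qed.

(** Two consecutive boxes of a diagonal span a 2 by 2 square whose other two boxes lie on the
    adjacent diagonals. *)
Lemma diag_neighbours c : (diag_start c).+1 < diag_end c ->
  [/\ 0 < c, diag_start c.+1 < diag_end c.+1 & diag_start c.-1 < diag_end c.-1].
Proof.
move=> lt; have h1 : on_diag c (diag_start c) by rewrite on_diagE leqnn ltnW.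
have h2 : on_diag c (diag_start c).+1 by rewrite on_diagE leqnSn.
case/andP: h1 => h1 b1; case/andP: h2 => h2 b2.
have lk := has_box_ltk b2.
have c0 : 0 < c by clear - h1 lk; lia.
split=> //.
  have : on_diag c.+1 (diag_start c).
    rewrite /on_diag (has_box_convex b1 b2); clear - h1; lia.
  by rewrite on_diagE => /andP[]; apply: leq_ltn_trans.
have : on_diag c.-1 (diag_start c).+1.
  rewrite /on_diag (has_box_convex b1 b2); clear - h1 c0; lia.
by rewrite on_diagE => /andP[]; apply: leq_ltn_trans.
Qed.

Definition diag_of p := p.2 + k - p.1.
Definition level p := (p.1 - diag_start (diag_of p)).+1.

Lemma on_diag_box p : p \in D -> on_diag (diag_of p) p.1.
Proof.
move=> pD; rewrite /on_diag /diag_of; have lt := ltn_ord p.1.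
rewrite (_ : (_ - k = p.2)%N); last by clear - lt; lia.
by rewrite has_box_in pD andbT; clear - lt; lia.
Qed.

Lemma level_bounds p : p \in D ->
  [/\ diag_start (diag_of p) <= p.1, p.1 < diag_end (diag_of p),
      p.1 = diag_start (diag_of p) + (level p).-1 :> nat
    & p.2 = p.1 + diag_of p - k :> nat].
Proof.
move/on_diag_box; rewrite on_diagE => /andP[h1 h2]; split=> //.
  by rewrite /level /= subnKC.
by rewrite /diag_of; have := ltn_ord p.1; clear; lia.
Qed.

Lemma level_inj p q : p \in D -> q \in D -> diag_of p = diag_of q -> level p = level q ->
  p = q.
Proof.
move=> /level_bounds[_ _ p1 p2] /level_bounds[_ _ q1 q2] e1 e2.
have e : p.1 = q.1 :> nat by rewrite p1 q1 e1 e2.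
by apply: box_eq => //; rewrite p2 q2 e e1.
Qed.

Lemma level_ex c l : 0 < l -> diag_start c + l <= diag_end c ->
  exists2 p, p \in D & diag_of p = c /\ level p = l.
Proof.
move=> l0 le; have : on_diag c (diag_start c + l.-1) by rewrite on_diagE; clear - l0 le; lia.
case/andP=> h /has_boxP[p pD [p1 p2]]; exists p => //.
have pc : diag_of p = c by rewrite /diag_of p1 p2; clear - h; lia.
by split=> //; rewrite /level pc p1; clear - l0; lia.
Qed.

Lemma diag_of_box (a b : nat) p : p.1 = a :> nat -> p.2 = b :> nat ->
  diag_of p = b + k - a.
Proof. by rewrite /diag_of => -> ->. Qed.

(** If some dot is strictly northwest of [p], convexity makes the diagonal neighbour a dot, and this
    neighbour dominates all the others. *)
Lemma covering_dotP p q : p \in D ->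
  (covering_dot D p == Some q) = [&& q \in D, q.1.+1 == p.1 :> nat & q.2.+1 == p.2 :> nat].
Proof.
move=> pD; rewrite /covering_dot; case: pickP => [u|none] /=.
  case/and3P=> uD /andP[u1 u2] /forall_inP umax.
  have {}u1 : u.1 < p.1 := u1; have {}u2 : u.2 < p.2 := u2.
  have [v vD [v1 v2]] : exists2 v, v \in D & v.1 = p.1.-1 :> nat /\ v.2 = p.2.-1 :> nat.
    apply/has_boxP; apply: (@has_box_convex u.1 u.2 p.1 p.2); rewrite ?has_box_in //.
      by clear - u1; lia.
    by clear - u2; lia.
  have uv : v = u.
    have h1 : v.1 < p.1 by rewrite v1; clear - u1; lia.
    have h2 : v.2 < p.2 by rewrite v2; clear - u2; lia.
    have h3 : u.1 <= v.1 by rewrite v1; clear - u1; lia.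
    have h4 : u.2 <= v.2 by rewrite v2; clear - u2; lia.
    by apply/eqP; apply: implyP (umax v vD) _; rewrite /strictly_nw /box_le h1 h2 h3 h4.
  apply/eqP/and3P => [[<-]|[qD /eqP q1 /eqP q2]].
    by rewrite uD -uv v1 v2; split=> //; apply/eqP; clear - u1 u2; lia.
  congr Some; rewrite -uv; apply: box_eq; rewrite ?v1 ?v2 -?q1 -?q2 //.
apply/esym/negbTE/negP=> /and3P[qD /eqP q1 /eqP q2].
have := none q; rewrite qD /strictly_nw -q1 -q2 !leqnn /=.
case/forall_inP=> r rD; apply/implyP=> /andP[/andP[r1 r2] /andP[r3 r4]].
by apply/eqP; apply: box_eq; [clear - r1 r3|clear - r2 r4]; lia.
Qed.

Lemma maximal_chainP p q : p \in D ->
  (q \in maximal_chain D p) = [&& q \in D, diag_of q == diag_of p & q.1 <= p.1].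
Proof.
move=> pD; rewrite inE; apply/idP/idP.
  case/connectP=> s + ->; elim: s p pD => [|u s IH] p pD /=; first by rewrite pD eqxx leqnn.
  case/andP; rewrite covering_dotP // => /and3P[uD /eqP u1 /eqP u2] /IH-/(_ uD).
  case/and3P=> -> /eqP -> le; rewrite /= (leq_trans le) -?u1 // andbT.
  by rewrite /diag_of -u1 -u2; have := ltn_ord u.1; clear; lia.
case/and3P=> qD /eqP e le; have [n] := ubnP (p.1 - q.1).
elim: n p pD e le => // n IH p pD e le; rewrite ltnS => ln.
have lp := ltn_ord p.1; have lq := ltn_ord q.1.
have e' : p.2 + q.1 = q.2 + p.1 by move: e lp lq; rewrite /diag_of; clear; lia.
case: (ltngtP q.1 p.1) le => // [lt _|/val_inj eq1 _]; last first.
  by have -> : q = p; [apply: box_eq; rewrite eq1 // in e' *; clear - e'; lia | apply: connect0].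
have [u uD [u1 u2]] : exists2 u, u \in D & u.1 = p.1.-1 :> nat /\ u.2 = p.2.-1 :> nat.
  apply/has_boxP; apply: (@has_box_convex q.1 q.2 p.1 p.2); rewrite ?has_box_in //.
    by clear - lt; lia.
  by clear - lt e'; lia.
apply: (@connect_trans _ _ u).
  apply: connect1; rewrite /= covering_dotP // uD u1 u2 /=; clear - lt e'; lia.
apply: IH => //.
- by rewrite e /diag_of u1 u2; clear - lt e' lp; lia.
- by rewrite u1; clear - lt; lia.
by rewrite u1; clear - lt ln; lia.
Qed.

Lemma canonical_labelE p : p \in D -> canonical_label lam D p =
  interval_index lam (diag_start (diag_of p)) (diag_start (diag_of p) + diag_of p - k) (level p).
Proof.
move=> pD; have [s1 e1 p1 p2] := level_bounds pD; have lp := ltn_ord p.1.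
have ks : k <= diag_start (diag_of p) + diag_of p.
  have : on_diag (diag_of p) (diag_start (diag_of p)).
    by rewrite on_diagE leqnn; apply: leq_ltn_trans e1.
  by case/andP.
have chain x : diag_start (diag_of p) <= x <= p.1 ->
    exists2 q, q \in maximal_chain D p & q.1 = x :> nat /\ q.2 = x + diag_of p - k :> nat.
  move=> h; have : on_diag (diag_of p) x by rewrite on_diagE; clear - h e1; lia.
  case/andP=> h1 /has_boxP[q qD [q1 q2]]; exists q => //.
  rewrite maximal_chainP // qD q1 (diag_of_box q1 q2) /=.
  by clear - h h1; lia.
have mem q : q \in maximal_chain D p -> diag_start (diag_of p) <= q.1 <= p.1
    /\ q.2 = q.1 + diag_of p - k :> nat.
  rewrite maximal_chainP // => /and3P[qD /eqP e le].
  by have [h1 _ _ h2] := level_bounds qD; rewrite -e h1 le.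
congr plucker_index; apply/setP=> x; rewrite inE; apply/imsetP/idP => [[q /mem[h1 h2] ->]|h].
- by move: h1 p1; clear; rewrite /level /=; lia.
- have [|q qM [q1 _]] := chain x; first by move: h p1; clear; rewrite /level /=; lia.
  by exists q => //; apply: val_inj.
- by rewrite h2; move: h1 p1 ks; clear; rewrite /level /=; lia.
have [|q qM [q1 q2]] := chain (x + k - diag_of p).
  by move: h p1 ks; clear; rewrite /level /=; lia.
exists q => //; apply: val_inj; rewrite /= q2; move: h ks; clear; lia.
Qed.
End Diagonals.

(** * Stepped surfaces and Plücker mutations *)

Section States.
Variables (k m : nat) (lam mu : {set box k m}).
Hypotheses (yl : young_diagram lam) (ym : young_diagram mu) (ml : mu \subset lam).
Notation D := (lam :\: mu).
Implicit Types (p q : box k m) (a b c l : nat) (r : nat -> nat -> nat).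
Local Notation ii := (interval_index lam).
Local Notation sg := (diag_start lam mu).
Local Notation en := (diag_end lam mu).
Local Notation dg := (diag_of (k := k) (m := m)).
Local Notation lev := (level lam mu).

Definition lattice c l := (0 < l) && (sg c + l <= en c).

(* [2 * r c l + c + l] is the height of the surface at [(c, l)]; the last two fields
   say that it changes by one between neighbours. *)
Record state r : Prop := State {
  state_bounds : forall c l, lattice c l -> sg c <= r c l /\ r c l + l <= en c;
  state_level : forall c l, 0 < l -> lattice c l.+1 -> r c l.+1 <= r c l <= (r c l.+1).+1;
  state_diag : forall c l, lattice c l -> lattice c.+1 l ->
    r c.+1 l <= r c l <= (r c.+1 l).+1
}.

(** In terms of heights, the four neighbours are exactly one unit above [(c, l)]; a flip raises it
    by two. The neighbour below exists only for [1 < l], an empty interval having no position. *)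
Record local_min r c l : Prop := LocalMin {
  lmin_lattice : lattice c l;
  lmin_end : r c l + l < en c;
  lmin_diag : 0 < c;
  lmin_latticeS : lattice c l.+1;
  lmin_latticeR : lattice c.+1 l;
  lmin_latticeL : lattice c.-1 l;
  lmin_up : r c l.+1 = r c l;
  lmin_down : 1 < l -> r c l.-1 = (r c l).+1;
  lmin_right : r c.+1 l = r c l;
  lmin_left : r c.-1 l = (r c l).+1
}.

Definition flip r c l : nat -> nat -> nat :=
  fun c' l' => if (c' == c) && (l' == l) then (r c l).+1 else r c' l'.

Definition final r := forall c l, lattice c l -> r c l + l = en c.

Lemma lattice_box p : p \in D -> lattice (dg p) (lev p).
Proof.
move=> pD; have [h1 h2 h3 _] := level_bounds yl ym pD.
by rewrite /lattice; move: h1 h2 h3; rewrite /level /=; clear; lia.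
Qed.

Lemma lattice_ex c l : lattice c l -> exists2 p, p \in D & dg p = c /\ lev p = l.
Proof. by case/andP=> l0 h; apply: level_ex. Qed.

Lemma lattice_neighbours c l : lattice c l.+1 -> 0 < l ->
  [/\ 0 < c, lattice c.+1 l & lattice c.-1 l].
Proof.
case/andP=> _ h l0; have h2 : (sg c).+1 < en c by clear - h l0; lia.
have [c0 n1 n2] := diag_neighbours yl ym h2.
have [/andP[s1 s2] /andP[e1 e2]] := diag_steps yl ym (ltnW h2) n1.
have h3 : sg c.-1.+1 < en c.-1.+1 by rewrite prednK // ltnW.
have [] := diag_steps yl ym n2 h3; rewrite prednK // => /andP[s3 s4] /andP[e3 e4].
by rewrite /lattice l0; split=> //; [move: s1 e2 h | move: s4 e3 h]; clear; lia.
Qed.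

Lemma state_init : state (fun c _ => sg c).
Proof.
split=> [c l /andP[_ h]|c l _ _|c l /andP[l0 h1] /andP[_ h2]] //.
  by rewrite leqnn leqnSn.
by have [] := @diag_steps k m lam mu yl ym c; [clear - l0 h1; lia|clear - l0 h2; lia|].
Qed.

Lemma state_flip r c l : state r -> local_min r c l -> state (flip r c l).
Proof.
case=> s1 s2 s3 [lat nf c0 _ _ _ up down right left]; have /andP[l0 _] := lat.
have [b1 b2] := s1 _ _ lat.
split=> [c' l' h|c' l' l0' h|c' l' h h']; rewrite /flip.
- have := s1 _ _ h; case: (c' =P c) => [->|_]; case: (l' =P l) => [->|_] //=.
  by move: b1 nf; clear; lia.
- have := s2 _ _ l0' h; case: (c' =P c) => [->|//] /=.
  case: (l'.+1 =P l) => [e|_]; case: (l' =P l) => [e'|_] //=.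
  + by clear - e e'; lia.
  + move=> _; move: down; rewrite -e /= => -> //; clear; lia.
  + move=> _; rewrite e' up; clear; lia.
have := s3 _ _ h h'; case: (l' =P l) => [->|//] /=; rewrite ?andbT ?andbF //.
case: (c'.+1 =P c) => [e|_]; case: (c' =P c) => [e'|_] //=.
- by clear - e e'; lia.
- by move=> _; move: left; rewrite -e /= => ->; clear; lia.
by move=> _; rewrite e' right; clear; lia.
Qed.

Lemma local_min_exists r c l : state r -> lattice c l -> r c l + l < en c ->
  exists c l, local_min r c l.
Proof.
move=> st lat nf; have [p pD [pc pl]] := lattice_ex lat.
pose nonfinal p := (p \in D) && (r (dg p) (lev p) + lev p < en (dg p)).
have Pp : nonfinal p by rewrite /nonfinal pD pc pl.
case: (arg_minnP (fun p => r (dg p) (lev p) + r (dg p) (lev p) + dg p + lev p) Pp).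
move=> q /andP[qD qnf] qmin; clear p pD pc pl Pp c l lat nf.
have lat := lattice_box qD; move: qnf qmin lat.
set c := dg q; set l := lev q => nf qmin lat.
have [s1 s2 s3] := st; have [b1 b2] := s1 _ _ lat; have /andP[l0 _] := lat.
(* Any lower neighbour would be final by minimality; since the ends of adjacent diagonals differ by
   at most one, [(c, l)] would then be final as well. *)
have fin c' l' : lattice c' l' -> r c' l' + r c' l' + c' + l' < r c l + r c l + c + l ->
    r c' l' + l' = en c'.
  move=> lat'; have [p pD [pc pl]] := lattice_ex lat'.
  have := qmin p; rewrite /nonfinal pD pc pl /= => h lt; have [_ h'] := s1 _ _ lat'.
  by move: h h' lt; clear; lia.
have latS : lattice c l.+1 by rewrite /lattice; move: b1 nf; clear; lia.
have [c0 latR latL] := lattice_neighbours latS l0.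
have := s3 _ _ lat latR => hR.
have := s3 _ _ latL; rewrite prednK // => /(_ lat) hL.
have hU := s2 _ _ l0 latS.
have n0 : (sg c).+1 < en c by move: latS l0; rewrite /lattice; clear; lia.
have [_ n1 n2] := diag_neighbours yl ym n0.
have [_ eR] := diag_steps yl ym (ltnW n0) n1.
have h3 : sg c.-1.+1 < en c.-1.+1 by rewrite prednK // ltnW.
have [_] := diag_steps yl ym n2 h3; rewrite prednK // => eL.
exists c, l; split=> //.
- have := fin _ _ latS; move: hU nf; clear; lia.
- move=> l1; have latD : lattice c l.-1 by move: lat l1; rewrite /lattice; clear; lia.
  have hD := s2 c l.-1; rewrite prednK // in hD.
  have {hD} := hD ltac:(clear - l1; lia) lat; have := fin _ _ latD; move: nf l1; clear; lia.
- have := fin _ _ latR; move: hR nf eR; clear; lia.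
have := fin _ _ latL; move: hL nf eL c0; clear; lia.
Qed.

Definition distance r := \sum_(p in D) (en (dg p) - lev p - r (dg p) (lev p)).

Lemma distance_flip r c l : state r -> local_min r c l -> distance (flip r c l) < distance r.
Proof.
move=> st lm; have [p pD [pc pl]] := lattice_ex (lmin_lattice lm).
have nf := lmin_end lm.
rewrite /distance (bigD1 p) //= [X in _ < X](bigD1 p) //= -addSn leq_add //.
  by rewrite /flip pc pl !eqxx /=; clear - nf; lia.
apply: leq_sum => q /andP[qD qp]; rewrite /flip; case: ifP => // /andP[/eqP e1 /eqP e2].
by case/eqP: qp; apply: (level_inj yl ym) => //; rewrite ?pc ?pl.
Qed.

(** Stated for an arbitrary property so that the sets of labels and the seeds are followed along one
    and the same sequence of flips. *)
Lemma flips_to_final (P : (nat -> nat -> nat) -> Prop) :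
    P (fun c _ => sg c) ->
    (forall r c l, state r -> local_min r c l -> P r -> P (flip r c l)) ->
  exists r, [/\ state r, final r & P r].
Proof.
move=> P0 PS.
suff H n r : distance r < n -> state r -> P r -> exists r, [/\ state r, final r & P r].
  exact: H (ltnSn _) state_init P0.
elim: n r => // n IH r; rewrite ltnS => le st Pr.
pose nonfinal p := (p \in D) && (r (dg p) (lev p) + lev p < en (dg p)).
have [/existsP[p /andP[pD pn]]|none] := boolP [exists p, nonfinal p].
  have [c [l lm]] := local_min_exists st (lattice_box pD) pn.
  apply: (IH (flip r c l)); [|exact: state_flip|exact: PS].
  exact: leq_trans (distance_flip st lm) le.
exists r; split=> // c l lat; have [p pD [pc pl]] := lattice_ex lat.
have := existsPn none p; rewrite /nonfinal pD pc pl /= -leqNgt => h.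
have [_ h'] := state_bounds st lat.
by apply/eqP; rewrite eqn_leq h' h.
Qed.

Definition state_label r c l := ii (r c l) (r c l + c - k) l.
Definition label_set r := vlabs lam |: [set state_label r (dg p) (lev p) | p in D].

Lemma state_label_box r c l : state r -> lattice c l ->
  [/\ k <= r c l + c, has_box D (r c l) (r c l + c - k)
    & has_box lam (r c l + l.-1) (r c l + c - k + l.-1)].
Proof.
move=> st lat; have [b1 b2] := state_bounds st lat; have /andP[l0 _] := lat.
have : on_diag lam mu c (r c l) by rewrite on_diagE //; move: b1 b2 l0; clear; lia.
case/andP=> h1 h2; split=> //.
have : on_diag lam mu c (r c l + l.-1) by rewrite on_diagE //; move: b1 b2 l0; clear; lia.
case/andP=> _; rewrite has_boxD => /andP[h _]; move: h.
by congr has_box; move: h1; clear; lia.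
Qed.

Lemma state_label_inj r r' c l c' l' : state r -> state r' -> lattice c l -> lattice c' l' ->
  state_label r c l = state_label r' c' l' -> [/\ c = c', l = l' & r c l = r' c' l'].
Proof.
move=> st st' lat lat'; have [h1 h2 h3] := state_label_box st lat.
have [h1' h2' h3'] := state_label_box st' lat'.
have /andP[l0 _] := lat; have /andP[l0' _] := lat'.
case/(interval_index_inj yl l0 l0' h3 h3') => e1 e2 e3; split=> //.
by move: e1 e2 h1 h1'; clear; lia.
Qed.

Lemma state_label_neq_vlabs r c l : state r -> lattice c l ->
  state_label r c l != vlabs lam.
Proof.
move=> st lat; have [_ _ h] := state_label_box st lat; have /andP[l0 _] := lat.
exact: interval_index_neq_vlabs.
Qed.

Lemma label_set_init : label_set (fun c _ => sg c) = canonical_tp_basis lam D.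
Proof.
by congr (_ |: _); apply: eq_in_imset => p pD; rewrite canonical_labelE.
Qed.

Lemma final_label r c l : state r -> final r -> lattice c l ->
  state_label r c l = diag_index lam (r c l) (r c l + c - k).
Proof.
move=> st fin lat; have [h1 h2 h3] := state_label_box st lat; have /andP[l0 _] := lat.
apply/esym/diag_index_interval => //.
apply/negP=> h; have : on_diag lam mu c (en c).
  rewrite /on_diag -(fin _ _ lat) (_ : _ - k = r c l + c - k + l).
    by rewrite (has_box_skew_le ym h2 _ _ h) ?leq_addr // andbT; move: h1; clear; lia.
  by move: h1; clear; lia.
by rewrite on_diagE // ltnn andbF.
Qed.

Lemma final_label_in r p : state r -> final r -> p \in D ->
  state_label r (dg p) (lev p) \in diag_set lam D.
Proof.
move=> st fin pD; have lat := lattice_box pD; rewrite final_label //.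
have [_ /has_boxP[q qD [<- <-]] _] := state_label_box st lat.
exact: diag_index_in.
Qed.

(** In the final state the order along each diagonal is reversed: the interval from [q] to the end
    has length [en (dg q) - q.1], so it is attached to the dot of that level. *)
Lemma final_label_ex r q : state r -> final r -> q \in D ->
  exists2 p, p \in D & state_label r (dg p) (lev p) = diag_index lam q.1 q.2.
Proof.
move=> st fin qD; have [b1 b2 b3 b4] := level_bounds yl ym qD.
have lat : lattice (dg q) (en (dg q) - q.1).
  by rewrite /lattice; move: b1 b2; clear; lia.
have [p pD [pc pl]] := lattice_ex lat; exists p => //.
rewrite final_label ?lattice_box // pc pl b4; have := fin _ _ lat => e.
have -> : r (dg q) (en (dg q) - q.1) = q.1 by move: e b2; clear; lia.
by [].
Qed.

Lemma label_set_final r : state r -> final r -> label_set r = diag_set lam D.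
Proof.
move=> st fin; congr (_ |: _); apply/setP=> H; apply/imsetP/imsetP => -[p pD ->].
  have := final_label_in st fin pD; case/setU1P=> [e|/imsetP[q qD ->]]; last by exists q.
  by case/eqP: (state_label_neq_vlabs st (lattice_box pD)).
by have [q qD <-] := final_label_ex st fin pD; exists q.
Qed.

Section Flip.
Variables (r : nat -> nat -> nat) (c l : nat).
Hypotheses (st : state r) (lm : local_min r c l).
Local Notation r' := (flip r c l).

(* The empty interval of length [l - 1 = 0] is represented by [vlabs lam]. *)
Definition lower_label := if l == 1 then vlabs lam else state_label r c l.-1.

Let r0 := r c l.
Let q0 := r c l + c - k.
Let kr : k <= r0 + c.
Proof. by case: (state_label_box st (lmin_lattice lm)). Qed.

Let l0 : 0 < l.
Proof. by case/andP: (lmin_lattice lm). Qed.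

Lemma flip_far : has_box lam (r0 + l) (q0 + l).
Proof.
have [b1 b2] := state_bounds st (lmin_lattice lm).
have : on_diag lam mu c (r0 + l).
  by rewrite on_diagE //; move: (lmin_end lm) b1; rewrite /r0; clear; lia.
case/andP=> _; rewrite has_boxD => /andP[h _]; move: h.
by congr has_box; move: kr; rewrite /q0 -/r0; clear; lia.
Qed.

Lemma flip_label_old : ii r0 q0 l = state_label r c l.
Proof. by []. Qed.

Lemma flip_label_new : ii r0.+1 q0.+1 l = state_label r' c l.
Proof.
rewrite /state_label /flip !eqxx /=; congr (ii _ _ _).
by move: kr; rewrite /q0 -/r0; clear; lia.
Qed.

Lemma flip_label_down : ii r0.+1 q0.+1 l.-1 = lower_label.
Proof.
rewrite /lower_label; case: eqP => [->|l1].
  by rewrite /interval_index !interval0 index0.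
rewrite /state_label (lmin_down lm); last by move: l0 l1; clear; lia.
by congr (ii _ _ _); move: kr; rewrite /q0 -/r0; clear; lia.
Qed.

Lemma flip_label_up : ii r0 q0 l.+1 = state_label r c l.+1.
Proof. by rewrite /state_label (lmin_up lm). Qed.

Lemma flip_label_left : ii r0.+1 q0 l = state_label r c.-1 l.
Proof.
rewrite /state_label (lmin_left lm); congr (ii _ _ _).
by move: kr (lmin_diag lm); rewrite /q0 -/r0; clear; lia.
Qed.

Lemma flip_label_right : ii r0 q0.+1 l = state_label r c.+1 l.
Proof.
rewrite /state_label (lmin_right lm); congr (ii _ _ _).
by move: kr; rewrite /q0 -/r0; clear; lia.
Qed.

Lemma flip_relation (F : fieldType) (M : 'M[F]_(k, k + m)) :
  (plucker (state_label r' c l) M * plucker (state_label r c l) M =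
   plucker lower_label M * plucker (state_label r c l.+1) M
   + plucker (state_label r c.-1 l) M * plucker (state_label r c.+1 l) M)%R.
Proof.
rewrite -flip_label_new -flip_label_old -flip_label_down -flip_label_up -flip_label_left
  -flip_label_right; exact: interval_relation flip_far.
Qed.

Lemma flip_other c' l' : (c', l') <> (c, l) -> state_label r' c' l' = state_label r c' l'.
Proof.
by move=> ne; rewrite /state_label /flip; case: ifP => // /andP[/eqP e1 /eqP e2]; rewrite e1 e2 in ne.
Qed.

Lemma state_label_in c' l' : lattice c' l' -> state_label r c' l' \in label_set r.
Proof.
by case/lattice_ex=> p pD [<- <-]; apply/setU1P; right; apply/imsetP; exists p.
Qed.

Lemma lower_label_in : lower_label \in label_set r.
Proof.
rewrite /lower_label; case: eqP => l1; first exact: setU11.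
apply: state_label_in; move: (lmin_lattice lm) l1; rewrite /lattice; clear; lia.
Qed.

Lemma flip_new_notin : state_label r' c l \notin label_set r.
Proof.
have st' := state_flip st lm.
apply/negP=> /setU1P[e|/imsetP[p pD e]].
  by case/eqP: (state_label_neq_vlabs st' (lmin_lattice lm)).
have [e1 e2] := state_label_inj st' st (lmin_lattice lm) (lattice_box pD) e.
by rewrite -e1 -e2 /flip !eqxx /=; clear; lia.
Qed.

Lemma label_set_flip :
  label_set r' = state_label r' c l |: (label_set r :\ state_label r c l).
Proof.
have [p pD [pc pl]] := lattice_ex (lmin_lattice lm).
apply/setP=> H; apply/setU1P/setU1P => [[->|/imsetP[q qD ->]]|[->|]].
- right; rewrite in_setD1 eq_sym state_label_neq_vlabs ?setU11 //; exact: lmin_lattice lm.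
- have [->|qp] := eqVneq q p; first by left; rewrite pc pl.
  have ne : (dg q, lev q) <> (c, l).
    by case=> e1 e2; case/eqP: qp; apply: (level_inj yl ym) => //; rewrite ?pc ?pl.
  right; rewrite flip_other // in_setD1 state_label_in ?lattice_box // andbT.
  apply/eqP=> /(state_label_inj st st (lattice_box qD) (lmin_lattice lm))[e1 e2 _].
  by rewrite e1 e2 in ne.
- by right; apply/imsetP; exists p; rewrite ?pc ?pl.
rewrite in_setD1 => /andP[Hn /setU1P[->|/imsetP[q qD e]]]; first by left.
right; apply/imsetP; exists q => //; rewrite e flip_other // => -[e1 e2].
by rewrite e e1 e2 eqxx in Hn.
Qed.

Lemma mutation_flip (R : realFieldType) :
  plucker_mutation R lam D (label_set r) (label_set r').
Proof.
split; try exact: setU11.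
have [S [a [b [d [e [[cS abcd dis] [ac bd [ab cd] ad bc]]]]]]] :=
  interval_three_term yl l0 flip_far.
exists (state_label r' c l), (state_label r c l), lower_label, (state_label r c l.+1),
  (state_label r c.-1 l), (state_label r c.+1 l); split.
  exists S, a, b, d, e; split=> //; first by rewrite ac bd flip_label_new.
  left; rewrite ab cd ad bc flip_label_down flip_label_up flip_label_left flip_label_right.
  by [].
(* The first kind of mutation always applies; for [l = 1] the lower label is the variable of
   [vlabs lam], which belongs to every label set. *)
constructor 1; split; last exact: label_set_flip.
  rewrite !subUset !sub1set -!andbA; apply/and5P; split.
  - by apply: state_label_in; apply: lmin_lattice lm.
  - exact: lower_label_in.
  - by apply: state_label_in; apply: lmin_latticeS lm.
  - by apply: state_label_in; apply: lmin_latticeL lm.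
  by apply: state_label_in; apply: lmin_latticeR lm.
exact: flip_new_notin.
Qed.
End Flip.
End States.

(** * The canonical quiver *)

Section Faces.
Variables (k m : nat) (lam mu : {set box k m}).
Hypotheses (yl : young_diagram lam) (ym : young_diagram mu).
Notation D := (lam :\: mu).
Implicit Types (p q : box k m).

Lemma skew_row_nextE p q : row_next D p q =
  [&& p \in D, q \in D, p.1 == q.1 :> nat & q.2 == p.2.+1 :> nat].
Proof.
rewrite /row_next; case: (boolP (p \in D)) => pD //=; case: (boolP (q \in D)) => qD //=.
rewrite val_eqE; case: eqP => //= e.
apply/andP/eqP => [[lt /existsP none]|e2]; last first.
  split; first by rewrite e2.
  by apply/existsP=> -[y /andP[_]]; rewrite e2 ltnS; clear; lia.
apply/eqP; rewrite eqn_leq lt andbT leqNgt; apply/negP=> lt2; case: none.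
have [|u uD [u1 u2]] := has_boxP D p.1 p.2.+1 _.
  by apply: (@has_box_convex _ _ _ _ yl ym p.1 p.2 q.1 q.2); rewrite ?has_box_in // ?e ?leqnn // leqnSn.
exists u.2; rewrite (_ : (p.1, u.2) = u); last by apply: box_eq.
by rewrite uD u2 leqnn.
Qed.

Lemma skew_col_nextE p q : col_next D p q =
  [&& p \in D, q \in D, p.2 == q.2 :> nat & q.1 == p.1.+1 :> nat].
Proof.
rewrite /col_next; case: (boolP (p \in D)) => pD //=; case: (boolP (q \in D)) => qD //=.
rewrite val_eqE; case: eqP => //= e.
apply/andP/eqP => [[lt /existsP none]|e2]; last first.
  split; first by rewrite e2.
  by apply/existsP=> -[y /andP[_]]; rewrite e2 ltnS; clear; lia.
apply/eqP; rewrite eqn_leq lt andbT leqNgt; apply/negP=> lt2; case: none.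
have [|u uD [u1 u2]] := has_boxP D p.1.+1 p.2 _.
  by apply: (@has_box_convex _ _ _ _ yl ym p.1 p.2 q.1 q.2); rewrite ?has_box_in // ?e ?leqnn // leqnSn.
exists u.1; rewrite (_ : (u.1, p.2) = u); last by apply: box_eq.
by rewrite uD u1 leqnn.
Qed.

Lemma has_leftE p : p \in D -> has_left D p = (0 < p.2) && has_box D p.1 p.2.-1.
Proof.
move=> pD; apply/existsP/andP => [[q]|[p2 /has_boxP[q qD [q1 q2]]]].
  rewrite skew_row_nextE => /and4P[qD _ /eqP e1 /eqP e2].
  by rewrite e2 -e1 has_box_in.
by exists q; rewrite skew_row_nextE qD pD q1 q2 prednK // !eqxx.
Qed.

Lemma has_upE p : p \in D -> has_up D p = (0 < p.1) && has_box D p.1.-1 p.2.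
Proof.
move=> pD; apply/existsP/andP => [[q]|[p1 /has_boxP[q qD [q1 q2]]]].
  rewrite skew_col_nextE => /and4P[qD _ /eqP e1 /eqP e2].
  by rewrite e2 -e1 has_box_in.
by exists q; rewrite skew_col_nextE qD pD q1 q2 prednK // !eqxx.
Qed.

Lemma has_downE p : p \in D -> [exists q, col_next D p q] = has_box D p.1.+1 p.2.
Proof.
move=> pD; apply/existsP/has_boxP => [[q]|[q qD [q1 q2]]].
  by rewrite skew_col_nextE => /and4P[_ qD /eqP e1 /eqP e2]; exists q.
by exists q; rewrite skew_col_nextE qD pD q1 q2 !eqxx.
Qed.

Lemma corner_inord (c : corner k m) (a b : nat) : a <= k -> b <= m ->
  (c == (inord a, inord b)) = (c.1 == a :> nat) && (c.2 == b :> nat).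
Proof.
move=> ak bm; rewrite -pair_eqE /= /pair_eq /= -!val_eqE /= !inordK //.
Qed.

(** The sides going up and left cross the two lines that leave the dot. A side going right or down
    stays in the region only if the adjacent box is in [lam]; this box is then a dot, and its own
    line is crossed. *)
Lemma se_corner_isolated p (c : corner k m) : p \in D ->
  ~~ (unseparated lam D (se_corner p) c || unseparated lam D c (se_corner p)).
Proof.
move=> pD; have e1 : (se_corner p).1 = p.1.+1 :> nat by rewrite inordK // ltnS ltn_ord.
have e2 : (se_corner p).2 = p.2.+1 :> nat by rewrite inordK // ltnS ltn_ord.
have dot a b : has_box lam a b -> p.1 <= a -> p.2 <= b -> exists2 q, q \in D & q.1 = a :> nat /\ q.2 = b :> nat.
  move=> h h1 h2; apply/has_boxP; apply: (has_box_skew_le ym (a := p.1) (b := p.2)) => //.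
  by rewrite has_box_in.
apply/negP=> /orP[] /and3P[r1 r2 /orP[]].
- case/and3P=> /eqP h1 /eqP h2; case/negP.
  move: r2; rewrite /in_region h1 h2 e1 e2 /= => h.
  have [||q qD [q1 q2]] := dot _ _ h; rewrite ?leqnSn //.
  by apply/existsP; exists q; rewrite qD q1 q2 eqxx ltnSn.
- case/and3P=> /eqP h1 /eqP h2; case/negP.
  move: r2; rewrite /in_region h1 h2 e1 e2 /= => h.
  have [||q qD [q1 q2]] := dot _ _ h; rewrite ?leqnSn //.
  by apply/existsP; exists q; rewrite qD q1 q2 eqxx ltnSn.
- case/and3P=> /eqP h1 /eqP h2; case/negP.
  apply/existsP; exists p; rewrite pD -h1 e1 ltnSn andbT /=.
  by move: h2; rewrite e2 => -[->].
case/and3P=> /eqP h1 /eqP h2; case/negP.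
apply/existsP; exists p; rewrite pD -h1 e2 ltnSn andbT /=.
by move: h2; rewrite e1 => -[->].
Qed.

Lemma same_face_se_corner p c : p \in D ->
  same_face lam D (se_corner p) c = (c == se_corner p).
Proof.
move=> pD; apply/idP/eqP => [/connectP[s pth ->]|->]; last exact: connect0.
by case: s pth => //= c' s /andP[]; rewrite (negPf (se_corner_isolated _ pD)).
Qed.

Lemma se_corner_inj p q : se_corner p = se_corner q -> p = q.
Proof.
move/eqP; rewrite corner_inord ?ltn_ord // !inordK ?ltnS ?ltn_ord // !eqSS.
by case/andP=> /eqP h1 /eqP h2; apply: box_eq.
Qed.

Lemma face_ofE (c : corner k m) (P : {p | p \in D}) :
  (face_of lam D c == Some P) = (c == se_corner (val P)).
Proof.
rewrite /face_of; case: pickP => [Q|none].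
  rewrite same_face_se_corner ?(valP Q) // => /eqP ->; apply/eqP/eqP => [[->]//|].
  by move=> /se_corner_inj/val_inj ->.
apply/esym/negbTE; have := none P; rewrite same_face_se_corner ?(valP P) //.
by move=> ->.
Qed.

Lemma face_of_None (c : corner k m) : (face_of lam D c == None) =
  ~~ [exists P : {p | p \in D}, c == se_corner (val P)].
Proof.
case E: (face_of lam D c) => [P|]; rewrite ?eqxx.
  by apply/esym/negbTE; rewrite negbK; apply/existsP; exists P; rewrite -face_ofE E.
by apply/esym/existsP=> -[P]; rewrite -face_ofE E.
Qed.

Lemma face_of_inord (a b : nat) (P : {p | p \in D}) : a <= k -> b <= m ->
  (face_of lam D (inord a, inord b) == Some P)
  = (a == (val P).1.+1) && (b == (val P).2.+1).
Proof.
move=> ak bm; rewrite face_ofE eq_sym corner_inord // !inordK ?ltnS ?ltn_ord //.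
by rewrite eq_sym [_ == b]eq_sym.
Qed.

Lemma face_of_inord_None (a b : nat) : a <= k -> b <= m ->
  (face_of lam D (inord a, inord b) == None)
  = ~~ [&& 0 < a, 0 < b & has_box D a.-1 b.-1].
Proof.
move=> ak bm; rewrite face_of_None; congr (~~ _); apply/existsP/and3P.
  case=> P; rewrite -face_ofE face_of_inord // => /andP[/eqP-> /eqP->].
  by split=> //; rewrite has_box_in (valP P).
case=> a0 b0 /has_boxP[p pD [p1 p2]]; exists (Sub p pD).
by rewrite -face_ofE face_of_inord //= p1 p2 !prednK // !eqxx.
Qed.

Lemma not_frozen (P : {p | p \in D}) :
  has_box lam (val P).1.+1 (val P).2.+1 -> ~~ @face_frozen k m lam D (Some P).
Proof.
move=> h; rewrite /face_frozen /= ; apply/existsP=> -[c /and3P[_ nh]].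
rewrite face_ofE => /eqP e; case/negP: nh; rewrite e.
by rewrite /se_corner /= !inordK ?ltnS ?ltn_ord.
Qed.

Local Notation arr := (pmap (@dual_arrow _) (plabic_edges lam D)).

(** The edge is indexed by its west dot [p], and [v] is the face southeast of [p]. The west end is
    black if [p] has an edge up, or is a bend with a further dot below it. *)
Definition row_arrow (u v : face D) : bool :=
  if v is Some P then
    let p := val P in [&& has_box D p.1 p.2.+1,
      has_up D p || (is_bend D p && has_box D p.1.+1 p.2) &
      u == face_of lam D (inord p.1, inord p.2.+1)]
  else false.

Definition col_arrow (u v : face D) : bool :=
  if v is Some P then
    let p := val P in [&& has_box D p.1.+1 p.2, has_left D p &
      u == face_of lam D (inord p.1.+1, inord p.2)]
  else false.

Definition inner_arrow (u v : face D) : bool :=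
  if u is Some P then
    let p := val P in [&& has_left D p, has_up D p &
      v == face_of lam D (inord p.1, inord p.2)]
  else false.

Lemma count_pmap_enum (T : finType) (U : eqType) (E : Type) (S : {set T}) (f : T -> E)
    (g : E -> option U) (x : U) (b : bool) :
    (forall t t', t \in S -> t' \in S -> g (f t) = Some x -> g (f t') = Some x -> t = t') ->
    ((exists2 t, t \in S & g (f t) = Some x) <-> b) ->
  count_mem x (pmap g [seq f t | t <- enum S]) = b.
Proof.
move=> uniq_t ex_t.
have cE (s : seq T) : count_mem x (pmap g [seq f t | t <- s]) = count (fun t => g (f t) == Some x) s.
  by elim: s => //= t s <-; case: (g (f t)).
rewrite cE; case: b ex_t => -[h1 h2].
  have [t tS gt] := h2 isT; rewrite -size_filter.
  have /perm_size -> : perm_eq [seq t <- enum S | g (f t) == Some x] [:: t]; last by [].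
  apply: uniq_perm => //; first by rewrite filter_uniq ?enum_uniq.
  move=> t'; rewrite mem_filter mem_enum inE; apply/andP/eqP => [[/eqP gt' t'S]|->].
    exact: uniq_t.
  by rewrite gt eqxx.
apply/eqP; rewrite eqn0Ngt -has_count; apply/hasP=> -[t]; rewrite mem_enum => tS /eqP gt.
by have : false by apply: h1; exists t.
Qed.

Lemma face_of_se (P : {p | p \in D}) : face_of lam D (se_corner (val P)) = Some P.
Proof. by apply/eqP; rewrite face_ofE. Qed.

Lemma dual_horizontal (u v : face D) p q : row_next D p q ->
  (dual_arrow (horizontal_edge lam D p q) = Some (u, v)) <->
  [/\ has_up D p || (is_bend D p && has_box D p.1.+1 p.2),
      u = face_of lam D (inord p.1, inord p.2.+1) & v = face_of lam D (se_corner p)].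
Proof.
rewrite skew_row_nextE => /and4P[pD qD /eqP e1 /eqP e2].
rewrite /dual_arrow /horizontal_edge /= /west_end_color /right_color has_downE //.
rewrite /nw_corner /sw_corner -e1 e2 -/(se_corner p) /is_bend.
case: (has_up D p); case: (has_left D p) => //=; try by split=> [[-> ->]//|[_ -> ->]].
  by split=> // -[].
by case: has_box; [split=> [[-> ->]|[_ -> ->]] | split=> // -[]].
Qed.

Lemma dual_vertical (u v : face D) p q : col_next D p q ->
  (dual_arrow (vertical_edge lam D p q) = Some (u, v)) <->
  [/\ has_left D p, u = face_of lam D (inord p.1.+1, inord p.2)
    & v = face_of lam D (se_corner p)].
Proof.
rewrite skew_col_nextE => /and4P[pD qD /eqP e1 /eqP e2].
rewrite /dual_arrow /vertical_edge /= /down_color.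
rewrite /nw_corner /ne_corner -e1 e2 -/(se_corner p).
case: (has_left D p) => /=; first by split=> [[-> ->]//|[_ -> ->]].
by case: (has_up D p); split=> // -[].
Qed.

(** Each edge is determined by the face southeast of its west or north dot, or of the split dot
    itself, so each kind of edge gives at most one arrow between two faces in a given direction. *)
Lemma count_arrows (u v : face D) :
  count_mem (u, v) arr = row_arrow u v + (col_arrow u v + inner_arrow u v).
Proof.
have seP p (pD : p \in D) : face_of lam D (se_corner p) = Some (Sub p pD).
  exact: (face_of_se (Sub p pD)).
have se_inj p p' : p \in D -> p' \in D ->
    face_of lam D (se_corner p) = face_of lam D (se_corner p') -> p = p'.
  by move=> pD p'D; rewrite !seP => -[].
rewrite /plabic_edges !pmap_cat !count_cat; congr (_ + (_ + _)).
- apply: count_pmap_enum.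
    move=> [p q] [p' q'] /[!inE] /= pq p'q' /(dual_horizontal _ _ pq)[_ _ ->].
    case/(dual_horizontal _ _ p'q') => _ _; move: pq p'q'.
    rewrite !skew_row_nextE => /and4P[pD _ /eqP e1 /eqP e2] /and4P[p'D _ /eqP e1' /eqP e2'].
    move=> /se_inj-/(_ pD p'D) e; congr pair => //.
    by apply: box_eq; rewrite -?e1 -?e1' ?e2 ?e2' e.
  rewrite /row_arrow; split=> [[[p q] /[!inE] /= pq /(dual_horizontal _ _ pq)[h -> ->]]|].
    move: pq; rewrite skew_row_nextE => /and4P[pD qD /eqP e1 /eqP e2].
    by rewrite seP /= e1 -e2 has_box_in qD -e1 h eqxx.
  case: v => [P|//] /and3P[/has_boxP[q qD [q1 q2]] h /eqP ->].
  have pq : row_next D (val P) q by rewrite skew_row_nextE (valP P) qD q1 q2 !eqxx.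
  by exists (val P, q); [rewrite inE | apply/(dual_horizontal _ _ pq); rewrite face_of_se].
- apply: count_pmap_enum.
    move=> [p q] [p' q'] /[!inE] /= /andP[pq _] /andP[p'q' _] /(dual_vertical _ _ pq)[_ _ ->].
    case/(dual_vertical _ _ p'q') => _ _; move: pq p'q'.
    rewrite !skew_col_nextE => /and4P[pD _ /eqP e1 /eqP e2] /and4P[p'D _ /eqP e1' /eqP e2'].
    move=> /se_inj-/(_ pD p'D) e; congr pair => //.
    by apply: box_eq; rewrite -?e1 -?e1' ?e2 ?e2' e.
  rewrite /col_arrow; split=> [[[p q] /[!inE] /= /andP[pq _] /(dual_vertical _ _ pq)[h -> ->]]|].
    move: pq; rewrite skew_col_nextE => /and4P[pD qD /eqP e1 /eqP e2].
    by rewrite seP /= e1 -e2 has_box_in qD h -e1 eqxx.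
  case: v => [P|//] /and3P[/has_boxP[q qD [q1 q2]] h /eqP ->].
  have pq : col_next D (val P) q by rewrite skew_col_nextE (valP P) qD q1 q2 !eqxx.
  exists (val P, q); first by rewrite inE /= pq /is_bend h.
  by apply/(dual_vertical _ _ pq); rewrite face_of_se.
apply: count_pmap_enum.
  move=> p p' /[!inE] /= /andP[+ _] /andP[+ _]; rewrite -!in_setD => pD p'D [e1 _] [e2 _].
  by apply: se_inj => //; rewrite e1 e2.
rewrite /inner_arrow; split=> [[p /[!inE] /andP[+ /andP[h1 h2]] [<- <-]]|].
  by rewrite -in_setD => pD; rewrite seP /= h1 h2 eqxx.
case: u => [P|//] /and3P[h1 h2 /eqP ->]; exists (val P).
  by rewrite 2!inE -in_setD (valP P) h1 h2.
by rewrite /dual_arrow /= face_of_se.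
Qed.

Lemma canonical_quiverE (u v : face D) : @canonical_quiver k m lam D u v =
  ((row_arrow u v + (col_arrow u v + inner_arrow u v))%N%:Z
   - (row_arrow v u + (col_arrow v u + inner_arrow v u))%N%:Z)%R.
Proof. by congr (Posz _ - Posz _)%R; apply: count_arrows. Qed.

Lemma canonical_quiver_skew (u v : face D) :
  @canonical_quiver k m lam D v u = (- @canonical_quiver k m lam D u v)%R.
Proof. by rewrite /canonical_quiver opprB. Qed.

Section Row.
Variable P : {p | p \in D}.
Local Notation p := (val P).
Hypothesis far : has_box lam p.1.+1 p.2.+1.

Let pD : p \in D := valP P.
Let near (a b : nat) : p.1 <= a <= p.1.+1 -> p.2 <= b <= p.2.+1 -> has_box D a b.
Proof.
move=> /andP[h1 h2] /andP[h3 h4]; apply: (has_box_skew_le ym (a := p.1) (b := p.2)) => //.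
  by rewrite has_box_in.
exact: has_box_le yl far h2 h4.
Qed.

Let has_box_p : has_box D p.1 p.2.
Proof. by rewrite has_box_in. Qed.

(** As the box southeast of [p] is in [lam], the 2 by 2 square starting at [p] consists of dots, and
    for edges between [P] and [Q] all conditions on colours hold by themselves. *)
Lemma canonical_quiver_Some (Q : {p | p \in D}) :
  @canonical_quiver k m lam D (Some P) (Some Q) =
  (((((val Q).1 == p.1.+1 :> nat) && ((val Q).2 == p.2 :> nat))
    + ((((val Q).1 == p.1 :> nat) && ((val Q).2 == p.2.+1 :> nat))
    + ((p.1 == (val Q).1.+1 :> nat) && (p.2 == (val Q).2.+1 :> nat))))%N%:Z
   - (((p.1 == (val Q).1.+1 :> nat) && (p.2 == (val Q).2 :> nat))
    + (((p.1 == (val Q).1 :> nat) && (p.2 == (val Q).2.+1 :> nat))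
    + (((val Q).1 == p.1.+1 :> nat) && ((val Q).2 == p.2.+1 :> nat))))%N%:Z)%R.
Proof.
have qD : val Q \in D := valP Q.
have lp1 : p.1 <= k := ltnW (ltn_ord _); have lp2 : p.2 <= m := ltnW (ltn_ord _).
have lq1 : (val Q).1 <= k := ltnW (ltn_ord _); have lq2 : (val Q).2 <= m := ltnW (ltn_ord _).
have hq : has_box D (val Q).1 (val Q).2 by rewrite has_box_in.
rewrite canonical_quiverE /row_arrow /col_arrow /inner_arrow.
rewrite ![Some _ == face_of _ _ _]eq_sym !face_of_inord ?ltn_ord // !eqSS.
congr (_%:Z - _%:Z)%R; congr (_ + (_ + _)); congr nat_of_bool.
- rewrite [(val Q).2 == p.2 :> nat]eq_sym; case: eqP => [e1|]; last by rewrite !andbF.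
  case: eqP => [e2|]; last by rewrite !andbF.
  rewrite has_upE // e1 -e2 /= has_box_p near ?leqnn ?leqnSn //.
- rewrite [(val Q).1 == p.1 :> nat]eq_sym; case: eqP => [e1|]; last by rewrite !andbF.
  case: eqP => [e2|]; last by rewrite !andbF.
  by rewrite has_leftE // -e1 e2 /= has_box_p near ?leqnn ?leqnSn.
- case: eqP => [e1|]; last by rewrite !andbF.
  case: eqP => [e2|]; last by rewrite !andbF.
  rewrite has_leftE // has_upE // e1 e2 /=.
  by rewrite !(has_box_convex yl ym hq has_box_p) // ?e1 ?e2 ?leqnn ?leqnSn.
- case: eqP => [e1|]; last by rewrite !andbF.
  case: eqP => [e2|]; last by rewrite !andbF.
  rewrite near ?leqnn ?leqnSn // has_upE // {3}e1 /= (_ : p.1.-1 = (val Q).1) ?e1 //.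
  by rewrite e2 hq.
- case: eqP => [e1|]; last by rewrite !andbF.
  case: eqP => [e2|]; last by rewrite !andbF.
  rewrite near ?leqnn ?leqnSn // has_leftE // (_ : p.2.-1 = (val Q).2) ?e2 //.
  by rewrite e1 hq.
case: eqP => [e1|]; last by rewrite !andbF.
case: eqP => [e2|]; last by rewrite !andbF.
by rewrite has_leftE // has_upE // e1 e2 /= !near ?leqnn ?leqnSn.
Qed.

(** Nonzero only where the boundary of [mu] turns at [p]. *)
Lemma canonical_quiver_None :
  @canonical_quiver k m lam D (Some P) None =
  ([&& has_left D p, has_up D p & ~~ [&& (0 < p.1)%N, (0 < p.2)%N & has_box D p.1.-1 p.2.-1]]%:Z
   - (~~ has_left D p && ~~ has_up D p)%:Z)%R.
Proof.
have lp1 : p.1 <= k := ltnW (ltn_ord _); have lp2 : p.2 <= m := ltnW (ltn_ord _).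
rewrite canonical_quiverE /row_arrow /col_arrow /inner_arrow !add0n addn0.
rewrite ![None == _]eq_sym !face_of_inord_None ?ltn_ord // !succnK.
rewrite (near (a := p.1) (b := p.2.+1)) ?leqnn ?leqnSn //.
rewrite (near (a := p.1.+1) (b := p.2)) ?leqnn ?leqnSn //.
rewrite /is_bend (has_leftE pD) (has_upE pD).
case: (0 < p.1); case: (0 < p.2) => //=; do ?[case: (has_box D _ _) => //=].
Qed.
End Row.
End Faces.

(** * Quiver mutation along a flip *)

Section Exchange.
Implicit Types (r : nat -> nat -> nat) (c l : nat).

(* In terms of the heights [h c l = 2 * r c l + c + l], the number of arrows from
   [(c, l)] is [h c' l' - h c l] to a neighbour with [l' = l], is
   [h c l - h c' l'] to a neighbour with [c' = c], and is half of
   [h c l' - h c' l] to a diagonal neighbour. *)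
Definition exchange r c l c' l' : int :=
  (if (c' == c.+1) && (l' == l) then 2 * ((r c' l')%:Z - (r c l)%:Z) + 1
   else if (c == c'.+1) && (l' == l) then 2 * ((r c' l')%:Z - (r c l)%:Z) - 1
   else if (c' == c) && (l' == l.+1) then 2 * ((r c l)%:Z - (r c' l')%:Z) - 1
   else if (c' == c) && (l == l'.+1) then 2 * ((r c l)%:Z - (r c' l')%:Z) + 1
   else if (c' == c.+1) && (l' == l.+1) then (r c l')%:Z - (r c' l)%:Z
   else if (c' == c.+1) && (l == l'.+1) then (r c l')%:Z - (r c' l)%:Z - 1
   else if (c == c'.+1) && (l' == l.+1) then (r c l')%:Z - (r c' l)%:Z + 1
   else if (c == c'.+1) && (l == l'.+1) then (r c l')%:Z - (r c' l)%:Z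
   else 0)%R.

(* The frozen variables of all the empty intervals are the same vertex [None]; the
   heights of these intervals cancel in the sum over [(c, 0)] and [(c +- 1, 0)]. *)
Definition exchange_None r c l : int :=
  (if l == 1%N then 2 * (r c 1%N)%:Z - (r c.+1 1%N)%:Z - (r c.-1 1%N)%:Z else 0)%R.

Definition delta c l c' l' : int := ((c' == c) && (l' == l))%:Z.

Lemma flipE r c l c' l' : ((flip r c l c' l')%:Z = (r c' l')%:Z + delta c l c' l')%R.
Proof.
rewrite /flip /delta; case: ifP => [/andP[/eqP-> /eqP->]|_]; last by rewrite addr0.
by rewrite -addn1 PoszD.
Qed.

(** The linear part of [exchange], which is affine in [r], evaluated at the unit bump
    [delta c l]. *)
Definition exchange_delta c l c1 l1 c2 l2 : int :=
  (if (c2 == c1.+1) && (l2 == l1) then 2 * (delta c l c2 l2 - delta c l c1 l1)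
   else if (c1 == c2.+1) && (l2 == l1) then 2 * (delta c l c2 l2 - delta c l c1 l1)
   else if (c2 == c1) && (l2 == l1.+1) then 2 * (delta c l c1 l1 - delta c l c2 l2)
   else if (c2 == c1) && (l1 == l2.+1) then 2 * (delta c l c1 l1 - delta c l c2 l2)
   else if (c2 == c1.+1) && (l2 == l1.+1) then delta c l c1 l2 - delta c l c2 l1
   else if (c2 == c1.+1) && (l1 == l2.+1) then delta c l c1 l2 - delta c l c2 l1
   else if (c1 == c2.+1) && (l2 == l1.+1) then delta c l c1 l2 - delta c l c2 l1
   else if (c1 == c2.+1) && (l1 == l2.+1) then delta c l c1 l2 - delta c l c2 l1
   else 0)%R.

Lemma exchange_flip r c l c1 l1 c2 l2 :
  (exchange (flip r c l) c1 l1 c2 l2 = exchange r c1 l1 c2 l2 + exchange_delta c l c1 l1 c2 l2)%R.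
Proof.
rewrite /exchange /exchange_delta !flipE.
by do 8!(case: ifP => _; first by ring); rewrite addr0.
Qed.

Lemma exchangeC r c l c' l' : (exchange r c' l' c l = - exchange r c l c' l')%R.
Proof.
rewrite /exchange; repeat (case: ifP => ?); lia.
Qed.

(* The arrows at a vertex which is about to be flipped. *)
Definition star c l c' l' : int :=
  (((c' == c.+1) || (c == c'.+1)) && (l' == l))%:Z%R
  - ((c' == c) && ((l' == l.+1) || (l == l'.+1)))%:Z%R.

(** As the row of a vertex about to be flipped is [star], subtracting it twice reverses all its
    arrows. *)
Lemma exchange_delta_self c l c' l' :
  (exchange_delta c l c l c' l' = - (2 * star c l c' l'))%R.
Proof.
rewrite /exchange_delta /star /delta !eqxx /=.
have neS n : (n == n.+1) = false by rewrite eqn_leq ltnn andbF.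
have neS' n : (n.+1 == n) = false by rewrite eq_sym.
case: (c' =P c) => [->|_]; case: (l' =P l) => [->|_]; rewrite ?neS ?neS' /= ?andbF ?andbT //=.
- by case: eqP => [e|_] //=; case: eqP.
- by case: eqP => [e|_] /=; [|case: eqP].
by do ?[case: ifP => //].
Qed.

Lemma star_max c l c' l' :
  (Num.max 0 (star c l c' l') = (((c' == c.+1) || (c == c'.+1)) && (l' == l))%:Z
   /\ Num.max 0 (- star c l c' l') = ((c' == c) && ((l' == l.+1) || (l == l'.+1)))%:Z)%R.
Proof.
have maxE (b1 b2 : bool) : ~~ (b1 && b2) ->
    (Num.max 0 (b1%:Z - b2%:Z) = b1%:Z /\ Num.max 0 (- (b1%:Z - b2%:Z)) = b2%:Z)%R.
  by case: b1; case: b2.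
by apply: maxE; lia.
Qed.

(** The right-hand side is the correction in the mutation rule for quivers, with [star] as the row
    of the mutated vertex. *)
Lemma exchange_delta_star c l c1 l1 c2 l2 : (c1, l1) != (c, l) -> (c2, l2) != (c, l) ->
  (exchange_delta c l c1 l1 c2 l2 =
   Num.max 0 (- star c l c1 l1) * Num.max 0 (star c l c2 l2)
   - Num.max 0 (- star c l c2 l2) * Num.max 0 (star c l c1 l1))%R.
Proof.
have [-> ->] := star_max c l c1 l1; have [-> ->] := star_max c l c2 l2.
rewrite -!pair_eqE /pair_eq /= => /negPf n1 /negPf n2.
(* Both sides are nonzero only for diagonal neighbours, one of them next to [(c, l)] horizontally
   and the other vertically. *)
pose diag := ((c2 == c1.+1) || (c1 == c2.+1)) && ((l2 == l1.+1) || (l1 == l2.+1)).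
have -> : exchange_delta c l c1 l1 c2 l2 =
    (if diag then delta c l c1 l2 - delta c l c2 l1 else 0)%R.
  have d1 : delta c l c1 l1 = 0%R by rewrite /delta n1.
  have d2 : delta c l c2 l2 = 0%R by rewrite /delta n2.
  rewrite /exchange_delta d1 d2; move: (delta c l c1 l2) (delta c l c2 l1).
  move=> d12 d21; rewrite /diag; clear; repeat (case: ifP => ?); lia.
rewrite -!PoszM !mulnb.
have -> : ((c1 == c) && ((l1 == l.+1) || (l == l1.+1)))
    && (((c2 == c.+1) || (c == c2.+1)) && (l2 == l)) = diag && ((c1 == c) && (l2 == l)).
  rewrite /diag; case: (c1 =P c) => [->|_] /=; last by rewrite andbF.
  case: (l2 =P l) => [->|_] /=; last by rewrite !andbF.
  by rewrite !andbT andbC [(l1 == _) || _]orbC.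
have -> : ((c2 == c) && ((l2 == l.+1) || (l == l2.+1)))
    && (((c1 == c.+1) || (c == c1.+1)) && (l1 == l)) = diag && ((c2 == c) && (l1 == l)).
  rewrite /diag; case: (c2 =P c) => [->|_] /=; last by rewrite andbF.
  case: (l1 =P l) => [->|_] /=; last by rewrite !andbF.
  by rewrite !andbT andbC [(c1 == _) || _]orbC.
by rewrite /delta; case: diag.
Qed.
End Exchange.

Section Quiver.
Variables (k m : nat) (lam mu : {set box k m}).
Hypotheses (yl : young_diagram lam) (ym : young_diagram mu).
Notation D := (lam :\: mu).
Implicit Types (c l : nat) (r : nat -> nat -> nat) (P Q : {p | p \in D}) (b : face D -> face D -> int).
Local Notation sg := (diag_start lam mu).
Local Notation en := (diag_end lam mu).
Local Notation dg P := (diag_of (val P)).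
Local Notation lev P := (level lam mu (val P)).
Local Notation lat := (lattice lam mu).

(** With all neighbours one unit higher, the diagonal arrows disappear. Single arrows to the
    horizontal neighbours and from the vertical ones remain, matching the two products of the
    three-term relation. *)
Lemma exchange_local_min r c l c' l' : local_min lam mu r c l -> 0 < l' ->
  exchange r c l c' l' = star c l c' l'.
Proof.
case=> [_ _ c0 _ _ _ up down right left] l'0; rewrite /exchange /star.
have neS n : (n == n.+1) = false by rewrite eqn_leq ltnn andbF.
have neS' n : (n.+1 == n) = false by rewrite eq_sym.
have neSS n : (n == n.+2) = false by apply/eqP; lia.
case: (c' =P c.+1) => [->|_] /=.
  rewrite neSS !neS' /=; case: (l' =P l) => [->|_] /=; first by rewrite right; lia.
  case: (l' =P l.+1) => [->|_] /=; first by rewrite up right; lia.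
  case: (l =P l'.+1) => [e|_] //=; rewrite right.
  by move: down; rewrite e /= => -> //; lia.
case: (c =P c'.+1) => [e|_] /=.
  subst c; rewrite /= in left; rewrite neS.
  case: (l' =P l) => [->|_] /=; first by rewrite left; lia.
  case: (l' =P l.+1) => [->|_] /=; first by rewrite up left; lia.
  case: (l =P l'.+1) => [e2|_] //=; rewrite left.
  by move: down; rewrite e2 /= => -> //; lia.
case: (c' =P c) => [->|_] //=.
case: (l' =P l.+1) => [->|_] /=; first by rewrite up; lia.
case: (l =P l'.+1) => [e|_] //=.
by move: down; rewrite e /= => -> //; lia.
Qed.

Lemma exchange_None_local_min r c l : local_min lam mu r c l ->
  exchange_None r c l = (- (l == 1%N)%:Z)%R.
Proof.
case=> [_ _ _ _ _ _ _ _ right left]; rewrite /exchange_None; case: eqP => // e.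
by rewrite -e right left; lia.
Qed.

Definition exchange_row r P (v : face D) : int :=
  if v is Some Q then exchange r (dg P) (lev P) (dg Q) (lev Q)
  else exchange_None r (dg P) (lev P).

(** The premise on [(lev P).+1] says that [P] is not last on its diagonal. With antisymmetry, such
    rows suffice: mutating one row uses only that row and the row of the mutated vertex. *)
Definition exchange_quiver r b : Prop :=
  (forall u v, b v u = - b u v)%R /\
  (forall P, lat (dg P) (lev P).+1 -> forall v, b (Some P) v = exchange_row r P v).

Lemma vertex_pos_inj P Q : dg P = dg Q -> lev P = lev Q -> P = Q.
Proof. by move=> e1 e2; apply: val_inj; apply: (level_inj yl ym) => //; apply: valP. Qed.

Lemma exchange_quiver_flip r b P0 : local_min lam mu r (dg P0) (lev P0) ->
  exchange_quiver r b ->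
  exchange_quiver (flip r (dg P0) (lev P0)) (mutate_quiver b (Some P0)).
Proof.
set c := dg P0; set l := lev P0 => lm [anti row]; split.
  move=> u v; rewrite /mutate_quiver [(v == _) || _]orbC.
  case: ifP => _; first by rewrite (anti u v).
  by rewrite (anti u v); ring.
have star_row Q : b (Some P0) (Some Q) = star c l (dg Q) (lev Q).
  by rewrite row ?(lmin_latticeS lm) //= exchange_local_min.
have None_row : b (Some P0) None = (- (l == 1%N)%:Z)%R.
  by rewrite row ?(lmin_latticeS lm) //= exchange_None_local_min.
move=> P latP v; rewrite /mutate_quiver.
have [e|PP0] := eqVneq (Some P) (Some P0).
  case: e => ->; rewrite /=; case: v => [Q|].
    rewrite star_row /exchange_row -/c -/l exchange_flip exchange_delta_self.
    by rewrite exchange_local_min //; ring.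
  rewrite None_row /exchange_row -/c -/l /exchange_None !flipE /delta.
  have := exchange_None_local_min lm; rewrite /exchange_None.
  have := lmin_diag lm; clear; case: eqP => [->|_] //= c0; rewrite !eqxx /=.
  have -> : (c.+1 == c) = false by apply/eqP; lia.
  have -> : (c.-1 == c) = false by apply/eqP; lia.
  by rewrite /=; lia.
have pos_neq Q : Some Q != Some P0 -> (dg Q, lev Q) != (c, l).
  by apply: contraNneq => e; rewrite (vertex_pos_inj (congr1 fst e) (congr1 snd e)).
have starP := exchange_delta_star (pos_neq _ PP0).
rewrite /= /arrows (anti (Some P0) (Some P)) star_row.
case: v => [Q|].
  have [[->]|QP0] := eqVneq (Some Q) (Some P0).
    rewrite row //= exchangeC -/c -/l [in RHS]exchangeC exchange_flip exchange_delta_self.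
    by rewrite exchange_local_min //; ring.
  rewrite (row _ latP) (anti (Some P0) (Some Q)) star_row /exchange_row exchange_flip.
  by rewrite starP ?pos_neq // addrA.
rewrite /= (row _ latP) (anti (Some P0) None) None_row opprK.
have [-> _] := star_max c l (dg P) (lev P).
have -> : (Num.max 0 (- (l == 1%N)%:Z) = 0 :> int)%R by case: (l == 1).
have -> : (Num.max 0 (l == 1%N)%:Z = (l == 1%N)%:Z :> int)%R by case: (l == 1).
(* At level 1 the mutated vertex receives one arrow from [None], so each horizontal neighbour loses
   one; this is the coefficient [-1] of the neighbours in [exchange_None]. *)
rewrite mulr0 addr0 /exchange_row /exchange_None !flipE /delta.
have := lmin_diag lm; have := pos_neq _ PP0; rewrite -pair_eqE /pair_eq /=.
move: (dg P) (lev P) => c1 l1; clearbody c l; clear.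
case: (l1 =P 1) => [->|n1]; last first.
  move=> _ _; case: (l1 =P l) => [<-|_]; first by rewrite (introF eqP n1) mul0r subr0.
  by rewrite andbF mulr0 subr0.
rewrite [l == 1]eq_sym; case: (1 =P l) => [e|_]; rewrite ?andbF ?andbT ?mul0r ?subr0 ?addr0 //.
move=> n1 c0; rewrite ?andbT in n1; rewrite ?(negPf n1) ?mul1r ?addr0.
have -> : (c1.-1 == c) = (c1 == c.+1) by apply/eqP/eqP; lia.
rewrite [c1.+1 == c]eq_sym.
have : ~~ ((c1 == c.+1) && (c == c1.+1)) by lia.
by case: (c1 == c.+1); case: (c == c1.+1) => //= _; lia.
Qed.

Lemma mutable_far P : lat (dg P) (lev P).+1 -> has_box lam (val P).1.+1 (val P).2.+1.
Proof.
move=> latP; have [b1 b2 b3 b4] := level_bounds yl ym (valP P).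
have : on_diag lam mu (dg P) (val P).1.+1.
  rewrite on_diagE //; move: latP b1 b3; rewrite /lattice /level /=; clear; lia.
case/andP=> _; rewrite has_boxD => /andP[h _]; move: h; congr has_box.
rewrite /diag_of; have := ltn_ord (val P).1.
by move: (nat_of_ord (val P).1) (nat_of_ord (val P).2) => x y; clear; lia.
Qed.

(** Initially [r] depends only on the diagonal, through its starting row. The cases compare the
    diagonals of the two vertices, and consecutive starting rows differ by at most one. *)
Lemma canonical_exchange_quiver :
  exchange_quiver (fun c _ => sg c) (@canonical_quiver k m lam D).
Proof.
split=> [u v|P latP]; first exact: canonical_quiver_skew.
have far := mutable_far latP; have [b1 b2 b3 b4] := level_bounds yl ym (valP P).
have lt := ltn_ord (val P).1.
have [l0 nl0] : 0 < lev P /\ (sg (dg P)).+1 < en (dg P).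
  by split=> //; move: latP; rewrite /lattice /level /=; clear; lia.
have [c0 nR nL] := diag_neighbours yl ym nl0.
have [/andP[s1 s2] /andP[e1 e2]] := diag_steps yl ym (ltnW nl0) nR.
have h3 : sg (dg P).-1.+1 < en (dg P).-1.+1 by rewrite prednK // ltnW.
have [] := diag_steps yl ym nL h3; rewrite prednK // => /andP[s3 s4] /andP[e3 e4].
case=> [Q|]; rewrite /exchange_row.
  rewrite canonical_quiver_Some //; have [d1 d2 d3 d4] := level_bounds yl ym (valP Q).
  have lt' := ltn_ord (val Q).1.
  have dE : dg P = (val P).2 + k - (val P).1 by [].
  have dE' : dg Q = (val Q).2 + k - (val Q).1 by [].
  move: b1 b3 d1 d3 dE dE' lt lt' l0 s1 s2 s3 s4 c0.
  have lq0 : 0 < lev Q by [].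
  move: lq0; rewrite /exchange; clear.
  move: (val P).1 (val P).2 (val Q).1 (val Q).2 => a b a' b'.
  move: (nat_of_ord a) (nat_of_ord b) (nat_of_ord a') (nat_of_ord b') (lev P) (lev Q).
  move=> {}a {}b {}a' {}b' l l'.
  move: (dg P) (dg Q) => c c' lq0 b1 b3 d1 d3 dE dE' lt lt' l0 s1 s2 s3 s4 c0.
  have neS n : (n == n.+1) = false by rewrite eqn_leq ltnn andbF.
  have neS' n : (n.+1 == n) = false by rewrite eq_sym.
  have neSS n : (n == n.+2) = false by apply/eqP; lia.
  have bdE : b + k = c + a by move: dE lt; clear; lia.
  have bdE' : b' + k = c' + a' by move: dE' lt'; clear; lia.
  clear dE dE' lt lt'.
  case: (c' =P c.+1) => [e|n1].
    rewrite e in d1 d3 bdE' *; clear e; rewrite neSS !neS' /=.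
    have -> : (a' == a.+1) && (b' == b) = false by clear - bdE bdE'; lia.
    have -> : (a' == a) && (b' == b.+1) = (a' == a) by clear - bdE bdE'; lia.
    have -> : (a == a'.+1) && (b == b'.+1) = false by clear - bdE bdE'; lia.
    have -> : (a == a'.+1) && (b == b') = (a == a'.+1) by clear - bdE bdE'; lia.
    have -> : (a == a') && (b == b'.+1) = false by clear - bdE bdE'; lia.
    have -> : (a' == a.+1) && (b' == b.+1) = false by clear - bdE bdE'; lia.
    move: (sg c) (sg c.+1) s1 s2 b1 b3 d1 d3 => x y; clear - l0 lq0.
    by move=> s1 s2 b1 b3 d1 d3; do 3?[case: ifP => ?]; lia.
  case: (c =P c'.+1) => [e|n2].
    have e' : c' = c.-1 by rewrite e.
    rewrite -e' in s3 s4; clear s1 s2 e'; subst c; rewrite ?neS ?neS' /=.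
    have -> : (a' == a.+1) && (b' == b) = (a' == a.+1) by clear - bdE bdE'; lia.
    have -> : (a' == a) && (b' == b.+1) = false by clear - bdE bdE'; lia.
    have -> : (a == a'.+1) && (b == b'.+1) = false by clear - bdE bdE'; lia.
    have -> : (a == a'.+1) && (b == b') = false by clear - bdE bdE'; lia.
    have -> : (a == a') && (b == b'.+1) = (a == a') by clear - bdE bdE'; lia.
    have -> : (a' == a.+1) && (b' == b.+1) = false by clear - bdE bdE'; lia.
    move: (sg c'.+1) (sg c') s3 s4 b1 b3 d1 d3 => x y; clear - l0 lq0.
    by move=> s1 s2 b1 b3 d1 d3; do 3?[case: ifP => ?]; lia.
  case: (c' =P c) => [e|n3].
    rewrite e in d1 d3 bdE' *; clear e; rewrite ?neS ?neS' /=.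
    have -> : (a' == a.+1) && (b' == b) = false by clear - bdE bdE'; lia.
    have -> : (a' == a) && (b' == b.+1) = false by clear - bdE bdE'; lia.
    have -> : (a == a'.+1) && (b == b'.+1) = (a == a'.+1) by clear - bdE bdE'; lia.
    have -> : (a == a'.+1) && (b == b') = false by clear - bdE bdE'; lia.
    have -> : (a == a') && (b == b'.+1) = false by clear - bdE bdE'; lia.
    have -> : (a' == a.+1) && (b' == b.+1) = (a' == a.+1) by clear - bdE bdE'; lia.
    move: (sg c) b1 b3 d1 d3 => x; clear - l0 lq0.
    by move=> b1 b3 d1 d3; do 2?[case: ifP => ?]; lia.
  rewrite /=.
  have -> : (a' == a.+1) && (b' == b) = false by clear - bdE bdE' n1 n2 n3; lia.
  have -> : (a' == a) && (b' == b.+1) = false by clear - bdE bdE' n1 n2 n3; lia.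
  have -> : (a == a'.+1) && (b == b'.+1) = false by clear - bdE bdE' n1 n2 n3; lia.
  have -> : (a == a'.+1) && (b == b') = false by clear - bdE bdE' n1 n2 n3; lia.
  have -> : (a == a') && (b == b'.+1) = false by clear - bdE bdE' n1 n2 n3; lia.
  by have -> : (a' == a.+1) && (b' == b.+1) = false by clear - bdE bdE' n1 n2 n3; lia.
rewrite canonical_quiver_None // (has_leftE yl ym (valP P)) (has_upE yl ym (valP P)).
have od c a (j : nat) : k <= a + c -> j = a + c - k -> has_box D a j = (sg c <= a < en c).
  by move=> h ->; rewrite -on_diagE // /on_diag h.
have onP := on_diag_box (valP P); have kP : k <= (val P).1 + dg P by case/andP: onP.
(* The left, upper and northwest neighbours lie on the diagonals [c - 1], [c + 1] and [c]; each is a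
   dot or not according to the starting row of its diagonal. *)
have leftE : (0 < (val P).2) && has_box D (val P).1 (val P).2.-1 = (sg (dg P).-1 <= (val P).1).
  case: (posnP (val P).2) => [b0|bgt] /=.
    apply/esym/negbTE; rewrite -ltnNge; have : ~~ on_diag lam mu (dg P).-1 (val P).1.
      apply/nandP; left; rewrite -ltnNge; move: b0 b4 kP c0.
      by move: (dg P) (nat_of_ord (val P).1) (nat_of_ord (val P).2) => x y t; clear; lia.
    rewrite on_diagE // negb_and -ltnNge -leqNgt => /orP[//|h].
    by have := leq_trans b2 (leq_trans e3 h); rewrite ltnn.
  rewrite (od (dg P).-1); try (move: bgt b4 kP c0; move: (dg P) (nat_of_ord (val P).1) (nat_of_ord (val P).2) => x y t; clear; lia).
  by rewrite (leq_trans b2 e3) andbT.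
have upE : (0 < (val P).1) && has_box D (val P).1.-1 (val P).2 = (sg (dg P).+1 < (val P).1).
  case: (posnP (val P).1) => [a0|agt] /=; first by rewrite a0.
  rewrite (od (dg P).+1); try (move: agt b4 kP; move: (dg P) (nat_of_ord (val P).1) (nat_of_ord (val P).2) => x y t; clear; lia).
  have h : (val P).1.-1 < en (dg P).+1 by rewrite -ltnS prednK // (leq_trans b2 e2).
  by rewrite h andbT -ltnS prednK.
have ulE : [&& 0 < (val P).1, 0 < (val P).2 & has_box D (val P).1.-1 (val P).2.-1]
    = (sg (dg P) < (val P).1).
  case: (posnP (val P).1) => [a0|agt] /=; first by rewrite a0.
  case: (posnP (val P).2) => [b0|bgt] /=.
    apply/esym/negbTE; rewrite -leqNgt; have : ~~ on_diag lam mu (dg P) (val P).1.-1.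
      apply/nandP; left; rewrite -ltnNge; move: b0 b4 kP agt.
      by move: (dg P) (nat_of_ord (val P).1) (nat_of_ord (val P).2) => x y t; clear; lia.
    by rewrite on_diagE // negb_and (leq_ltn_trans (leq_pred _) b2) orbF -ltnNge prednK.
  rewrite (od (dg P)); try (move: agt bgt b4 kP; move: (dg P) (nat_of_ord (val P).1) (nat_of_ord (val P).2) => x y t; clear; lia).
  by rewrite (leq_ltn_trans (leq_pred _) b2) andbT -ltnS prednK.
rewrite leftE upE ulE /exchange_None.
move: b1 b3 l0 s1 s2 s3 s4.
move: (sg (dg P)) (sg (dg P).+1) (sg (dg P).-1) (nat_of_ord (val P).1) (lev P).
move=> x y z a l; clear => b1 b3 l0 s1 s2 s3 s4.
case: eqP => [e|n1].
  have -> : a = x by move: b3; rewrite e /= addn0.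
  have -> : (z <= x) = (z == x) by move: s3 s4; clear; lia.
  have -> : (y < x) = (x == y.+1) by move: s1 s2; clear; lia.
  rewrite ltnn; case: (z =P x) => [e1|n1]; case: (x =P y.+1) => [e2|n2] /=.
  - by move: e1 e2; clear; lia.
  - by move: e1 n2 s1 s2; clear; lia.
  - by move: n1 e2 s3 s4; clear; lia.
  by move: n1 n2 s1 s2 s3 s4; clear; lia.
have -> : z <= a by move: n1 b3 l0 s4; clear; lia.
have -> : y < a by move: n1 b3 l0 s1; clear; lia.
by have -> : x < a by move: n1 b3 l0; clear; lia.
Qed.
End Quiver.

(** * Seeds *)

Local Open Scope ring_scope.

Lemma prod_pair_exp (R : comNzRingType) (T : finType) (f : T -> R) (e : T -> nat) u1 u2 :
    u1 != u2 -> (forall u, e u = (u == u1) || (u == u2)) ->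
  \prod_u f u ^+ e u = f u1 * f u2.
Proof.
move=> ne eE; rewrite (bigD1 u1) //= (bigD1 u2) /=; last by rewrite eq_sym.
rewrite big1 ?mulr1 => [|u /andP[/negPf u1N /negPf u2N]]; last by rewrite eE u1N u2N expr0.
by rewrite !eE !eqxx orbT !expr1.
Qed.

Section Fractions.
Variable A : idomainType.
Implicit Types p q : A.

Lemma tofrac_mulf p1 q1 p2 q2 :
  tofrac p1 / tofrac q1 * (tofrac p2 / tofrac q2) = tofrac (p1 * p2) / tofrac (q1 * q2).
Proof. by rewrite !rmorphM mulf_div. Qed.

Lemma tofrac_addf p1 q1 p2 q2 : tofrac q1 != 0 -> tofrac q2 != 0 ->
  tofrac p1 / tofrac q1 + tofrac p2 / tofrac q2
  = tofrac (p1 * q2 + p2 * q1) / tofrac (q1 * q2).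
Proof. by move=> q10 q20; rewrite rmorphD !rmorphM addf_div. Qed.

Lemma tofrac_invf p q : (tofrac p / tofrac q)^-1 = tofrac q / tofrac p.
Proof. exact: invf_div. Qed.

Lemma tofrac_divr1 p : tofrac p = tofrac p / tofrac 1.
Proof. by rewrite rmorph1 divr1. Qed.
End Fractions.

Section Seeds.
Variables (R : realFieldType) (k m : nat) (lam mu : {set box k m}).
Hypotheses (yl : young_diagram lam) (ym : young_diagram mu) (ml : mu \subset lam).
Notation D := (lam :\: mu).
Implicit Types (M : 'M[R]_(k, k + m)) (g : 'M[R]_(k, k + m) -> R) (f : cluster_field R D)
  (P Q : {p | p \in D}) (v : face D) (r : nat -> nat -> nat).
Local Notation dg P := (diag_of (val P)).
Local Notation lev P := (level lam mu (val P)).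
Local Notation lat := (lattice lam mu).

Definition label_values M (i : 'I_#|{: face D}|) : R :=
  plucker (face_label lam (enum_val i)) M.

(** The relation [specializes_to] for arbitrary functions on matrices, a form that is stable under
    the operations of an exchange relation. *)
Definition has_values f g : Prop := exists p q : {mpoly R[#|{: face D}|]},
  f = tofrac p / tofrac q /\ forall M, in_cell lam D M ->
    q.@[label_values M] != 0 /\ g M = p.@[label_values M] / q.@[label_values M].

Lemma cell_point : exists M, in_cell lam D M.
Proof. by exists (le_matrix lam D (fun=> 1)); apply: in_cell_le_matrix => p; apply: ltr01. Qed.

(** The cell has a point, so a polynomial without zeros on it is not the zero polynomial. *)
Lemma meval_neq0 (q : {mpoly R[#|{: face D}|]}) :
  (forall M, in_cell lam D M -> q.@[label_values M] != 0) -> tofrac q != 0.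
Proof.
move=> q0; have [M cM] := cell_point; rewrite tofrac_eq0; apply: contraNneq (q0 M cM) => ->.
by rewrite meval0.
Qed.

Lemma has_valuesM f1 g1 f2 g2 : has_values f1 g1 -> has_values f2 g2 ->
  has_values (f1 * f2) (fun M => g1 M * g2 M).
Proof.
case=> p1 [q1 [-> h1]] [p2 [q2 [-> h2]]]; exists (p1 * p2), (q1 * q2); split.
  exact: tofrac_mulf.
move=> M cM; have [q10 ->] := h1 M cM; have [q20 ->] := h2 M cM.
by rewrite !mevalM mulf_neq0 // mulf_div.
Qed.

Lemma has_valuesD f1 g1 f2 g2 : has_values f1 g1 -> has_values f2 g2 ->
  has_values (f1 + f2) (fun M => g1 M + g2 M).
Proof.
case=> p1 [q1 [-> h1]] [p2 [q2 [-> h2]]].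
have n1 : tofrac q1 != 0 by apply: meval_neq0 => M /h1[].
have n2 : tofrac q2 != 0 by apply: meval_neq0 => M /h2[].
exists (p1 * q2 + p2 * q1), (q1 * q2); split.
  exact: (tofrac_addf p1 p2 n1 n2).
move=> M cM; have [q10 ->] := h1 M cM; have [q20 ->] := h2 M cM.
by rewrite mevalD !mevalM mulf_neq0 // addf_div.
Qed.

Lemma has_valuesV f g : (forall M, in_cell lam D M -> g M != 0) -> has_values f g ->
  has_values f^-1 (fun M => (g M)^-1).
Proof.
move=> g0 [p [q [-> h]]]; exists q, p; split; first exact: tofrac_invf.
move=> M cM; have [q0 e] := h M cM; have := g0 M cM; rewrite e => n.
split; last by rewrite invf_div.
by apply: contraNneq n => ->; rewrite mul0r.
Qed.

Lemma eq_has_values f g g' : (forall M, in_cell lam D M -> g M = g' M) ->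
  has_values f g -> has_values f g'.
Proof.
by move=> e [p [q [-> h]]]; exists p, q; split=> // M cM; rewrite -e //; apply: h.
Qed.

Definition vertex_label r v : {set 'I_(k + m)} :=
  if v is Some P then state_label lam r (dg P) (lev P) else vlabs lam.

Lemma vertex_label_gt0 r v M : state lam mu r -> in_cell lam D M ->
  0 < plucker (vertex_label r v) M.
Proof.
move=> st cM; case: v => [P|]; last exact: plucker_vlabs_gt0 cM.
have [_ h1 h2] := state_label_box yl ym st (lattice_box yl ym (valP P)).
by apply: interval_index_gt0 cM _ => // _; rewrite h1.
Qed.

Record seed_state r (s : seed (cluster_field R D) (face D)) : Prop := SeedState {
  seed_reachable : reachable (face_frozen lam (D := D)) (initial_seed R lam D) s;
  seed_quiver : exchange_quiver r (quiver s);
  seed_values : forall v, has_values (seed_var s v) (plucker (vertex_label r v))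
}.

Lemma seed_state_init : seed_state (fun c _ => diag_start lam mu c) (initial_seed R lam D).
Proof.
split; first exact: reachable0; first exact: canonical_exchange_quiver.
move=> v; exists 'X_(enum_rank v), 1; split; first exact: tofrac_divr1.
move=> M cM; rewrite meval1 divr1 oner_neq0 mevalXU /label_values enum_rankK.
split=> //; congr plucker; case: v => [P|] //=.
by rewrite canonical_labelE // (valP P).
Qed.

Lemma lattice_vertex c l : lat c l -> exists P, dg P = c /\ lev P = l.
Proof. by move/(lattice_ex yl ym)=> [p pD h]; exists (Sub p pD). Qed.

Lemma vertex_eqE P Q : (P == Q) = (dg P == dg Q) && (lev P == lev Q).
Proof.
by apply/eqP/andP => [->//|[/eqP e1 /eqP e2]]; apply: (vertex_pos_inj yl ym).
Qed.

Lemma seed_state_flip r c l s : state lam mu r -> local_min lam mu r c l ->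
  seed_state r s -> exists s', seed_state (flip r c l) s'.
Proof.
move=> st lm0 [rs qs vs]; have [P0 [cE lE]] := lattice_vertex (lmin_lattice lm0).
move: lm0; rewrite -cE -lE => lm; clear c l cE lE.
set c := dg P0 in lm *; set l := lev P0 in lm *.
exists (mutate_seed (Some P0) s); split.
- apply: reachableS => //; apply: not_frozen => //; apply: mutable_far => //.
  exact: lmin_latticeS lm.
- exact: exchange_quiver_flip.
move=> v; rewrite /=; have [->|vP] := eqVneq v (Some P0); last first.
  have -> : vertex_label (flip r c l) v = vertex_label r v; last exact: vs.
  case: v vP => [Q|//] QP; rewrite /vertex_label flip_other //.
  by move=> e; case/eqP: QP; rewrite (vertex_pos_inj yl ym (congr1 fst e) (congr1 snd e)).
have [Pu [cu lu]] := lattice_vertex (lmin_latticeS lm).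
have [Pr [cr lr]] := lattice_vertex (lmin_latticeR lm).
have [Pl [cl ll]] := lattice_vertex (lmin_latticeL lm).
(* The vertex below: the northwest face if the interval of length [l - 1] is empty, a dot of the
   same diagonal otherwise. *)
have [d [dE dl]] : exists d : face D, vertex_label r d = lower_label lam r c l /\
    (forall v, (v == d) = if v is Some Q then (dg Q == c) && (l == (lev Q).+1) else l == 1%N).
  have [l1|l1] := eqVneq l 1%N.
    exists None; split; first by rewrite /lower_label l1 eqxx.
    by case=> [Q|]; rewrite ?l1 ?eqxx //= eqSS andbF.
  have latd : lat c l.-1.
    by move: (lmin_lattice lm) l1; rewrite /lattice; clear; lia.
  have [Pd [cd ld]] := lattice_vertex latd; exists (Some Pd); split.
    by rewrite /lower_label (negPf l1) /= cd ld.
  case=> [Q|]; last by [].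
  rewrite (inj_eq (@Some_inj _)) vertex_eqE cd ld; congr (_ && _).
  by have := lmin_lattice lm; rewrite /lattice; clear; lia.
have [anti row] := qs.
have mutP : lat c l.+1 := lmin_latticeS lm.
have rowE := row P0 mutP.
(* The three-term relation in the order of [mutate_var]: incoming arrows start at the vertical
   neighbours, outgoing ones end at the horizontal neighbours. *)
apply: (@eq_has_values _ (fun M =>
  (plucker (vertex_label r (Some Pu)) M * plucker (vertex_label r d) M
   + plucker (vertex_label r (Some Pr)) M * plucker (vertex_label r (Some Pl)) M)
  * (plucker (vertex_label r (Some P0)) M)^-1)).
  move=> M cM; rewrite dE /vertex_label -/c -/l cu lu cr lr cl ll.
  have := flip_relation yl ym st lm M => rel.
  have nz : plucker (state_label lam r c l) M != 0.
    by rewrite gt_eqF //; apply: (@vertex_label_gt0 r (Some P0) M).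
  by apply: (mulIf nz); rewrite divfK // rel mulrC addrC [X in X + _]mulrC addrC mulrC.
have prodE (e : face D -> nat) u1 u2 : u1 != u2 -> (forall u, e u = (u == u1) || (u == u2)) ->
    has_values (\prod_u seed_var s u ^+ e u)
      (fun M => plucker (vertex_label r u1) M * plucker (vertex_label r u2) M).
  by move=> ne eE; rewrite (prod_pair_exp _ ne eE); apply: has_valuesM.
apply: has_valuesM; last first.
  apply: has_valuesV (vs _) => M cM; rewrite gt_eqF //; exact: vertex_label_gt0.
apply: has_valuesD.
- apply: prodE => [|u].
    by rewrite dl cu lu eqxx /=; clear; lia.
  rewrite /arrows (anti (Some P0) u) rowE dl; case: u => [Q|] /=.
    rewrite (exchange_local_min _ lm) // (inj_eq (@Some_inj _)) vertex_eqE cu lu.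
    have [_ ->] := star_max c l (dg Q) (lev Q).
    by rewrite absz_nat andb_orr.
  by rewrite (exchange_None_local_min lm) opprK; case: (l == 1%N).
apply: prodE => [|u].
  by rewrite (inj_eq (@Some_inj _)) vertex_eqE cr lr cl ll; clear; lia.
rewrite /arrows rowE; case: u => [Q|] /=.
  rewrite (exchange_local_min _ lm) // !(inj_eq (@Some_inj _)) !vertex_eqE cr lr cl ll.
  have [-> _] := star_max c l (dg Q) (lev Q).
  have -> : (c == (dg Q).+1) = (dg Q == c.-1) by have := lmin_diag lm; clear; lia.
  by rewrite absz_nat -andb_orl.
by rewrite (exchange_None_local_min lm); case: (l == 1%N).
Qed.
End Seeds.

Section Assembly.
Variables (R : realFieldType) (k m : nat) (lam mu : {set box k m}).
Hypotheses (yl : young_diagram lam) (ym : young_diagram mu) (ml : mu \subset lam).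
Notation D := (lam :\: mu).

Lemma diag_set_mutation_cluster :
  mutation_equivalent R lam D (canonical_tp_basis lam D) (diag_set lam D)
  /\ is_cluster R lam D (diag_set lam D).
Proof.
pose good r := clos_refl_trans _ (plucker_mutation R lam D) (canonical_tp_basis lam D)
    (label_set lam mu r) /\ exists s, @seed_state R k m lam mu r s.
have [|r c l st lm [mr [s ss]]|r [st fin [mr [s [rs _ vs]]]]] := @flips_to_final k m lam mu yl ym good.
- split; first by rewrite label_set_init //; apply: rt_refl.
  by exists (initial_seed R lam D); apply: seed_state_init.
- split; last exact: (seed_state_flip yl ym ml st lm ss).
  by apply: rt_trans mr _; apply: rt_step; apply: mutation_flip.
split; first by left; rewrite -(label_set_final yl ym st fin).
exists s => //; split=> [v|H].
  exists (vertex_label r v); last exact: vs.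
  case: v => [P|]; first by apply: final_label_in => //; apply: valP.
  exact: setU11.
case/setU1P=> [->|/imsetP[q qD ->]]; first by exists None; apply: (vs None).
have [p pD <-] := final_label_ex yl ym st fin qD.
by exists (Some (Sub p pD)); apply: (vs (Some (Sub p pD))).
Qed.
End Assembly.

Theorem theorem3 (R : realFieldType) (k m : nat) (lam mu : {set 'I_k * 'I_m})
    (k_gt0 : (0 < k)%N) (lam_young : young_diagram lam)
    (mu_young : young_diagram mu) (mu_lam : mu \subset lam) :
  let D := lam :\: mu in
  [/\ forall (w : 'I_k * 'I_m -> R) (M : 'M[R]_(k, k + m)),
        positive_weights D w -> represents lam D w M ->
        plucker (vlabs lam) M = 1 ->
        forall (x : 'I_k) (y : 'I_m), (x, y) \in D ->
          w (x, y) =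
            diag_minor lam M x y * diag_minor lam M x.+1 y.+2
            / (diag_minor lam M x y.+1 * diag_minor lam M x.+1 y.+1),
      tp_basis R lam D (diag_set lam D) /\
      mutation_equivalent R lam D (canonical_tp_basis lam D) (diag_set lam D) &
      is_cluster R lam D (diag_set lam D)].
Proof.
have [mut clu] := diag_set_mutation_cluster R lam_young mu_young mu_lam.
split; [|split|] => //.
  by move=> w M w0 rep M1 x y xyD; apply: (weight_diag_minors lam_young mu_young mu_lam w0 rep).
exact: tp_basis_diag_set.
Qed.
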